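(* Let $B$ be a paracompact topological space, let $\mathcal{U}=\{U_i\}_{i\in I}$ be a countable open cover of $B$, and let $d\geq 1$. For every $\epsilon\geq 0$, the construction $\mathsf{cl}$ described in the context gives a well-defined map $$\mathsf{cl}:\check{\mathsf H}^1_\epsilon(\mathcal{U};O(d))\to[B,\mathsf{Gr}(d)^{\sqrt2\epsilon}]$$ which is independent of the arbitrary choices made in the construction (the partition of unity subordinate to $\mathcal{U}$ and the enumeration $\iota$ of the opens of $\mathcal{U}$), and which is such that, if $\Omega,\Lambda\in\check{\mathsf H}^1_\epsilon(\mathcal{U};O(d))$ satisfy $\mathsf{d}_{\check{\mathsf H}}(\Omega,\Lambda)<\delta$, then $\mathsf{cl}(\Omega)$ and $\mathsf{cl}(\Lambda)$ become equal in $[B,\mathsf{Gr}(d)^{\sqrt2(\epsilon+\delta)}]$. Moreover, if $\epsilon\leq\sqrt2/4$ and $\Omega\in\check{\mathsf H}^1_\epsilon(\mathcal{U};O(d))$, then there exists $\Lambda\in\check{\mathsf H}^1_0(\mathcal{U};O(d))$ (an exact cohomology class) such that $\pi_*(\mathsf{cl}(\Omega))=\mathsf{cl}(\Lambda)\in[B,\mathsf{Gr}(d)]$ and $\mathsf{d}_{\check{\mathsf H}}(\Omega,\Lambda)\leq 9\epsilon$.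
   Context: Paracompact means Hausdorff and every open cover has a locally finite open refinement. $\|A\|=\sqrt{\mathrm{tr}(A^tA)}$ is the Frobenius norm; $O(d)$ carries the Frobenius distance. $[X,Y]$ is the set of homotopy classes of continuous maps. Grassmannians. $\mathsf{Gr}(d,n)=\{A\in\mathbb{R}^{n\times n}: A=A^t=A^2,\ \mathrm{rank}\,A=d\}$, and $\mathsf V(d,n)$ is the set of real $n\times d$ matrices with orthonormal columns. Padding with zeros (a row and a column for square matrices, a row for $n\times d$ matrices) gives inclusions as $n$ grows, and $\mathsf{Gr}(d)=\bigcup_n\mathsf{Gr}(d,n)$, $\mathsf V(d)=\bigcup_n\mathsf V(d,n)$, $\mathbb{R}^{\infty\times\infty}=\bigcup_n\mathbb{R}^{n\times n}$ have the direct limit topology. For $\epsilon>0$, $\mathsf{Gr}(d)^\epsilon\subseteq\mathbb{R}^{\infty\times\infty}$ is the (open) set of matrices at Frobenius distance $<\epsilon$ from some element of $\mathsf{Gr}(d)$; $\mathsf{Gr}(d)^0=\mathsf{Gr}(d)$. If $\epsilon\leq\sqrt2/2$, every $A\in\mathsf{Gr}(d)^\epsilon$ has a unique Frobenius-closest point $\pi(A)\in\mathsf{Gr}(d)$, the map $\pi:\mathsf{Gr}(d)^\epsilon\to\mathsf{Gr}(d)$ is a homotopy inverse of the inclusion, and $\pi_*:[B,\mathsf{Gr}(d)^\epsilon]\to[B,\mathsf{Gr}(d)]$ is the induced bijection. Approximate cocycles. $N(\mathcal{U})$ is the nerve of $\mathcal{U}$; write $(i_0\dots i_n)\in N(\mathcal{U})$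 for an ordered list with $U_{i_n}\cap\dots\cap U_{i_0}\neq\emptyset$. A 1-cochain is a family of continuous maps $\Omega=\{\Omega_{ij}:U_j\cap U_i\to O(d)\}_{(ij)\in N(\mathcal{U})}$ with $\Omega_{ij}(y)=\Omega_{ji}(y)^{-1}$. For $\epsilon>0$ it is an $\epsilon$-approximate cocycle if $\|\Omega_{ij}(y)\Omega_{jk}(y)-\Omega_{ik}(y)\|<\epsilon$ for all $(ijk)\in N(\mathcal{U})$ and $y\in U_k\cap U_j\cap U_i$; it is an exact cocycle ($\epsilon=0$) if $\Omega_{ij}(y)\Omega_{jk}(y)=\Omega_{ik}(y)$. The set of these is $\mathsf Z^1_\epsilon(\mathcal{U};O(d))$, with metric $\mathsf d_{\mathsf Z}(\Omega,\Lambda)=\sup_{(ij)\in N(\mathcal{U})}\sup_{y\in U_j\cap U_i}\|\Omega_{ij}(y)-\Lambda_{ij}(y)\|$. Families $\Theta=\{\Theta_i:U_i\to O(d)\}_{i\in I}$ of continuous maps form a group acting by $(\Theta\cdot\Omega)_{ij}=\Theta_i\Omega_{ij}\Theta_j^{-1}$; $\check{\mathsf H}^1_\epsilon(\mathcal{U};O(d))$ is the quotient of $\mathsf Z^1_\epsilon(\mathcal{U};O(d))$ by this action, and $\mathsf d_{\check{\mathsf H}}(\Omega,\Lambda)$ is the infimum of $\mathsf d_{\mathsf Z}$ over representatives. For $\epsilon\le\epsilon'$ there is an evident inclusion $\check{\mathsf H}^1_{\epsilon}\subseteq\check{\mathsf H}^1_{\epsilon'}$. Construction of $\mathsf{cl}$.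 Choose a partition of unity $\phi=\{\phi_i\}_{i\in I}$ subordinate to $\mathcal{U}$ and an injection $\iota:I\to\{1,2,3,\dots\}$. For $\Omega\in\mathsf Z^1_\epsilon(\mathcal{U};O(d))$ and $i\in I$ define $\Phi_i:U_i\to\mathsf V(d)$ by declaring, for each $j\in I$, the rows of $\Phi_i(y)$ from $d\,\iota(j)$ to $d(\iota(j)+1)-1$ to be $\sqrt{\phi_j(y)}\,\Omega_{ij}(y)^t$ (zero if $y\notin U_j$), all other rows being zero. Then $\mathsf{cl}([\Omega])$ is the homotopy class of the map $B\to\mathsf{Gr}(d)^{\sqrt2\epsilon}$, $y\mapsto\sum_{i\in I}\phi_i(y)\,\Phi_i(y)\Phi_i(y)^t$. *)

(* Defs.v *)
From HB Require Import structures.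
From mathcomp Require Import all_boot all_order all_algebra generic_quotient.
From mathcomp Require Import all_classical all_reals all_analysis.

Set Implicit Arguments.
Unset Strict Implicit.
Unset Printing Implicit Defensive.
Import Order.TTheory GRing.Theory Num.Theory numFieldNormedType.Exports.

Local Open Scope classical_set_scope.
Local Open Scope ring_scope.
Local Open Scope quotient_scope.

Definition locally_finite (T : topologicalType) (J : Type) (D : set J)
    (F : J -> set T) : Prop :=
  forall x : T, exists2 N, nbhs x N &
    finite_set [set j | D j /\ F j `&` N !=set0].

Definition paracompact (T : topologicalType) : Prop :=
  hausdorff_space T /\
  forall C : set (set T),
    (forall V, C V -> open V) -> \bigcup_(V in C) V = [set: T] ->
    exists D : set (set T),
      [/\ forall W, D W -> open W,
          \bigcup_(W in D) W = [set: T],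
          forall W, D W -> exists2 V, C V & W `<=` V
        & locally_finite D id].

Definition open_cover (T : topologicalType) (I : Type) (U : I -> set T) : Prop :=
  (forall i, open (U i)) /\ \bigcup_i U i = [set: T].

Definition partition_of_unity (R : realType) (T : topologicalType)
    (I : choiceType) (U : I -> set T) (phi : I -> T -> R) : Prop :=
  [/\ forall i, continuous (phi i),
      forall i y, 0 <= phi i y,
      forall i, closure [set y | phi i y != 0] `<=` U i,
      locally_finite [set: I] (fun i => [set y | phi i y != 0])
    & forall y, \sum_(i \in [set: I]) phi i y = 1].

Lemma within_comp (S T Z : topologicalType) (A : set S) (B : set T)
    (f : S -> T) (g : T -> Z) :
  continuous f -> (forall x, A x -> B (f x)) ->
  {within B, continuous g} -> {within A, continuous (g \o f)}.
Proof.
move=> cf AB /subspace_continuousP cg; apply/subspace_continuousP => x Ax.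
have cgx := cg _ (AB _ Ax).
move=> P /cgx /(cf x) /=; rewrite /nbhs /= /within /=.
move=> BP; rewrite -/(nbhs x _) in BP *.
by apply: filterS BP => z h Az; exact/h/AB.
Qed.

Section Homotopy.
Context (R : realType) (X Y : topologicalType).

Definition homotopic (f g : continuousType X Y) : Prop :=
  exists H : X * R -> Y,
    [/\ {within [set: X] `*` `[0, 1], continuous H},
        forall x, H (x, 0) = f x & forall x, H (x, 1) = g x].

Lemma homotopic_refl f : homotopic f f.
Proof.
exists (fun p => f p.1); split=> //.
apply: continuous_subspaceT => p.
apply: (@continuous_comp _ _ _ fst f); first exact: cvg_fst.
exact: cts_fun.
Qed.

Lemma continuous_reparam (u : R -> R) :
  continuous u -> continuous (fun p : X * R => (p.1, u p.2)).
Proof.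
move=> cu [x t].
apply: (@cvg_pair _ _ _ (nbhs (x, t)) (nbhs x) (nbhs (u t)) _ _ _ fst
         (fun p => u p.2)); first exact: cvg_fst.
exact: (@continuous_comp _ _ _ (snd : X * R -> R) u (x, t) cvg_snd (cu t)).
Qed.

Lemma homotopic_sym f g : homotopic f g -> homotopic g f.
Proof.
move=> [H [cH H0 H1]]; exists (fun p => H (p.1, 1 - p.2)); split=> [|x|x] /=.
- apply: (within_comp (f := fun p : X * R => (p.1, 1 - p.2)) _ _ cH).
    apply: (@continuous_reparam (fun t => 1 - t)) => t.
    by apply: cvgB; [exact: cvg_cst | exact: cvg_id].
  move=> [x t] /= [_]; rewrite /= !in_itv /= => /andP[t0 t1]; split=> //.
  by rewrite ?in_itv /= subr_ge0 t1 gerBl.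
- by rewrite subr0.
- by rewrite subrr.
Qed.

Lemma homotopic_trans f g h : homotopic f g -> homotopic g h -> homotopic f h.
Proof.
move=> [H [cH H0 H1]] [K [cK K0 K1]].
pose L (p : X * R) := if p.2 <= 2^-1 then H (p.1, 2 * p.2)
                      else K (p.1, 2 * p.2 - 1).
have h01 : (0 : R) <= 2^-1 by rewrite invr_ge0.
have h11 : (2^-1 : R) < 1 by rewrite invf_lt1// ltr1n.
pose A := [set: X] `*` [set` `[0, 2^-1 : R]].
pose B := [set: X] `*` [set` `[2^-1, 1 : R]].
have closedX (a b : R) : closed ([set: X] `*` [set` `[a, b]]).
  rewrite (_ : _ `*` _ = snd @^-1` [set` `[a, b]]); last first.
    by apply/seteqP; split=> [[x t] []|[x t]].
  apply: preimage_closed; last exact: interval_closed.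
  by move=> p *; exact: (@cvg_snd _ _ (nbhs p.1) (nbhs p.2)).
have mul2 : continuous (fun t : R => 2 * t) by move=> t; exact: mulrl_continuous.
exists L; split=> [|x|x] /=.
- have -> : [set: X] `*` `[0, 1] = A `|` B.
    apply/seteqP; split=> [[x t] [_] /=|[x t]] /=.
      rewrite ?in_itv /= => /andP[t0 t1]; case: (leP t 2^-1) => ht.
        by left; split=> //=; rewrite ?in_itv /= t0.
      by right; split=> //=; rewrite ?in_itv /= (ltW ht).
    case=> -[_] /=; rewrite ?in_itv /= => /andP[t0 t1]; split=> //=.
      by rewrite ?in_itv /= t0 (le_trans t1) ?ltW.
    by rewrite ?in_itv /= t1 (le_trans _ t0).
  apply: withinU_continuous; [exact: closedX|exact: closedX| |].
  + have cHA : {within A, continuous (H \o (fun p : X * R => (p.1, 2 * p.2)))}.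
      apply: within_comp cH; first exact: (@continuous_reparam (fun t => 2 * t)).
      move=> [x t] [_] /=; rewrite ?in_itv /= => /andP[t0 t1]; split=> //=.
      by rewrite ?in_itv /= mulr_ge0 //= mulrC -ler_pdivlMr// mul1r.
    apply: subspace_eq_continuous cHA => -[x t].
    rewrite inE => -[_] /=; rewrite ?in_itv /= => /andP[t0 t1].
    by rewrite /from_subspace /L /= t1.
  + have cKB : {within B, continuous
        (K \o (fun p : X * R => (p.1, 2 * p.2 - 1)))}.
      apply: within_comp cK.
        apply: (@continuous_reparam (fun t => 2 * t - 1)) => t.
        by apply: cvgB; [exact: mul2 | exact: cvg_cst].
      move=> [x t] [_] /=; rewrite ?in_itv /= => /andP[t0 t1]; split=> //=.
      rewrite ?in_itv /= subr_ge0 lerBlDr mulrC -ler_pdivrMr// mul1r t0 /=.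
      by rewrite -ler_pdivlMr// -[1 + 1]/(2%:R) divff ?pnatr_eq0.
    apply: subspace_eq_continuous cKB => -[x t].
    rewrite inE => -[_] /=; rewrite ?in_itv /= => /andP[t0 t1].
    rewrite /from_subspace /L /=; case: ifP => // ht.
    have -> : t = 2^-1 by apply/eqP; rewrite eq_le ht.
    by rewrite divff ?pnatr_eq0// subrr K0 H1.
- by rewrite /L /= h01 mulr0 H0.
- by rewrite /L /= leNgt h11 /= mulr1 -[2]/(1+1) addrK K1.
Qed.

Definition homotopicb : rel (continuousType X Y) :=
  fun f g => `[< homotopic f g >].

Lemma homotopicb_refl : reflexive homotopicb.
Proof. by move=> f; apply/asboolP; exact: homotopic_refl. Qed.

Lemma homotopicb_sym : symmetric homotopicb.
Proof. by move=> f g; apply/asboolP/asboolP; exact: homotopic_sym. Qed.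

Lemma homotopicb_trans : transitive homotopicb.
Proof.
by move=> g f h /asboolP fg /asboolP gh; apply/asboolP/(homotopic_trans fg).
Qed.

Canonical homotopic_equiv :=
  EquivRel homotopicb homotopicb_refl homotopicb_sym homotopicb_trans.

Definition homotopy_classes := {eq_quot homotopic_equiv}.
Definition homotopy_class (f : continuousType X Y) : homotopy_classes :=
  \pi_homotopy_classes f.

Lemma homotopy_classP f g : homotopy_class f = homotopy_class g <-> homotopic f g.
Proof.
split; first by move=> /eqmodP /asboolP.
by move=> fg; apply/eqmodP; apply/asboolP.
Qed.

End Homotopy.

Section Pushforward.
Context (R : realType) (X Y Z : topologicalType).

Definition pushforward_class (g : continuousType Y Z)
    (c : homotopy_classes R X Y) : homotopy_classes R X Z :=
  homotopy_class R (g \o repr c : continuousType X Z).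

Lemma pushforward_classE (g : continuousType Y Z) (f : continuousType X Y) :
  pushforward_class g (homotopy_class R f) =
  homotopy_class R (g \o f : continuousType X Z).
Proof.
apply/homotopy_classP.
have /homotopy_classP[H [cH H0 H1]] :
    homotopy_class R (repr (homotopy_class R f)) = homotopy_class R f.
  by rewrite /homotopy_class reprK.
exists (g \o H); split=> [|x|x] /=; rewrite ?H0 ?H1//.
move=> p.
exact: (@continuous_comp (subspace _) Y Z H g p (cH p) (@cts_fun _ _ g (H p))).
Qed.

End Pushforward.

Definition frobenius (R : realType) m n (A : 'M[R]_(m, n)) : R :=
  Num.sqrt (\tr (A^T *m A)).

Definition mxpad (R : realType) n (M : 'M[R]_n) : nat -> nat -> R := fun p q =>
  if insub p is Some i then if insub q is Some j then M i j else 0 else 0.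

Definition colpad (R : realType) n d (M : 'M[R]_(n, d)) : nat -> 'I_d -> R :=
  fun p c => if insub p is Some i then M i c else 0.

(* The union of the spaces of n x n matrices under zero padding. *)
Record infmx (R : realType) := Infmx {
  infmx_val :> nat -> nat -> R;
  _ : exists n (M : 'M[R]_n), infmx_val = mxpad M
}.

HB.instance Definition _ (R : realType) := gen_eqMixin (infmx R).
HB.instance Definition _ (R : realType) := gen_choiceMixin (infmx R).

Definition to_infmx (R : realType) n (M : 'M[R]_n) : infmx R :=
  @Infmx R (mxpad M) (ex_intro _ n (ex_intro _ M erefl)).

Section InfmxTopology.
Context (R : realType).

Definition infmx_open : set_system (infmx R) :=
  [set V | forall n, open (@to_infmx R n @^-1` V)].

Lemma infmx_openT : infmx_open setT.
Proof. by move=> n; exact: openT. Qed.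

Lemma infmx_openI : setI_closed infmx_open.
Proof. by move=> V W oV oW n; rewrite preimage_setI; exact: openI. Qed.

Lemma infmx_open_bigcup (J : Type) (F : J -> set (infmx R)) :
  (forall j, infmx_open (F j)) -> infmx_open (\bigcup_j F j).
Proof.
by move=> oF n; rewrite preimage_bigcup; apply: bigcup_open => j _; exact: oF.
Qed.

HB.instance Definition _ := isOpenTopological.Build (infmx R)
  infmx_openT infmx_openI infmx_open_bigcup.

End InfmxTopology.

(* [tr (C^T C)] for [C = A - B]; the sums have finite support. *)
Definition infmx_dist (R : realType) (A B : infmx R) : R :=
  Num.sqrt (\sum_(q \in [set: nat]) \sum_(p \in [set: nat])
              (A p q - B p q) * (A p q - B p q)).

Definition Grn (R : realType) (d n : nat) : set 'M[R]_n :=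
  [set A | [/\ A = A^T, A = A *m A & \rank A = d]].
Arguments Grn : clear implicits.

Definition Gr (R : realType) (d : nat) : set (infmx R) :=
  \bigcup_n (@to_infmx R n @` Grn R d n).
Arguments Gr : clear implicits.

Definition Stiefel (R : realType) (d : nat) : set (nat -> 'I_d -> R) :=
  [set A | exists n (M : 'M[R]_(n, d)), M^T *m M = 1%:M /\ A = colpad M].
Arguments Stiefel : clear implicits.

(* For [eta = 0] the set is Gr(d) itself, not the empty strict thickening. *)
Definition Gr_thick (R : realType) (d : nat) (eta : R) : set (infmx R) :=
  if eta == 0 then Gr R d
  else [set A | exists2 P, Gr R d P & infmx_dist A P < eta].
Arguments Gr_thick : clear implicits.

Definition GrSpace (R : realType) (d : nat) : topologicalType :=
  set_type (Gr R d).
Definition GrThick (R : realType) (d : nat) (eta : R) : topologicalType :=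
  set_type (Gr_thick R d eta).

(* [P] is the unique point of Gr(d) at minimal Frobenius distance from [A]. *)
Definition is_closest (R : realType) (d : nat) (A P : infmx R) : Prop :=
  Gr R d P /\ forall Q, Gr R d Q -> Q <> P -> infmx_dist A P < infmx_dist A Q.

Section Inclusion.
Context (T : topologicalType) (A B : set T) (AB : A `<=` B).

Definition set_incl (x : set_type A) : set_type B :=
  exist _ (val x) (mem_set (AB (set_valP x))).

Lemma set_incl_continuous : continuous set_incl.
Proof.
apply/continuousP => _ [V oV <-].
have -> : set_incl @^-1` (set_val @^-1` V) = set_val @^-1` V by [].
by exists V.
Qed.

HB.instance Definition _ :=
  @isContinuous.Build (set_type A) (set_type B) set_incl set_incl_continuous.

End Inclusion.

Lemma infmx_distxx (R : realType) (A : infmx R) : infmx_dist A A = 0.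
Proof.
rewrite /infmx_dist fsbig1 ?sqrtr0// => q _.
by rewrite fsbig1// => p _; rewrite subrr mul0r.
Qed.

Lemma Gr_thick_le (R : realType) (d : nat) (eta eta' : R) :
  0 <= eta -> eta <= eta' -> Gr_thick R d eta `<=` Gr_thick R d eta'.
Proof.
move=> eta0 le; rewrite /Gr_thick; case: eqP => [eta_eq0|/eqP etaN0].
  case: eqP => [_ A|/eqP etaN0' A GA]; first by [].
  exists A => //.
  by rewrite infmx_distxx lt_neqAle eq_sym etaN0' (le_trans eta0).
have eta_gt0 : 0 < eta by rewrite lt_neqAle eq_sym etaN0.
rewrite (negPf (lt0r_neq0 (lt_le_trans eta_gt0 le))).
by move=> A [P GP AP]; exists P => //; exact: lt_le_trans AP le.
Qed.

Lemma Gr_thick0 (R : realType) (d : nat) :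
  Gr_thick R d (Num.sqrt 2 * 0) `<=` Gr R d.
Proof. by rewrite mulr0 /Gr_thick eqxx. Qed.

Lemma Gr_thickD (R : realType) (d : nat) (eps delta : R) :
  0 <= eps -> 0 <= delta ->
  Gr_thick R d (Num.sqrt 2 * eps) `<=` Gr_thick R d (Num.sqrt 2 * (eps + delta)).
Proof.
move=> eps0 delta0; apply: Gr_thick_le; first by rewrite mulr_ge0 ?sqrtr_ge0.
by rewrite ler_wpM2l ?sqrtr_ge0// lerDl.
Qed.

Definition GrThick_exact (R : realType) (d : nat) :
    continuousType (GrThick d (Num.sqrt 2 * 0 : R)) (GrSpace R d) :=
  set_incl (@Gr_thick0 R d).

Definition GrThick_incl (R : realType) (d : nat) (eps delta : R)
    (eps0 : 0 <= eps) (delta0 : 0 <= delta) :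
    continuousType (GrThick d (Num.sqrt 2 * eps))
                   (GrThick d (Num.sqrt 2 * (eps + delta))) :=
  set_incl (@Gr_thickD R d eps delta eps0 delta0).

Definition orthogonal (R : realType) (d : nat) : set 'M[R]_d :=
  [set A | A^T *m A = 1%:M].

Section MatrixContinuity.
Context (R : realType) (X : topologicalType).

Lemma mx_continuous m n (f : X -> 'M[R]_(m, n)) :
  (forall i j, continuous (fun x => f x i j)) -> continuous f.
Proof.
move=> cf x P [Q Qf QP].
apply: (@filterS _ (nbhs x) _ (fun z => forall i j, Q i j (f z i j))).
  by move=> z Qz; apply: QP.
apply: filter_forall => i; apply: filter_forall => j.
exact: (cf i j x _ (Qf i j)).
Qed.

Lemma entry_continuous m n (f : X -> 'M[R]_(m, n)) i j :
  continuous f -> continuous (fun x => f x i j).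
Proof.
move=> cf x; apply: (@continuous_comp _ _ _ f (fun M : 'M[R]_(m, n) => M i j)).
  exact: cf.
exact: coord_continuous.
Qed.

Lemma sum_continuous (J : Type) (r : seq J) (h : J -> X -> R) :
  (forall k, continuous (h k)) -> continuous (fun x => \sum_(k <- r) h k x).
Proof.
move=> ch; elim: r => [|k r IHr].
  under [X in continuous X]funext => x do rewrite big_nil.
  by move=> x; exact: cvg_cst.
under [X in continuous X]funext => x do rewrite big_cons.
by move=> x; apply: cvgD; [exact: ch | exact: IHr].
Qed.

Lemma mulmx_continuous m n p (f : X -> 'M[R]_(m, n)) (g : X -> 'M[R]_(n, p)) :
  continuous f -> continuous g -> continuous (fun x => f x *m g x).
Proof.
move=> cf cg; apply: mx_continuous => i j.
under [X in continuous X]funext => x do rewrite mxE.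
apply: sum_continuous => k x.
by apply: cvgM; exact: entry_continuous.
Qed.

Lemma trmx_continuous m n (f : X -> 'M[R]_(m, n)) :
  continuous f -> continuous (fun x => (f x)^T).
Proof.
move=> cf; apply: mx_continuous => i j.
under [X in continuous X]funext => x do rewrite mxE.
exact: entry_continuous.
Qed.

End MatrixContinuity.

Section Orthogonal.
Context (R : realType) (d : nat).
Implicit Types A B : 'M[R]_d.

Lemma orthogonal1 : orthogonal (1%:M : 'M[R]_d).
Proof. by rewrite /orthogonal /= trmx1 mulmx1. Qed.

Lemma orthogonal_unit A : orthogonal A -> A \in unitmx.
Proof. by move=> /mulmx1_unit[]. Qed.

Lemma orthogonal_inv A : orthogonal A -> invmx A = A^T.
Proof.
move=> oA; have uA := orthogonal_unit oA.
by rewrite -[LHS]mul1mx -oA -mulmxA mulmxV// mulmx1.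
Qed.

Lemma orthogonalV A : orthogonal A -> orthogonal (invmx A).
Proof.
move=> oA; rewrite orthogonal_inv// /orthogonal /= trmxK.
exact: mulmx1C.
Qed.

Lemma orthogonalM A B : orthogonal A -> orthogonal B -> orthogonal (A *m B).
Proof.
move=> oA oB; rewrite /orthogonal /= trmx_mul -mulmxA (mulmxA A^T) oA.
by rewrite mul1mx.
Qed.

End Orthogonal.

Section Cocycles.
Context (R : realType) (B : topologicalType) (I : choiceType).
Context (U : I -> set B) (d : nat).

(* A family of maps [Omega i j : U_j `&` U_i -> O(d)] is encoded by its
   extension by 0 to B, so that Leibniz equality is equality of families. Index
   pairs outside the nerve have an empty overlap and carry no data. *)
Definition cochain (Omega : I -> I -> B -> 'M[R]_d) : Prop :=
  [/\ forall i j, {within U j `&` U i, continuous (Omega i j)},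
      forall i j y, U j y -> U i y -> orthogonal (Omega i j y),
      forall i j y, U j y -> U i y -> Omega i j y = invmx (Omega j i y)
    & forall i j y, ~ (U j `&` U i) y -> Omega i j y = 0].

Definition cocycle_condition (eps : R) (Omega : I -> I -> B -> 'M[R]_d) : Prop :=
  forall i j k y, U k y -> U j y -> U i y ->
    if eps == 0 then Omega i j y *m Omega j k y = Omega i k y
    else frobenius (Omega i j y *m Omega j k y - Omega i k y) < eps.

Record Z1 (eps : R) := MkZ1 {
  Z1_val :> I -> I -> B -> 'M[R]_d;
  Z1_cochain : cochain Z1_val;
  Z1_cocycle : cocycle_condition eps Z1_val
}.

HB.instance Definition _ (eps : R) := gen_eqMixin (Z1 eps).
HB.instance Definition _ (eps : R) := gen_choiceMixin (Z1 eps).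

Definition dZ (Omega Lambda : I -> I -> B -> 'M[R]_d) : R :=
  sup [set sup [set frobenius (Omega ij.1 ij.2 y - Lambda ij.1 ij.2 y)
                 | y in U ij.2 `&` U ij.1]
        | ij in [set ij | U ij.2 `&` U ij.1 !=set0]].

Definition gauge (Theta : I -> B -> 'M[R]_d) : Prop :=
  forall i, {within U i, continuous (Theta i)} /\
            forall y, U i y -> orthogonal (Theta i y).

Definition cohomologous (Omega Lambda : I -> I -> B -> 'M[R]_d) : Prop :=
  exists2 Theta, gauge Theta & forall i j y, U j y -> U i y ->
    Lambda i j y = Theta i y *m Omega i j y *m invmx (Theta j y).

Lemma cohomologous_refl Omega : cohomologous Omega Omega.
Proof.
exists (fun _ _ => 1%:M) => [i|i j y _ _].
  split=> [|y _]; last exact: orthogonal1.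
  by apply: continuous_subspaceT => y; exact: cvg_cst.
by rewrite invmx1 mul1mx mulmx1.
Qed.

Lemma cohomologous_sym Omega Lambda :
  cohomologous Omega Lambda -> cohomologous Lambda Omega.
Proof.
move=> [Th gT E]; exists (fun i y => invmx (Th i y)) => [i|i j y Ujy Uiy].
  have [cT oT] := gT i; split=> [|y Uy]; last exact/orthogonalV/oT.
  have cT' : {within U i, continuous (fun y => (Th i y)^T)}.
    exact: (@trmx_continuous R (subspace (U i)) d d (Th i)).
  apply: subspace_eq_continuous cT' => y; rewrite inE => Uy.
  by rewrite /from_subspace orthogonal_inv//; exact: oT.
have uT k : U k y -> Th k y \in unitmx.
  by move=> Uky; apply/orthogonal_unit/(gT k).2.
by rewrite E// invmxK !mulmxA mulVmx ?uT// mul1mx -mulmxA mulVmx ?uT// mulmx1.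
Qed.

Lemma cohomologous_trans Omega Lambda Xi :
  cohomologous Omega Lambda -> cohomologous Lambda Xi -> cohomologous Omega Xi.
Proof.
move=> [S gS ES] [T gT ET]; exists (fun i y => T i y *m S i y).
  move=> i; have [cS oS] := gS i; have [cT oT] := gT i; split=> [|y Uy].
    exact: (@mulmx_continuous R (subspace (U i)) d d d (T i) (S i)).
  by apply: orthogonalM; [exact: oT | exact: oS].
move=> i j y Ujy Uiy; rewrite ET// ES//.
have oS := (gS j).2 _ Ujy; have oT := (gT j).2 _ Ujy.
rewrite [invmx (_ *m _)]orthogonal_inv ?trmx_mul; last exact: orthogonalM.
by rewrite !orthogonal_inv// !mulmxA.
Qed.

Definition cohomologousb (eps : R) : rel (Z1 eps) :=
  fun Omega Lambda => `[< cohomologous Omega Lambda >].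

Lemma cohomologousb_refl eps : reflexive (@cohomologousb eps).
Proof. by move=> O; apply/asboolP; exact: cohomologous_refl. Qed.

Lemma cohomologousb_sym eps : symmetric (@cohomologousb eps).
Proof. by move=> O L; apply/asboolP/asboolP; exact: cohomologous_sym. Qed.

Lemma cohomologousb_trans eps : transitive (@cohomologousb eps).
Proof.
by move=> O L X /asboolP OL /asboolP LX; apply/asboolP/(cohomologous_trans OL).
Qed.

Canonical cohomologous_equiv eps := EquivRel (@cohomologousb eps)
  (@cohomologousb_refl eps) (@cohomologousb_sym eps) (@cohomologousb_trans eps).

Definition H1 (eps : R) := {eq_quot (cohomologous_equiv eps)}.
Definition H1_class (eps : R) (Omega : Z1 eps) : H1 eps := \pi_(H1 eps) Omega.

Lemma H1_classP eps (Omega Lambda : Z1 eps) :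
  H1_class Omega = H1_class Lambda <-> cohomologous Omega Lambda.
Proof.
split; first by move=> /eqmodP /asboolP.
by move=> OL; apply/eqmodP; apply/asboolP.
Qed.

Definition dH (eps : R) (c c' : H1 eps) : R :=
  inf [set dZ Omega Lambda | Omega in [set Omega : Z1 eps | H1_class Omega = c]
                           & Lambda in [set Lambda : Z1 eps | H1_class Lambda = c']].

Lemma cocycle_condition_le (eps eps' : R) Omega : 0 <= eps -> eps <= eps' ->
  cocycle_condition eps Omega -> cocycle_condition eps' Omega.
Proof.
move=> eps0 le cO i j k y Uk Uj Ui; have := cO i j k y Uk Uj Ui.
case: eqP => [_|/eqP epsN0]; case: eqP => [e'0|/eqP eps'N0] //.
- move=> ->; rewrite subrr /frobenius mulmx0 mxtrace0 sqrtr0.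
  by rewrite lt_neqAle eq_sym eps'N0 (le_trans eps0).
- by case/eqP: epsN0; apply/eqP; rewrite eq_le eps0 -e'0 le.
- by move=> /lt_le_trans; apply.
Qed.

Definition Z1_incl (eps eps' : R) (eps0 : 0 <= eps) (le : eps <= eps')
    (Omega : Z1 eps) : Z1 eps' :=
  MkZ1 (Z1_cochain Omega) (cocycle_condition_le eps0 le (@Z1_cocycle _ Omega)).

Definition H1_incl (eps eps' : R) (eps0 : 0 <= eps) (le : eps <= eps')
    (c : H1 eps) : H1 eps' := H1_class (Z1_incl eps0 le (repr c)).

Lemma H1_inclE eps eps' (eps0 : 0 <= eps) (le : eps <= eps') (Omega : Z1 eps) :
  H1_incl eps0 le (H1_class Omega) = H1_class (Z1_incl eps0 le Omega).
Proof.
apply/H1_classP => /=.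
have /H1_classP : H1_class (repr (H1_class Omega)) = H1_class Omega.
  by rewrite /H1_class reprK.
by [].
Qed.

(* Rows are numbered from 1, so the row of index [p : nat] is row [p.+1]; row
   [r] of the block of [j] is row [d * iota j + r]. The block is zero when
   [y] is not in [U j], because [Omega i j] vanishes there. *)
Definition Phi (phi : I -> B -> R) (iota : I -> nat)
    (Omega : I -> I -> B -> 'M[R]_d) (i : I) (y : B) : nat -> 'I_d -> R :=
  fun p c => \sum_(j \in [set: I]) \sum_(r < d | p.+1 == (d * iota j + r)%N)
    Num.sqrt (phi j y) * (Omega i j y)^T r c.

Definition cl_matrix (phi : I -> B -> R) (iota : I -> nat)
    (Omega : I -> I -> B -> 'M[R]_d) (y : B) : nat -> nat -> R :=
  fun p q => \sum_(i \in [set: I]) phi i y *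
    \sum_(c < d) Phi phi iota Omega i y p c * Phi phi iota Omega i y q c.

Definition enumeration (iota : I -> nat) : Prop :=
  injective iota /\ forall i, (0 < iota i)%N.

End Cocycles.

(* The subspace topology on Gr(d) is the direct limit of the topologies of the
   Gr(d, n). *)

Section GrassmannianTopology.
Context (R : realType) (d : nat).

Lemma mxpad_ord n (A : 'M[R]_n) (i j : 'I_n) : mxpad A i j = A i j.
Proof. by rewrite /mxpad !valK. Qed.

Lemma mxpad_out n (A : 'M[R]_n) (p q : nat) :
  (n <= p)%N || (n <= q)%N -> mxpad A p q = 0.
Proof.
rewrite /mxpad; case: insubP => // i _ <-; case: insubP => // j _ <-.
by rewrite [(n <= i)%N]leqNgt [(n <= j)%N]leqNgt !ltn_ord.
Qed.

Lemma fsum_ord n (F : nat -> R) : (forall p, (n <= p)%N -> F p = 0) ->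
  \sum_(p \in [set: nat]) F p = \sum_(k < n) F k.
Proof.
move=> F0; rewrite (fsbig_ord _ n F); apply/esym/fsbig_widen => //.
  by move=> p /= [_] /negP; rewrite -leqNgt => /F0.
Qed.

Lemma mxpad_trmx n (A : 'M[R]_n) (p q : nat) : mxpad A^T p q = mxpad A q p.
Proof. 
by rewrite /mxpad; case: (insub p) => [i|]; case: (insub q) => [j|]; rewrite ?mxE. Qed.

Lemma mxpad_mul n (A : 'M[R]_n) (p q : nat) :
  mxpad (A *m A) p q = \sum_(r \in [set: nat]) mxpad A p r * mxpad A r q.
Proof.
have [np|pn] := leqP n p.
  rewrite mxpad_out ?np// fsbig1// => r _.
  by rewrite mxpad_out ?np// mul0r.
have [nq|qn] := leqP n q.
  rewrite mxpad_out ?nq ?orbT// fsbig1// => r _.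
  by rewrite (@mxpad_out n A r) ?nq ?orbT// mulr0.
rewrite (@fsum_ord n); last by move=> r nr; rewrite mxpad_out ?nr ?orbT// mul0r.
rewrite (_ : mxpad _ p q = mxpad (A *m A) (Ordinal pn) (Ordinal qn))//.
rewrite mxpad_ord mxE; apply: eq_bigr => k _.
by rewrite -[p]/(nat_of_ord (Ordinal pn)) -[q]/(nat_of_ord (Ordinal qn)) !mxpad_ord.
Qed.

Lemma mxpad_tr n (A : 'M[R]_n) :
  \sum_(p \in [set: nat]) mxpad A p p = \tr A.
Proof.
rewrite (@fsum_ord n) => [|p np]; last by rewrite mxpad_out ?np.
by apply: eq_bigr => k _; rewrite mxpad_ord.
Qed.

Lemma idem_tr n (A : 'M[R]_n) : A = A *m A -> \tr A = (\rank A)%:R.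
Proof.
move=> AA; move: (row_base A) (col_base A) (mulmx_base A) (row_base_free A)
  (col_base_full A) => rb cb cbrb rbF /row_fullP[D Dcb].
suff E : rb *m cb = 1%:M by rewrite -[in LHS]cbrb mxtrace_mulC E mxtrace1.
apply: (row_free_inj rbF); rewrite mul1mx.
have H : cb *m (rb *m cb *m rb) = cb *m rb.
  by rewrite !mulmxA cbrb -mulmxA cbrb -AA.
by move/(congr1 (mulmx D)): H; rewrite !mulmxA Dcb !mul1mx.
Qed.

Lemma GrnE n (A : 'M[R]_n) :
  Grn R d n A <-> [/\ A = A^T, A = A *m A & \tr A = d%:R].
Proof.
split=> -[sA AA rA]; split=> //; first by rewrite idem_tr// rA.
by move: rA; rewrite idem_tr// => /eqP; rewrite eqr_nat => /eqP.
Qed.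

Lemma Gr_to_infmx n (A : 'M[R]_n) : Gr R d (to_infmx A) -> Grn R d n A.
Proof.
move=> [m _ [P GP /(congr1 (@infmx_val R)) /= E]].
have EE p q : mxpad P p q = mxpad A p q by rewrite E.
case/GrnE: GP => sP PP tP; apply/GrnE; split.
- apply/matrixP => i j; rewrite mxE -!mxpad_ord -!EE.
  by rewrite [in LHS]sP mxpad_trmx.
- by apply/matrixP => i j; rewrite -!mxpad_ord mxpad_mul -E -mxpad_mul -PP.
- by rewrite -mxpad_tr -E mxpad_tr.
Qed.

Lemma Grn_closed n : closed (Grn R d n).
Proof.
have eq_closed (f g : 'M[R]_n -> 'M[R]_n) :
    continuous f -> continuous g -> closed [set A | f A = g A].
  move=> cf cg.
  have -> : [set A | f A = g A] =
      \bigcap_(ij in [set: 'I_n * 'I_n])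
        [set A | f A ij.1 ij.2 - g A ij.1 ij.2 = 0].
    apply/seteqP; split=> [A /= fg ij _|A fg] /=; first by rewrite fg subrr.
    by apply/matrixP => i j; apply/eqP; rewrite -subr_eq0; apply/eqP/(fg (i, j)).
  apply: closed_bigI => -[i j] _ /=.
  apply: (preimage_closed (f := fun A => f A i j - g A i j) (D := [set 0])).
    move=> A *; have hf := @entry_continuous R _ n n f i j cf A.
    have hg := @entry_continuous R _ n n g i j cg A.
    exact: (cvgB hf hg).
  exact: closed_eq.
have cid : continuous (fun A : 'M[R]_n => A) by move=> A; exact: cvg_id.
have -> : Grn R d n = [set A | A = A^T] `&` [set A | A = A *m A] `&`
    [set A | \tr A = d%:R].
  apply/seteqP; split=> [A /GrnE[]//|A [[sA AA] tA]]; exact/GrnE.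
apply: closedI; first apply: closedI.
- by apply: eq_closed => //; exact: trmx_continuous.
- by apply: eq_closed => //; exact: mulmx_continuous.
- apply: (preimage_closed (f := fun A : 'M[R]_n => \tr A) (D := [set d%:R])).
    move=> A *; apply: sum_continuous => k; exact: (entry_continuous cid).
  exact: closed_eq.
Qed.

Definition Gr_incl n (A : set_type (Grn R d n)) : GrSpace R d :=
  exist _ (to_infmx (val A)) (mem_set (ex_intro2 _ _ n Logic.I
    (ex_intro2 _ _ (val A) (set_valP A) erefl))).

Lemma GrSpace_openP (V : set (GrSpace R d)) :
  open V <-> forall n, open (@Gr_incl n @^-1` V).
Proof.
split=> [[W oW <-] n|oV].
  by exists (@to_infmx R n @^-1` W); first exact: oW.
pose W := ~` [set A | exists2 x : GrSpace R d, ~ V x & val x = A].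
exists W; last first.
  apply/seteqP; split=> [x /= Wx|x Vx] /=.
    by apply: contrapT => nVx; apply: Wx; exists x.
  by move=> [x' nVx' /val_inj E]; apply: nVx'; rewrite E.
move=> n; have [W' oW' EW] := oV n.
suff -> : @to_infmx R n @^-1` W = W' `|` ~` Grn R d n.
  by apply: openU => //; apply: closed_openC; exact: Grn_closed.
apply/seteqP; split=> [A WA|A].
  have [GA|] := pselect (Grn R d n A); last by right.
  left; pose a : set_type (Grn R d n) := exist _ A (mem_set GA).
  suff : (set_val @^-1` W') a by [].
  by rewrite EW /=; apply: contrapT => nV; apply: WA; exists (Gr_incl a).
case=> [W'A [x nVx xA]|nGA [x _ xA]].
  have GA : Grn R d n A by apply: Gr_to_infmx; rewrite -xA; exact: set_valP.
  pose a : set_type (Grn R d n) := exist _ A (mem_set GA).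
  apply: nVx; suff -> : x = Gr_incl a.
    by have : (set_val @^-1` W') a by []; rewrite EW.
  exact: val_inj.
by apply: nGA; apply: Gr_to_infmx; rewrite -xA; exact: set_valP.
Qed.

End GrassmannianTopology.

(* Main.v *)
(* The class of [Omega] is carried by the frames [Phi_i], and the homotopies
   needed are paths of frames: averaging the projections [Phi_i Phi_i^T] stays
   in the thickened Grassmannian because
   [|F F^T - G G^T| <= sqrt 2 * |F - G|] for orthonormal frames and because
   [|Phi_i Omega_ij - Phi_j| < eps]. Partitions of unity are joined linearly;
   a change of enumeration or of gauge rotates the blocks of rows one after the
   other into free rows; close cocycles are joined by a straight line.

   For [eps <= sqrt 2 / 4] the matrices considered are at distance less than
   1/2 from Gr(d). There a minimiser [P] of the distance to [A] commutes with
   the symmetric part of [A], which makes it the unique one, and compactness of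
   the Gr(d, n) makes it depend continuously on [A]. The frames [Phi_i] project
   to the image of [P], and their polar parts [Psi_i] there, given by a
   contraction argument for the inverse square root, differ by the exact cocycle
   [Lambda_ij = Psi_i^T Psi_j]. When [Phi] uses the even rows and the
   construction for [Lambda] the odd ones, the paths
   [sqrt (1 - t) Psi_i + sqrt t Phi'_i] of frames join [P] to the class of
   [Lambda]. *)
From HB Require Import structures.
Require Import Defs.
From mathcomp Require Import all_boot all_order all_algebra ring lra zify.
From mathcomp Require Import all_classical all_reals all_analysis.
Import Order.TTheory GRing.Theory Num.Theory numFieldNormedType.Exports.

Set Implicit Arguments.
Unset Strict Implicit.
Unset Printing Implicit Defensive.

Local Open Scope classical_set_scope.
Local Open Scope ring_scope.

(** * The Frobenius norm *)


(** Infinitely many opens may be involved, so no single matrix size serves all of [B]. Sizes are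
    controlled only near each point, by predicates such as [bnd n x], and whatever must be defined
    on all of [B] is written with sums over [nat]. This is why a closest point has to inherit the
    zero rows of its matrix: it then has the same size, and it vanishes on rows kept free for
    another enumeration. Radius 0 means equality rather than an empty strict inequality, whence the
    tests [eps == 0].

    The bound [eps <= sqrt 2 / 4] enters twice. The mean is then less than 1/2 from the projection
    [Q] of a frame, which is what uniqueness of the closest point [P] needs. As [P] is no farther
    from the mean than [Q], the distance from [Q] to [P] is less than [2 sqrt 2 eps <= 1], which is
    what the inverse square root needs. Passing to the polar part moves a frame by at most that
    distance; the inner product of two frames, itself within [eps] of [Omega], moves by at most
    twice as much, and 9 is a rounding of [1 + 4 sqrt 2]. *)

Section Frobenius.
Context (R : realType).

Lemma mxtrace_trmul m n (A B : 'M[R]_(m, n)) :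
  \tr (A^T *m B) = \sum_i \sum_j A i j * B i j.
Proof.
rewrite exchange_big; apply: eq_bigr => j _; rewrite mxE.
by apply: eq_bigr => i _; rewrite mxE.
Qed.

Lemma mxtrace_sqr_ge0 m n (A : 'M[R]_(m, n)) : 0 <= \tr (A^T *m A).
Proof.
rewrite mxtrace_trmul; apply: sumr_ge0 => i _; apply: sumr_ge0 => j _.
by rewrite -expr2 sqr_ge0.
Qed.

Lemma frobenius_ge0 m n (A : 'M[R]_(m, n)) : 0 <= frobenius A.
Proof. exact: sqrtr_ge0. Qed.

Lemma sqr_frobenius m n (A : 'M[R]_(m, n)) : frobenius A ^+ 2 = \tr (A^T *m A).
Proof. by rewrite sqr_sqrtr// mxtrace_sqr_ge0. Qed.

Lemma sqr_frobeniusE m n (A : 'M[R]_(m, n)) :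
  frobenius A ^+ 2 = \sum_i \sum_j A i j ^+ 2.
Proof. by rewrite sqr_frobenius mxtrace_trmul. Qed.

Lemma frobeniusE m n (A : 'M[R]_(m, n)) :
  frobenius A = Num.sqrt (\sum_i \sum_j A i j ^+ 2).
Proof. by rewrite -sqr_frobeniusE sqrtr_sqr ger0_norm ?frobenius_ge0. Qed.

Lemma frobenius_le m n p q (A : 'M[R]_(m, n)) (B : 'M[R]_(p, q)) :
  (frobenius A <= frobenius B) = (frobenius A ^+ 2 <= frobenius B ^+ 2).
Proof. by rewrite ler_sqr// nnegrE frobenius_ge0. Qed.

Lemma frobenius0 m n : frobenius (0 : 'M[R]_(m, n)) = 0.
Proof. by rewrite /frobenius mulmx0 mxtrace0 sqrtr0. Qed.

Lemma frobenius_eq0 m n (A : 'M[R]_(m, n)) : frobenius A = 0 -> A = 0.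
Proof.
move=> A0; apply/matrixP => i j; apply/eqP; rewrite mxE -sqrf_eq0.
have : \sum_i \sum_j A i j ^+ 2 == 0 by rewrite -sqr_frobeniusE A0 expr0n.
rewrite psumr_eq0 => [/allP/(_ i)|k _]; last by apply: sumr_ge0 => l _; exact: sqr_ge0.
rewrite mem_index_enum => /(_ isT) /=.
rewrite psumr_eq0 => [/allP/(_ j)|k _]; last exact: sqr_ge0.
by rewrite mem_index_enum => /(_ isT).
Qed.

Lemma frobenius_tr m n (A : 'M[R]_(m, n)) : frobenius A^T = frobenius A.
Proof. by rewrite /frobenius trmxK mxtrace_mulC. Qed.

Lemma trmxZ m n a (A : 'M[R]_(m, n)) : (a *: A)^T = a *: A^T.
Proof. by rewrite linearZ. Qed.

Lemma trmxB m n (A B : 'M[R]_(m, n)) : (A - B)^T = A^T - B^T.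
Proof. by rewrite linearB. Qed.

Lemma trmxD m n (A B : 'M[R]_(m, n)) : (A + B)^T = A^T + B^T.
Proof. by rewrite linearD. Qed.

Lemma frobeniusZ m n a (A : 'M[R]_(m, n)) : frobenius (a *: A) = `|a| * frobenius A.
Proof.
rewrite /frobenius [(a *: A)^T]linearZ /= -scalemxAl -scalemxAr scalerA mxtraceZ -expr2.
by rewrite sqrtrM ?sqr_ge0// sqrtr_sqr.
Qed.

Lemma frobeniusN m n (A : 'M[R]_(m, n)) : frobenius (- A) = frobenius A.
Proof. by rewrite -scaleN1r frobeniusZ normrN1 mul1r. Qed.

Lemma frobeniusBC m n (A B : 'M[R]_(m, n)) : frobenius (A - B) = frobenius (B - A).
Proof. by rewrite -frobeniusN opprB. Qed.

Lemma mxtrace_trmulC m n (A B : 'M[R]_(m, n)) : \tr (A^T *m B) = \tr (B^T *m A).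
Proof. by rewrite -mxtrace_tr trmx_mul trmxK. Qed.

Lemma sqr_frobeniusD m n (A B : 'M[R]_(m, n)) :
  frobenius (A + B) ^+ 2 =
  frobenius A ^+ 2 + 2 * \tr (A^T *m B) + frobenius B ^+ 2.
Proof.
rewrite !sqr_frobenius [(A + B)^T]linearD /= mulmxDl !mulmxDr !mxtraceD.
rewrite [\tr (B^T *m A)]mxtrace_trmulC; ring.
Qed.

Lemma sqr_frobeniusB m n (A B : 'M[R]_(m, n)) :
  frobenius (A - B) ^+ 2 =
  frobenius A ^+ 2 - 2 * \tr (A^T *m B) + frobenius B ^+ 2.
Proof.
by rewrite sqr_frobeniusD frobeniusN mulmxN raddfN mulrN.
Qed.

(** Cauchy-Schwarz for the trace inner product, from the square of [|B| A - |A| B]; zero matrices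
    are set aside because a factor [|A| |B|] is cancelled at the end. *)
Lemma mxtrace_trmul_le m n (A B : 'M[R]_(m, n)) :
  \tr (A^T *m B) <= frobenius A * frobenius B.
Proof.
have [->|A0] := eqVneq A 0; first by rewrite frobenius0 trmx0 mul0mx mxtrace0 mul0r.
have [->|B0] := eqVneq B 0; first by rewrite frobenius0 mulmx0 mxtrace0 mulr0.
have pos m' n' (C : 'M[R]_(m', n')) : C != 0 -> 0 < frobenius C.
  move=> C0; rewrite lt_neqAle frobenius_ge0 andbT eq_sym.
  by apply: contra C0 => /eqP/frobenius_eq0 ->.
have a0 := pos _ _ _ A0; have b0 := pos _ _ _ B0.
have := sqr_ge0 (frobenius (frobenius B *: A - frobenius A *: B)).
rewrite sqr_frobeniusB !frobeniusZ.
have -> : \tr ((frobenius B *: A)^T *m (frobenius A *: B)) =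
    frobenius B * frobenius A * \tr (A^T *m B).
  by rewrite [(_ *: A)^T]linearZ /= -scalemxAl -scalemxAr scalerA mxtraceZ.
rewrite !ger0_norm ?frobenius_ge0//.
have : 0 < frobenius B * frobenius A by exact: mulr_gt0.
move: (frobenius A) (frobenius B) (\tr _) => a b t ab h.
have {}h : 0 <= (b * a) * (a * b - t) *+ 2.
  by apply: le_trans h _; rewrite le_eqVlt; apply/orP; left; apply/eqP; rewrite mulr2n; ring.
by rewrite pmulrn_lge0// pmulr_rge0// subr_ge0 in h.
Qed.

Lemma frobeniusD m n (A B : 'M[R]_(m, n)) :
  frobenius (A + B) <= frobenius A + frobenius B.
Proof.
rewrite -ler_sqr ?nnegrE ?addr_ge0 ?frobenius_ge0//.
by rewrite sqr_frobeniusD; have := mxtrace_trmul_le A B; lra.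
Qed.

Lemma frobeniusB_le m n (A B C : 'M[R]_(m, n)) :
  frobenius (A - C) <= frobenius (A - B) + frobenius (B - C).
Proof. by apply: le_trans (frobeniusD _ _); rewrite addrA subrK. Qed.

Lemma norm_mxtrace_trmul_le m n (A B : 'M[R]_(m, n)) :
  `|\tr (A^T *m B)| <= frobenius A * frobenius B.
Proof.
rewrite ler_norml mxtrace_trmul_le andbT lerNl -raddfN -mulmxN.
by apply: le_trans (mxtrace_trmul_le _ _) _; rewrite frobeniusN.
Qed.

(** Each entry of the product is the inner product of a row of [A] and a column of [B]; the
    Cauchy-Schwarz bounds add up to the product of the squared norms. *)
Lemma frobeniusM m n p (A : 'M[R]_(m, n)) (B : 'M[R]_(n, p)) :
  frobenius (A *m B) <= frobenius A * frobenius B.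
Proof.
rewrite -ler_sqr ?nnegrE ?mulr_ge0 ?frobenius_ge0// exprMn !sqr_frobeniusE.
rewrite [X in _ <= _ * X]exchange_big /= mulr_suml; apply: ler_sum => i _.
rewrite mulr_sumr; apply: ler_sum => j _.
have h := norm_mxtrace_trmul_le (row i A)^T (col j B).
have {h} := lerXn2r 2 _ _ h; rewrite !nnegrE normr_ge0 mulr_ge0 ?frobenius_ge0//.
move=> /(_ isT isT); rewrite real_normK ?num_real// exprMn.
rewrite trmxK frobenius_tr !sqr_frobeniusE big_ord1.
under [X in _ <= X * _ -> _]eq_bigr do rewrite mxE.
under [X in _ <= _ * X -> _]eq_bigr do rewrite big_ord1 mxE.
suff -> : \tr (row i A *m col j B) = (A *m B) i j by [].
rewrite /mxtrace big_ord1 !mxE; apply: eq_bigr => k _; by rewrite !mxE.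
Qed.

Lemma entry_le_frobenius m n (A : 'M[R]_(m, n)) i j : `|A i j| <= frobenius A.
Proof.
rewrite -ler_sqr ?nnegrE ?normr_ge0 ?frobenius_ge0// real_normK ?num_real// sqr_frobeniusE.
rewrite (bigD1 i)//= (bigD1 j)//= -addrA lerDl addr_ge0// sumr_ge0// => k _.
  exact: sqr_ge0.
by apply: sumr_ge0 => l _; exact: sqr_ge0.
Qed.

Lemma frobenius_isometry m n p (F : 'M[R]_(m, n)) (A : 'M[R]_(n, p)) :
  F^T *m F = 1%:M -> frobenius (F *m A) = frobenius A.
Proof. by move=> oF; rewrite /frobenius trmx_mul -mulmxA (mulmxA F^T) oF mul1mx. Qed.

(** Pythagoras for the projection [F F^T]: [|A|^2 - |F^T A|^2 = |A - F F^T A|^2]. *)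
Lemma frobenius_trisometry m n p (F : 'M[R]_(m, n)) (A : 'M[R]_(m, p)) :
  F^T *m F = 1%:M -> frobenius (F^T *m A) <= frobenius A.
Proof.
move=> oF; have := sqr_ge0 (frobenius (A - F *m (F^T *m A))).
rewrite sqr_frobeniusB (frobenius_isometry _ oF) mulmxA.
have -> : \tr (A^T *m F *m (F^T *m A)) = frobenius (F^T *m A) ^+ 2.
  by rewrite sqr_frobenius trmx_mul trmxK.
by rewrite frobenius_le => h; lra.
Qed.

(** The squares differ by a square: [2 |F - G|^2 - |F F^T - G G^T|^2 = 2 |F^T G - 1|^2]. *)
Lemma frobenius_proj m n (F G : 'M[R]_(m, n)) :
  F^T *m F = 1%:M -> G^T *m G = 1%:M ->
  frobenius (F *m F^T - G *m G^T) <= Num.sqrt 2 * frobenius (F - G).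
Proof.
move=> oF oG.
rewrite -ler_sqr ?nnegrE ?mulr_ge0 ?sqrtr_ge0 ?frobenius_ge0//.
rewrite exprMn (@sqr_sqrtr _ 2)//.
have trP (H : 'M[R]_(m, n)) : H^T *m H = 1%:M -> frobenius (H *m H^T) ^+ 2 = n%:R.
  move=> oH; rewrite (frobenius_isometry _ oH) frobenius_tr sqr_frobenius oH.
  by rewrite mxtrace1.
have trF (H : 'M[R]_(m, n)) : H^T *m H = 1%:M -> frobenius H ^+ 2 = n%:R.
  by move=> oH; rewrite sqr_frobenius oH mxtrace1.
rewrite !sqr_frobeniusB !trP// !trF//.
have := sqr_ge0 (frobenius (F^T *m G - 1%:M)); rewrite sqr_frobeniusB.
rewrite mulmx1 mxtrace_tr [frobenius 1%:M ^+ 2]sqr_frobenius trmx1 mulmx1 mxtrace1.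
have -> : \tr ((F *m F^T)^T *m (G *m G^T)) = frobenius (F^T *m G) ^+ 2.
  by rewrite sqr_frobenius !trmx_mul !trmxK !mulmxA mxtrace_mulC !mulmxA.
by move=> h; lra.
Qed.

End Frobenius.

(** * Partitions of unity on paracompact spaces *)


Section LocallyFiniteSums.
Context (R : realType).

Lemma fsbig_seqT (J : choiceType) (s : seq J) (F : J -> R) :
  uniq s -> (forall j, j \notin s -> F j = 0) ->
  \sum_(j \in [set: J]) F j = \sum_(j <- s) F j.
Proof.
move=> us F0; rewrite (fsbigE s)//; last by move=> j _ /F0.
by under eq_bigl do rewrite in_setT.
Qed.

(** Local finiteness in the form needed for sums: near each point one list carries all nonzero
    terms, so the sum is there a fixed finite one. *)
Definition locally_supported (T : topologicalType) (J : choiceType)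
    (f : J -> T -> R) :=
  forall x : T, exists2 s : seq J, uniq s &
    \forall y \near x, forall j, j \notin s -> f j y = 0.

Lemma locally_finite_supported (T : topologicalType) (J : choiceType)
    (f : J -> T -> R) :
  locally_finite [set: J] (fun j => [set y | f j y != 0]) -> locally_supported f.
Proof.
move=> lf x; have [N Nx /finite_seqP[s sE]] := lf x.
exists (undup s); first exact: undup_uniq.
apply: filterS Nx => y Ny j; rewrite mem_undup => /negP js.
apply/eqP; apply/negPn/negP => fj; apply: js.
by have : [set` s] j by rewrite -sE /=; split=> //; exists y.
Qed.

Lemma near_eq_continuous (S T : topologicalType) (x : S) (f g : S -> T) :
  {near x, f =1 g} -> {for x, continuous f} -> {for x, continuous g}.
Proof.
move=> E cf; have Ex : f x = g x := nbhs_singleton E.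
change (g @ x --> g x); rewrite -Ex; exact: cvg_trans (near_eq_cvg E) cf.
Qed.

Lemma fsum_continuous (T : topologicalType) (J : choiceType) (f : J -> T -> R) :
  locally_supported f -> (forall j, continuous (f j)) ->
  continuous (fun x => \sum_(j \in [set: J]) f j x).
Proof.
move=> lf cf x; have [s us sN] := lf x.
have E : {near x, (fun x => \sum_(j <- s) f j x) =1
                  (fun x => \sum_(j \in [set: J]) f j x)}.
  by apply: filterS sN => y f0; rewrite (fsbig_seqT us)// => j /f0.
exact: near_eq_continuous E (@sum_continuous R T J s f cf x).
Qed.

End LocallyFiniteSums.

Section Paracompact.
Context (T : topologicalType).

(** Only finitely many members meet [N], so the union [E] of their closures is closed; a point
    outside [E] would have the neighbourhood [N] minus [E], which misses every member. *)
Lemma closure_locally_finite (J : choiceType) (D : set J) (F : J -> set T) :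
  locally_finite D F ->
  closure (\bigcup_(j in D) F j) `<=` \bigcup_(j in D) closure (F j).
Proof.
move=> lf x clx; have [N Nx fin] := lf x.
set J0 := [set j | _] in fin.
pose E := \bigcup_(j in J0) closure (F j).
have cE : closed E by apply: closed_bigcup => // j _; exact: closed_closure.
have [[j [Dj _] Ex]|nEx] := pselect (E x); first by exists j.
have Nx' : nbhs x (N `&` ~` E).
  by apply: filterI => //; apply: open_nbhs_nbhs; split=> //; exact: closed_openC.
have [z [[j Dj Fz] [Nz nEz]]] := clx _ Nx'.
by exfalso; apply: nEz; exists j; [split=> //; exists z|exact: subset_closure].
Qed.

Hypothesis pT : paracompact T.

(** Refine the cover by [O] and the separating sets. Members not contained in [O] have closures that
    miss [A], and by local finiteness so does the closure of their union; its complement is the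
    required set. Used twice: the Hausdorff property separates points, then regularity separates
    points from closed sets. *)
Lemma paracompact_separation (A O : set T) : open O -> A `<=` O ->
  (forall y, ~ O y -> exists V, [/\ open V, V y & closure V `&` A = set0]) ->
  exists V, [/\ open V, A `<=` V & closure V `<=` O].
Proof.
move=> oO AO sep.
pose C := [set V | open V /\ (V `<=` O \/ closure V `&` A = set0)].
have [||D [oD cD DC lfD]] := pT.2 C; first by move=> V [].
  apply/seteqP; split=> // y _; have [Oy|nOy] := pselect (O y).
    by exists O => //; split=> //; left.
  by have [V [oV Vy VA]] := sep _ nOy; exists V => //; split=> //; right.
pose D' := D `&` [set W | ~ W `<=` O].
pose W0 := \bigcup_(W in D') W.
have lfD' : locally_finite D' id.
  move=> x; have [N Nx fin] := lfD x; exists N => //.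
  by apply: sub_finite_set fin => W [[DW _] WN].
have oW0 : open W0 by apply: bigcup_open => W [DW _]; exact: oD.
exists (~` closure W0); split.
- exact/closed_openC/closed_closure.
- move=> a Aa /(closure_locally_finite lfD')[W [DW nWO] cWa].
  have [V [oV [VO|VA]] WV] := DC _ DW.
    by apply: nWO; exact: subset_trans VO.
  have : (closure V `&` A) a by split=> //; exact: closure_subset cWa.
  by rewrite VA.
- move=> y cly; have : (~` W0) y.
    have /closure_id -> : closed (~` W0) by exact: open_closedC.
    by apply: closure_subset cly; apply: subsetC; exact: subset_closure.
  have : [set: T] y by []. 
  rewrite -cD => -[W DW Wy] nW0; apply: contrapT => nOy; apply: nW0.
  by exists W => //; split=> // /(_ _ Wy).
Qed.

Lemma paracompact_regular (x : T) (O : set T) : open O -> O x ->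
  exists V, [/\ open V, V x & closure V `<=` O].
Proof.
move=> oO Ox; have [|y nOy|V [oV xV VO]] := @paracompact_separation [set x] O oO.
- by move=> _ ->.
- have yx : y != x by apply: contra_notN nOy => /eqP ->.
  have := pT.1; rewrite open_hausdorff => /(_ _ _ yx)[[V W]] /=.
  rewrite !inE => -[Vy Wx] [oV oW VW]; exists V; split=> //.
  apply/seteqP; split=> // z [cVz zx]; move: cVz; rewrite zx => /(_ W).
  by case=> [|t /= VWt]; [exact: open_nbhs_nbhs|by have : (set0 : set T) t by rewrite -VW].
by exists V; split=> //; exact: xV.
Qed.

Lemma paracompact_shrink (A O : set T) : closed A -> open O -> A `<=` O ->
  exists V, [/\ open V, A `<=` V & closure V `<=` O].
Proof.
move=> cA oO AO; apply: paracompact_separation => // y nOy.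
have [||V [oV Vy VA]] := @paracompact_regular y (~` A).
- exact: closed_openC.
- by move=> /AO.
exists V; split=> //; apply/seteqP; split=> // z [/VA]; exact.
Qed.

Lemma paracompact_normal (R : realType) : normal_space T.
Proof.
apply/(@normal_openP R) => A B cA cB AB.
have [||V [oV AV VB]] := @paracompact_shrink A (~` B) cA.
- exact: closed_openC.
- by move=> x Ax Bx; have : (A `&` B) x by []; rewrite AB.
exists V, (~` closure V); split=> //; first exact/closed_openC/closed_closure.
  by move=> x Bx /VB.
by apply/seteqP; split=> // x [Vx]; apply; exact: subset_closure.
Qed.

Lemma paracompact_cover_shrink (I : choiceType) (U : I -> set T) : open_cover U ->
  exists V : I -> set T, [/\ open_cover V, forall i, closure (V i) `<=` U i
    & locally_finite [set: I] V].
Proof.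
move=> [oU cU].
pose C := [set V | open V /\ exists i, closure V `<=` U i].
have [||D [oD cD DC lfD]] := pT.2 C; first by move=> V [].
  apply/seteqP; split=> // y _; have : [set: T] y by [].
  rewrite -cU => -[i _ Uiy].
  have [V [oV Vy VU]] := paracompact_regular (oU i) Uiy.
  by exists V => //; split=> //; exists i.
(* One index per member of the refinement, and [None] for sets outside [D]. The shrunk set of [i]
   will be the union of the members with index [i], so a neighbourhood that meets finitely many
   members meets finitely many of these unions. *)
have {}DC (W : set T) : exists i : option I, D W -> 
    exists2 j, i = Some j & closure W `<=` U j.
  have [DW|nDW] := pselect (D W); last by exists None.
  have [V [oV [i VU]] WV] := DC _ DW; exists (Some i) => _; exists i => //.
  exact: subset_trans (closure_subset WV) VU.
have {DC}[c cP] := choice DC.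
pose Di i := D `&` [set W | c W = Some i].
exists (fun i => \bigcup_(W in Di i) W); split.
- split=> [i|]; first by apply: bigcup_open => W [DW _]; exact: oD.
  apply/seteqP; split=> // y _; have : [set: T] y by [].
  rewrite -cD => -[W DW Wy]; have [i ci _] := cP _ DW.
  by exists i => //; exists W.
- move=> i; have lfi : locally_finite (Di i) id.
    move=> x; have [N Nx fin] := lfD x; exists N => //.
    by apply: sub_finite_set fin => W [[DW _] WN].
  apply: subset_trans (closure_locally_finite lfi) _ => y [W [DW cW] Wy].
  by have [j] := cP _ DW; rewrite cW => -[<-]; exact.
- move=> x; have [N Nx fin] := lfD x; exists N => //.
  apply: (@sub_finite_set _ _
    (\bigcup_(W in [set W | D W /\ id W `&` N !=set0]) [set i | c W = Some i])).
    by move=> i [_ [y [[W [DW cW] Wy] Ny]]]; exists W => //; split=> //; exists y.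
  apply: bigcup_finite => // W _; case: (c W) => [i|].
    by apply: (@sub_finite_set _ _ [set i]) => // j [->].
  by apply: (@sub_finite_set _ _ set0).
Qed.

(** Two shrinkings leave room for Urysohn functions [f i], equal to 1 on [closure (V' i)] and to 0
    off [V i]. As the sets [V' i] cover, the locally finite sum [S] is positive and can be divided
    by. *)
Lemma paracompact_partition_of_unity (R : realType) (I : choiceType)
    (U : I -> set T) :
  open_cover U -> exists phi : I -> T -> R, partition_of_unity U phi.
Proof.
move=> /paracompact_cover_shrink[V [[oV cV] VU lfV]].
have [V' [[oV' cV'] V'V _]] := paracompact_cover_shrink (conj oV cV).
have /choice[f fP] i : exists f : T -> R, [/\ continuous f,
    forall y, 0 <= f y, forall y, ~ V i y -> f y = 0 &
    forall y, closure (V' i) y -> f y = 1].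
  have /(@normal_separatorP R) := paracompact_normal R.
  move=> /(_ (~` V i) (closure (V' i)) _ _ _)/(uniform_separatorP _ _).1.
  move=> /(_ R)[|||g [cg g01 g0 g1]].
  - exact: open_closedC.
  - exact: closed_closure.
  - by apply/seteqP; split=> // y [nVy /V'V].
  exists g; split=> // [y|y Vy|y Vy].
  - by have : range g (g y) by []; move=> /g01 /=; rewrite in_itv => /andP[].
  - by apply: g0; exists y.
  - by apply: g1; exists y.
pose S y := \sum_(i \in [set: I]) f i y.
have lff : locally_finite [set: I] (fun i => [set y | f i y != 0]).
  move=> x; have [N Nx fin] := lfV x; exists N => //.
  apply: sub_finite_set fin => i [_ [y [/= fy Ny]]]; split=> //; exists y; split=> //.
  by apply: contrapT => nVy; have [_ _ f0 _] := fP i; rewrite f0// eqxx in fy.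
have lsf := locally_finite_supported lff.
have cS : continuous S by apply: fsum_continuous => // i; have [] := fP i.
have S_gt0 y : 0 < S y.
  have : [set: T] y by [].
  rewrite -cV' => -[i _ V'y]; have [s us /nbhs_singleton f0] := lsf y.
  have [_ _ _ f1] := fP i.
  have is_ : i \in s.
    apply: contraT => /f0; rewrite f1; last exact: subset_closure.
    by move/eqP; rewrite oner_eq0.
  rewrite /S (fsbig_seqT us)// (bigD1_seq i)//= f1; last exact: subset_closure.
  rewrite ltr_pwDl// sumr_ge0// => j _; by have [] := fP j.
exists (fun i y => f i y / S y); split.
- move=> i y; have [cf _ _ _] := fP i; apply: cvgM; first exact: cf.
  by apply: cvgV; [rewrite gt_eqF|exact: cS].
- by move=> i y; have [_ f_ge0 _ _] := fP i; rewrite divr_ge0// ltW.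
- move=> i; apply: subset_trans (VU i); apply: closure_subset => y /=.
  have [_ _ f0 _] := fP i => fy; apply: contrapT => nVy.
  by rewrite f0// mul0r eqxx in fy.
- move=> x; have [N Nx fin] := lff x; exists N => //.
  apply: sub_finite_set fin => i [_ [y [/= fy Ny]]]; split=> //; exists y; split=> //=.
  by apply: contra fy => /eqP ->; rewrite mul0r.
- move=> y; have [s us /nbhs_singleton f0] := lsf y.
  rewrite (fsbig_seqT us) => [|j /f0 ->]; last by rewrite mul0r.
  rewrite -mulr_suml -(fsbig_seqT us) => [|j /f0//].
  by rewrite divff// gt_eqF// S_gt0.
Qed.

End Paracompact.

(** * Closest projections *)


(** Heine-Borel, carried over from row vectors by [vec_mx]: the bound confines each entry to a
    segment. *)
Lemma frobenius_bounded_compact (R : realType) m n (A : set 'M[R]_(m, n)) (M : R) :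
  closed A -> (forall x, A x -> frobenius x <= M) -> compact A.
Proof.
move=> cA AM.
have cv : continuous (@vec_mx R m n).
  apply: mx_continuous => i j.
  under [X in continuous X]funext => v do rewrite mxE.
  exact: coord_continuous.
have -> : A = @vec_mx R m n @` (@vec_mx R m n @^-1` A).
  apply/seteqP; split=> [x Ax|_ [v Av <-]//].
  by exists (mxvec x); rewrite /= mxvecK.
apply: continuous_compact; first exact: continuous_subspaceT.
apply: (@subclosed_compact _ _
  [set v : 'rV[R]_(m * n) | forall i, v ord0 i \in `[- M, M]]).
- by apply: preimage_closed => // v _ _; exact: cv.
- apply: (@rV_compact _  _ (fun=> `[- M, M]%classic)) => _.
  exact: segment_compact.
- move=> v /= /AM vM k; case/mxvec_indexP: k => i j.
  rewrite in_itv /= -ler_norml; apply: le_trans vM.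
  have -> : v ord0 (mxvec_index i j) = vec_mx v i j by rewrite mxE.
  exact: entry_le_frobenius.
Qed.

Lemma frobenius_continuous (R : realType) m n : continuous (@frobenius R m n).
Proof.
move=> A; apply: (@continuous_comp _ _ _
  (fun A : 'M[R]_(m, n) => \tr (A^T *m A)) Num.sqrt); last exact: sqrt_continuous.
have cid : continuous (fun A : 'M[R]_(m, n) => A) by move=> ?; exact: cvg_id.
apply: sum_continuous => k; apply: entry_continuous.
by apply: mulmx_continuous => //; exact: trmx_continuous.
Qed.

Section MatrixContinuity.
Context (R : realType) (X : topologicalType) (m n : nat).

Lemma addmx_continuous (f g : X -> 'M[R]_(m, n)) :
  continuous f -> continuous g -> continuous (fun x => f x + g x).
Proof.
move=> cf cg; apply: mx_continuous => i j.
under [X in continuous X]funext => x do rewrite mxE.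
by move=> x; apply: cvgD; exact: entry_continuous.
Qed.

Lemma scalemx_continuous (a : X -> R) (f : X -> 'M[R]_(m, n)) :
  continuous a -> continuous f -> continuous (fun x => a x *: f x).
Proof.
move=> ca cf; apply: mx_continuous => i j.
under [X in continuous X]funext => x do rewrite mxE.
by move=> x; apply: cvgM; [exact: ca|exact: entry_continuous].
Qed.

Lemma oppmx_continuous (f : X -> 'M[R]_(m, n)) :
  continuous f -> continuous (fun x => - f x).
Proof.
move=> cf; apply: mx_continuous => i j.
under [X in continuous X]funext => x do rewrite mxE.
by move=> x; apply: cvgN; exact: entry_continuous.
Qed.

Lemma cstmx_continuous (A : 'M[R]_(m, n)) : continuous (fun _ : X => A).
Proof. by move=> x; exact: cvg_cst. Qed.

End MatrixContinuity.

Lemma idmx_continuous (R : realType) m n : continuous (fun A : 'M[R]_(m, n) => A).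
Proof. by move=> x; exact: cvg_id. Qed.

(** * Projections of a fixed size and the distance to them *)

Section Grassmannian.
Context (R : realType) (d n : nat).
Implicit Types A P Q S E : 'M[R]_n.

Definition symmx A : 'M[R]_n := 2^-1 *: (A + A^T).

Lemma symmx_tr A : (symmx A)^T = symmx A.
Proof. by rewrite /symmx linearZ /= linearD /= trmxK addrC. Qed.

Lemma mxtrace_symmx A Q : Q^T = Q -> \tr (A^T *m Q) = \tr (symmx A *m Q).
Proof.
move=> sQ; rewrite /symmx -scalemxAl mxtraceZ mulmxDl mxtraceD.
have -> : \tr (A *m Q) = \tr (A^T *m Q).
  by rewrite -[LHS]mxtrace_tr trmx_mul sQ mxtrace_mulC.
by field.
Qed.

Lemma symmx_dist A P : P^T = P -> frobenius (symmx A - P) <= frobenius (A - P).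
Proof.
move=> sP; have -> : symmx A - P = 2^-1 *: ((A - P) + (A - P)^T).
  rewrite [(A - P)^T]linearB /= sP /symmx addrACA -opprD scalerBr.
  by rewrite -[P + P]mulr2n -[P *+ 2]scaler_nat scalerA mulVf ?pnatr_eq0// scale1r.
rewrite frobeniusZ ger0_norm ?invr_ge0//.
have := frobeniusD (A - P) (A - P)^T; rewrite frobenius_tr => h; lra.
Qed.

Lemma GrnP P : Grn R d n P -> [/\ P^T = P, P *m P = P & \tr P = d%:R].
Proof. by move=> /GrnE[sP PP tP]; split. Qed.

Lemma sqr_frobenius_Grn P : Grn R d n P -> frobenius P ^+ 2 = d%:R.
Proof. by move=> /GrnP[sP PP tP]; rewrite sqr_frobenius sP PP. Qed.

Lemma sqr_frobenius_sub_Grn A Q : Grn R d n Q ->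
  frobenius (A - Q) ^+ 2 = frobenius A ^+ 2 - 2 * \tr (symmx A *m Q) + d%:R.
Proof.
move=> GQ; have [sQ _ _] := GrnP GQ.
by rewrite sqr_frobeniusB (sqr_frobenius_Grn GQ) mxtrace_symmx.
Qed.

Lemma mxtrace_quad_le m E (C : 'M[R]_(m, n)) :
  `|\tr (E *m (C^T *m C))| <= frobenius E * frobenius C ^+ 2.
Proof.
rewrite mxtrace_mulC -mulmxA; apply: le_trans (norm_mxtrace_trmul_le _ _) _.
rewrite mulrC expr2 mulrA ler_wpM2r ?frobenius_ge0//.
by rewrite [leRHS]mulrC frobeniusM.
Qed.

(** For positive semidefinite [X] the bound is by its trace, which can be compared with the linear
    quantity [tau] of [commuting_closest]. *)
Lemma mxtrace_quad_sym m E (C : 'M[R]_(m, n)) X : C^T *m C = X ->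
  `|\tr (E *m X)| <= frobenius E * \tr X.
Proof. by move=> <-; rewrite -sqr_frobenius mxtrace_quad_le. Qed.

(** With [symmx A = P + E] the claim becomes [tr ((P + E) P) > tr ((P + E) Q)]. Since [E] commutes
    with [P], it meets only the diagonal blocks of [Q] for [P] and [1 - P]. Both [P - P Q P] and the
    second block are positive semidefinite of trace [tau], so the error is at most
    [2 |E| tau < tau]. *)
Lemma commuting_closest A P Q :
  Grn R d n P -> Grn R d n Q -> P *m symmx A = symmx A *m P ->
  frobenius (A - P) < 2^-1 -> Q <> P -> frobenius (A - P) < frobenius (A - Q).
Proof.
move=> GP GQ comm AP QP.
have [sP PP tP] := GrnP GP; have [sQ QQ tQ] := GrnP GQ.
rewrite -ltr_sqr ?nnegrE ?frobenius_ge0// !sqr_frobenius_sub_Grn//.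
pose E := symmx A - P.
have cE : P *m E = E *m P by rewrite mulmxBr mulmxBl comm.
have Elt : frobenius E < 2^-1 by apply: le_lt_trans AP; exact: symmx_dist.
have AE : symmx A = P + E by rewrite addrC subrK.
clearbody E.
pose tau := d%:R - \tr (P *m Q).
have tau_gt0 : 0 < tau.
  have : 0 < frobenius (P - Q) ^+ 2.
    rewrite exprn_gt0// lt_neqAle frobenius_ge0 andbT eq_sym; apply/eqP.
    by move=> /frobenius_eq0/eqP; rewrite subr_eq0 eq_sym => /eqP.
  by rewrite sqr_frobeniusB !sqr_frobenius_Grn// sP /tau => h; lra.
have h1 : `|\tr (E *m (P - P *m Q *m P))| <= frobenius E * tau.
  have -> : tau = \tr (P - P *m Q *m P).
    by rewrite raddfB /= tP [\tr (P *m Q *m P)]mxtrace_mulC mulmxA PP.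
  apply: (@mxtrace_quad_sym _ _ ((1%:M - Q) *m P)).
  rewrite trmx_mul sP [(1%:M - Q)^T]linearB /= trmx1 sQ.
  have QQ' : (1%:M - Q) *m (1%:M - Q) = 1%:M - Q.
    by rewrite mulmxBl mul1mx mulmxBr mulmx1 QQ subrr subr0.
  have -> : P *m (1%:M - Q) *m ((1%:M - Q) *m P) =
    P *m ((1%:M - Q) *m (1%:M - Q)) *m P by rewrite !mulmxA.
  rewrite QQ'.
  by rewrite mulmxBr mulmx1 mulmxBl PP.
pose P' := 1%:M - P.
have sP' : P'^T = P' by rewrite /P' linearB /= trmx1 sP.
have PP' : P' *m P' = P'.
  by rewrite /P' mulmxBl mul1mx mulmxBr mulmx1 PP subrr subr0.
have h2 : `|\tr (E *m (P' *m Q *m P'))| <= frobenius E * tau.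
  have -> : tau = \tr (P' *m Q *m P').
    by rewrite mxtrace_mulC mulmxA PP' /P' mulmxBl mul1mx raddfB /= tQ.
  apply: (@mxtrace_quad_sym _ _ (Q *m P')).
  by rewrite trmx_mul sP' sQ -!mulmxA (mulmxA Q Q) QQ.
have cE' : P' *m E = E *m P' by rewrite /P' mulmxBl mulmxBr mul1mx mulmx1 cE.
have eQ : \tr (E *m Q) = \tr (E *m (P *m Q *m P)) + \tr (E *m (P' *m Q *m P')).
  have key Z : Z *m Z = Z -> Z *m E = E *m Z ->
      \tr (E *m (Z *m Q *m Z)) = \tr (E *m (Z *m Q)).
    by move=> ZZ cZ; rewrite mulmxA mxtrace_mulC !mulmxA cZ -(mulmxA E Z Z) ZZ.
  by rewrite !key// -mxtraceD -mulmxDr -mulmxDl /P' addrC subrK mul1mx.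
rewrite AE !mulmxDl !mxtraceD PP eQ tP.
have : \tr (E *m P) - \tr (E *m (P *m Q *m P)) = \tr (E *m (P - P *m Q *m P)).
  by rewrite mulmxBr raddfB.
move: h1 h2; rewrite !ler_norml => /andP[h1 _] /andP[_ h2] h3.
have : frobenius E * tau < 2^-1 * tau by rewrite ltr_pM2r.
rewrite /tau in tau_gt0 h1 h2 *; lra.
Qed.

(** Confines [P] to the rows where [A] lives: with [E = symmx A - P] one gets [K P = - K P E], and
    [|E| < 1/2] leaves only [K P = 0]. *)
Lemma commuting_kernel A P m (K : 'M[R]_(m, n)) :
  Grn R d n P -> P *m symmx A = symmx A *m P ->
  frobenius (A - P) < 2^-1 -> K *m A = 0 -> K *m A^T = 0 -> K *m P = 0.
Proof.
move=> GP comm AP KA KAt; have [sP PP tP] := GrnP GP.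
pose E := symmx A - P.
have cE : P *m E = E *m P by rewrite mulmxBr mulmxBl comm.
have Elt : frobenius E < 2^-1 by apply: le_lt_trans AP; exact: symmx_dist.
have KE : K *m E = - (K *m P).
  by rewrite mulmxBr /symmx -scalemxAr mulmxDr KA KAt addr0 scaler0 sub0r.
have KPE : K *m P = - (K *m P *m E).
  by rewrite -mulmxA cE mulmxA KE mulNmx -mulmxA PP opprK.
apply: frobenius_eq0; apply/eqP; rewrite eq_le frobenius_ge0 andbT.
have := frobeniusM (K *m P) E; rewrite -frobeniusN -KPE.
have := frobenius_ge0 (K *m P); move: (frobenius _) => x x0 h.
suff : x <= x * 2^-1 by lra.
by apply: le_trans h _; rewrite ler_wpM2l// ltW.
Qed.

(** Trades the direction [u] of the image of [P] for [w]. By [P *m w = c *: u], the vector [w] is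
    orthogonal to the rest of the image, so the result is again a projection of rank [d]. *)
Lemma Grn_exchange P (u w : 'cV[R]_n) (c : R) :
  Grn R d n P -> P *m u = u -> u^T *m u = 1%:M -> w^T *m w = 1%:M ->
  P *m w = c *: u -> Grn R d n (P - u *m u^T + w *m w^T).
Proof.
move=> /GrnP[sP PP tP] Pu uu ww Pw; apply/GrnE; split.
- by rewrite linearD /= linearB /= !trmx_mul !trmxK sP.
- have uP : u^T *m P = u^T by rewrite -[RHS](congr1 trmx Pu) trmx_mul sP.
  have wP : w^T *m P = c *: u^T by rewrite -[P]sP -trmx_mul Pw linearZ.
  have uw : u^T *m w = c%:M by rewrite -uP -mulmxA Pw -scalemxAr uu scale_scalar_mx mulr1.
  have wu : w^T *m u = c%:M by rewrite -[w^T *m u]trmxK trmx_mul trmxK uw tr_scalar_mx.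
  rewrite !(mulmxDl, mulmxDr, mulmxBl, mulmxBr, mulNmx, mulmxN) PP !mulmxA Pu Pw.
  rewrite -!(mulmxA u) -!(mulmxA w) uP wP.
  rewrite uu ww uw wu !mul1mx !mul_scalar_mx -!scalemxAr -scalemxAl.
  by rewrite opprK addNr sub0r subrr add0r addrK.
- rewrite mxtraceD raddfB /= ![\tr (_ *m _^T)]mxtrace_mulC uu ww tP.
  by rewrite subrK.
Qed.

Lemma linear_le_square_eq0 (a b k : R) : 0 < a ->
  (forall t, 2 * a * t * b <= t ^+ 2 * k) -> b = 0.
Proof.
move=> a0 h; apply/eqP; apply: contraT => b0.
have b20 : 0 < b ^+ 2 by rewrite exprn_even_gt0.
(* If [b] is nonzero, the hypothesis at [t = e * b] says [2 * a <= e * k]; this [e] makes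
   [e * k <= a]. *)
pose e := a / (`|k| + 1).
have k1 : 0 < `|k| + 1 by rewrite ltr_wpDl.
have e0 : 0 < e by rewrite divr_gt0.
have ek : e * k <= a.
  rewrite /e mulrAC ler_pdivrMr// ler_pM2l//.
  by apply: le_trans (ler_norm _) _; rewrite lerDl.
have := h (e * b).
have -> : 2 * a * (e * b) * b = e * b ^+ 2 * (2 * a) by ring.
have -> : (e * b) ^+ 2 * k = e * b ^+ 2 * (e * k) by ring.
rewrite ler_pM2l; last exact: mulr_gt0.
by move=> h'; lra.
Qed.

(** First variation: [P] maximises [tr (S Q)] for the symmetric part [S] of [A]. Tilting [u] in the
    image of [P] towards [v] in its kernel gives, for each [t], an inequality whose linear term is a
    multiple of [q u v], which must therefore vanish. Hence [P S (1 - P) = 0], and transposing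
    yields commutation. *)
Lemma closest_commutes A P : Grn R d n P ->
  (forall Q, Grn R d n Q -> frobenius (A - P) <= frobenius (A - Q)) ->
  P *m symmx A = symmx A *m P.
Proof.
move=> GP minP; have [sP PP tP] := GrnP GP.
have sS := symmx_tr A.
have maxP Q : Grn R d n Q -> \tr (symmx A *m Q) <= \tr (symmx A *m P).
  move=> GQ; have := minP Q GQ.
  by rewrite frobenius_le !sqr_frobenius_sub_Grn// => h; lra.
move: (symmx A) sS maxP => S sS maxP.
suff PSP : P *m S *m (1%:M - P) = 0.
  have PS : P *m S = P *m S *m P.
    by apply/eqP; rewrite -subr_eq0 -[X in X - _]mulmx1 -mulmxBr PSP.
  have := congr1 trmx PS; rewrite !trmx_mul sP sS => SP.
  by rewrite SP PS mulmxA.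
pose q (x y : 'cV[R]_n) := \tr (x^T *m S *m y).
have qDl x y z : q (x + y) z = q x z + q y z.
  by rewrite /q linearD /= !mulmxDl mxtraceD.
have qDr x y z : q x (y + z) = q x y + q x z by rewrite /q mulmxDr mxtraceD.
have qZl a x y : q (a *: x) y = a * q x y.
  by rewrite /q [(a *: x)^T]linearZ /= -!scalemxAl mxtraceZ.
have qZr a x y : q x (a *: y) = a * q x y by rewrite /q -scalemxAr mxtraceZ.
have qC x y : q x y = q y x.
  by rewrite /q -[LHS]mxtrace_tr !trmx_mul trmxK sS mulmxA.
have qE x : \tr (S *m (x *m x^T)) = q x x.
  by rewrite mulmxA mxtrace_mulC mulmxA.
have main u v : P *m u = u -> P *m v = 0 -> q u v = 0.
  move=> Pu Pv.
  have n11 (x : 'cV[R]_n) : x^T *m x = (frobenius x ^+ 2)%:M.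
    by rewrite sqr_frobenius trace_mx11 -mx11_scalar.
  have [u0|u0] := eqVneq (frobenius u) 0.
    by rewrite (frobenius_eq0 u0) /q trmx0 !mul0mx mxtrace0.
  have uv : u^T *m v = 0 by rewrite -Pu trmx_mul sP -mulmxA Pv mulmx0.
  set a := frobenius u in u0; set b := frobenius v.
  have a0 : 0 < a by rewrite lt_neqAle eq_sym u0 frobenius_ge0.
  apply: (@linear_le_square_eq0 (a ^+ 2) _ (q u u * b ^+ 2 - a ^+ 2 * q v v)).
    by rewrite exprn_gt0.
  move=> t; pose c := frobenius (u + t *: v).
  have cE : c ^+ 2 = a ^+ 2 + t ^+ 2 * b ^+ 2.
    rewrite /c sqr_frobeniusD -scalemxAr uv scaler0 mxtrace0 mulr0 addr0.
    by rewrite frobeniusZ exprMn real_normK ?num_real.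
  have c20 : 0 < c ^+ 2.
    by rewrite cE ltr_pwDl ?exprn_gt0// mulr_ge0// sqr_ge0.
  have c0 : c != 0 by rewrite -sqrf_eq0 gt_eqF.
  have unit (x : 'cV[R]_n) : frobenius x != 0 ->
      ((frobenius x)^-1 *: x)^T *m ((frobenius x)^-1 *: x) = 1%:M.
    move=> x0; rewrite trmxZ -scalemxAl -scalemxAr scalerA n11 scale_scalar_mx.
    by congr _%:M; field.
  have := maxP _ (@Grn_exchange P (a^-1 *: u) (c^-1 *: (u + t *: v)) (c^-1 * a) GP _ _ _ _).
  rewrite -scalemxAr Pu !unit// => /(_ erefl erefl erefl).
  rewrite -scalemxAr mulmxDr Pu -scalemxAr Pv scaler0 addr0 scalerA mulfK//.
  move=> /(_ erefl); rewrite mulmxDr mulmxBr mxtraceD raddfB /= !qE.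
  rewrite !(qZl, qZr, qDl, qDr) (qC v u) => h.
  have {}h : c^-1 * (c^-1 * (q u u + t * q u v + t * (q u v + t * q v v))) <=
     a^-1 * (a^-1 * q u u) by lra.
  set Q := q u u + t * q u v + t * (q u v + t * q v v) in h *.
  have {h} : c ^+ 2 * a ^+ 2 * (c^-1 * (c^-1 * Q)) <=
     c ^+ 2 * a ^+ 2 * (a^-1 * (a^-1 * q u u)).
    by rewrite ler_pM2l// mulr_gt0// exprn_gt0.
  have -> : c ^+ 2 * a ^+ 2 * (c^-1 * (c^-1 * Q)) = a ^+ 2 * Q by field.
  have -> : c ^+ 2 * a ^+ 2 * (a^-1 * (a^-1 * q u u)) = c ^+ 2 * q u u by field.
  by rewrite cE /Q => h; lra.
apply/matrixP => i j; rewrite [RHS]mxE.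
have := main (P *m delta_mx i 0) ((1%:M - P) *m delta_mx j 0).
rewrite !mulmxA PP mulmxBr mulmx1 PP subrr mul0mx => /(_ erefl erefl) <-.
rewrite /q trmx_mul sP trmx_delta !mulmxA -3!mulmxA -rowE.
rewrite trace_mx11 !mulmxA -colE !mxE.
by apply: eq_bigr => k _; rewrite -row_mul [in RHS]mxE.
Qed.

Lemma Grn_compact : compact (Grn R d n).
Proof.
apply: (@frobenius_bounded_compact _ _ _ _ (Num.sqrt d%:R)); first exact: Grn_closed.
by move=> P /sqr_frobenius_Grn <-; rewrite sqrtr_sqr ger0_norm ?frobenius_ge0.
Qed.

Lemma frobenius_sub_continuous A : continuous (fun Q => frobenius (A - Q)).
Proof.
move=> Q; apply: (@continuous_comp _ _ _ (fun Q => A - Q) (@frobenius R n n)).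
  apply: addmx_continuous; first exact: cstmx_continuous.
  exact/oppmx_continuous/idmx_continuous.
exact: frobenius_continuous.
Qed.

Lemma compact_closest (K : set 'M[R]_n) A : compact K -> K !=set0 ->
  exists2 P, K P & forall Q, K Q -> frobenius (A - P) <= frobenius (A - Q).
Proof.
move=> cK K0; have [|P] := compact_EVT_min K0 cK (f := fun Q => frobenius (A - Q)).
  by apply: continuous_subspaceT; exact: frobenius_sub_continuous.
by rewrite inE => KP minP; exists P => // Q KQ; apply: minP; rewrite inE.
Qed.

End Grassmannian.

(** * The retraction onto the Grassmannian *)


Section Truncation.
Context (R : realType).
Implicit Types F G : nat -> nat -> R.

Definition bounded_by n F := forall p q, (n <= p)%N || (n <= q)%N -> F p q = 0.

Definition trunc n F : 'M[R]_n := \matrix_(i, j) F i j.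

Lemma bounded_by_le m n F : (m <= n)%N -> bounded_by m F -> bounded_by n F.
Proof.
move=> mn bF p q pq; apply: bF.
by case/orP: pq => /(leq_trans mn) ->; rewrite ?orbT.
Qed.

Lemma bounded_by_mxpad n (M : 'M[R]_n) : bounded_by n (mxpad M).
Proof. by move=> p q; exact: mxpad_out. Qed.

Lemma trunc_mxpad n (M : 'M[R]_n) : trunc n (mxpad M) = M.
Proof. by apply/matrixP => i j; rewrite mxE mxpad_ord. Qed.

Lemma mxpad_trunc n F : bounded_by n F -> mxpad (trunc n F) = F.
Proof.
move=> bF; apply/funext => p; apply/funext => q.
have [np|pn] := leqP n p; first by rewrite mxpad_out ?np// bF ?np.
have [nq|qn] := leqP n q; first by rewrite mxpad_out ?nq ?orbT// bF ?nq ?orbT.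
by rewrite -[p]/(nat_of_ord (Ordinal pn)) -[q]/(nat_of_ord (Ordinal qn)) mxpad_ord mxE.
Qed.

Lemma infmx_eq (A B : infmx R) : (A : nat -> nat -> R) = B -> A = B.
Proof.
by case: A B => [f pf] [g pg] /= E; subst g; congr Infmx; exact: Prop_irrelevance.
Qed.

Lemma infmx_bounded (A : infmx R) : exists n, bounded_by n A.
Proof. by case: A => f [n [M fM]]; exists n; rewrite /= fM; exact: bounded_by_mxpad. Qed.

Lemma infmx_bounded2 (A B : infmx R) k :
  exists n, [/\ (k <= n)%N, bounded_by n A & bounded_by n B].
Proof.
have [a bA] := infmx_bounded A; have [b bB] := infmx_bounded B.
exists (maxn k (maxn a b)); split; first exact: leq_maxl.
  by apply: bounded_by_le bA; rewrite !leq_max leqnn orbT.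
by apply: bounded_by_le bB; rewrite !leq_max leqnn !orbT.
Qed.

Lemma to_infmx_trunc n (A : infmx R) : bounded_by n A -> to_infmx (trunc n A) = A.
Proof. by move=> bA; apply: infmx_eq; rewrite /= mxpad_trunc. Qed.

Lemma infmx_distE n (A B : infmx R) : bounded_by n A -> bounded_by n B ->
  infmx_dist A B = frobenius (trunc n A - trunc n B).
Proof.
move=> bA bB; rewrite frobeniusE /infmx_dist; congr Num.sqrt.
rewrite (@fsum_ord R n) => [|q nq]; last first.
  by rewrite fsbig1// => p _; rewrite bA ?nq ?orbT// bB ?nq ?orbT// subrr mul0r.
rewrite [RHS]exchange_big; apply: eq_bigr => j _.
rewrite (@fsum_ord R n) => [|p np]; last first.
  by rewrite bA ?np// bB ?np// subrr mul0r.
by apply: eq_bigr => i _; rewrite !mxE expr2.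
Qed.

Lemma infmx_dist_mxpad n (M N : 'M[R]_n) :
  infmx_dist (to_infmx M) (to_infmx N) = frobenius (M - N).
Proof. by rewrite (@infmx_distE n) ?trunc_mxpad//; exact: bounded_by_mxpad. Qed.

Lemma infmx_dist_triangle (A B C : infmx R) :
  infmx_dist A C <= infmx_dist A B + infmx_dist B C.
Proof.
have [k bC] := infmx_bounded C.
have [n [kn bA bB]] := infmx_bounded2 A B k.
have {}bC := bounded_by_le kn bC.
by rewrite !(@infmx_distE n)// frobeniusB_le.
Qed.

Lemma infmx_dist_eq0 (A B : infmx R) : infmx_dist A B = 0 -> A = B.
Proof.
have [n [_ bA bB]] := infmx_bounded2 A B 0.
rewrite (@infmx_distE n)// => /frobenius_eq0/eqP; rewrite subr_eq0 => /eqP E.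
by rewrite -(to_infmx_trunc bA) -(to_infmx_trunc bB) E.
Qed.

Lemma infmx_dist_ge0 (A B : infmx R) : 0 <= infmx_dist A B.
Proof. exact: sqrtr_ge0. Qed.

Lemma infmx_openE (V : set (infmx R)) :
  open V = forall n, open (@to_infmx R n @^-1` V).
Proof. by []. Qed.

Lemma infmx_coord_continuous p q : continuous (fun A : infmx R => A p q).
Proof.
apply/continuousP => V oV; rewrite infmx_openE => n.
have cpq : continuous (fun M : 'M[R]_n => mxpad M p q).
  rewrite /mxpad; case: (insub p) => [i|]; last exact: cst_continuous.
  case: (insub q) => [j|]; last exact: cst_continuous.
  exact/entry_continuous/idmx_continuous.
by have := open_comp (fun M _ => cpq M) oV.
Qed.

Context (d : nat).

Lemma Gr_trunc n (A : infmx R) : bounded_by n A -> Gr R d A -> Grn R d n (trunc n A).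
Proof. by move=> bA GA; apply: Gr_to_infmx; rewrite to_infmx_trunc. Qed.

Lemma Grn_Gr n (M : 'M[R]_n) : Grn R d n M -> Gr R d (to_infmx M).
Proof. by move=> GM; exists n => //; exists M. Qed.

(* Commutation with the symmetric part, stated without fixing the size of the
   matrices. *)
Definition infmx_commute (P A : nat -> nat -> R) := forall p q,
  \sum_(k \in [set: nat]) P p k * (A k q + A q k) =
  \sum_(k \in [set: nat]) (A p k + A k p) * P k q.

Lemma infmx_commuteP n (P A : nat -> nat -> R) :
  bounded_by n P -> bounded_by n A ->
  infmx_commute P A <-> trunc n P *m symmx (trunc n A) = symmx (trunc n A) *m trunc n P.
Proof.
move=> bP bA.
have EL p q : \sum_(k \in [set: nat]) P p k * (A k q + A q k) =
    \sum_(k < n) P p k * (A k q + A q k).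
  by apply: fsum_ord => k nk; rewrite bP ?nk ?orbT// mul0r.
have ER p q : \sum_(k \in [set: nat]) (A p k + A k p) * P k q =
    \sum_(k < n) (A p k + A k p) * P k q.
  by apply: fsum_ord => k nk; rewrite (bP k) ?nk ?orbT// mulr0.
rewrite /symmx -scalemxAr -scalemxAl; split=> [comm|].
  congr (_ *: _); apply/matrixP => i j; have := comm i j; rewrite EL ER !mxE => E.
  under eq_bigr do rewrite !mxE.
  by under [RHS]eq_bigr do rewrite !mxE.
have two : 2^-1 != 0 :> R by rewrite invr_eq0 pnatr_eq0.
move=> /(scalerI two)/matrixP comm p q; rewrite EL ER.
have [np|pn] := leqP n p.
  rewrite !big1// => k _; last by rewrite bP ?np// mul0r.
  by rewrite (bA p k) ?np// (bA k p) ?np ?orbT// addr0 mul0r.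
have [nq|qn] := leqP n q.
  rewrite !big1// => k _; last by rewrite (bA k q) ?nq ?orbT// (bA q k) ?nq// addr0 mulr0.
  by rewrite bP ?nq ?orbT// mulr0.
have := comm (Ordinal pn) (Ordinal qn); rewrite !mxE.
under eq_bigr do rewrite !mxE.
by under [X in _ = X -> _]eq_bigr do rewrite !mxE.
Qed.

(** The minimiser is sought in the compact [Grn R d m] only. Commutation does not depend on the
    size, so [commuting_closest] then compares it with competitors of any larger size. *)
Lemma infmx_closest (A P0 : infmx R) : Gr R d P0 -> infmx_dist A P0 < 2^-1 ->
  exists P, is_closest d A P /\
    forall p, (forall q, A p q = 0 /\ A q p = 0) -> forall q, P p q = 0.
Proof.
move=> GP0 AP0; have [m [_ bA bP0]] := infmx_bounded2 A P0 0.
have GP0m := Gr_trunc bP0 GP0.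
have [|P GP minP] := compact_closest (trunc m A) (@Grn_compact R d m).
  by exists (trunc m P0).
have AP : frobenius (trunc m A - P) < 2^-1.
  by apply: le_lt_trans (minP _ GP0m) _; rewrite -infmx_distE.
have comm := closest_commutes GP minP.
have bP := bounded_by_mxpad P.
have {}comm : infmx_commute (mxpad P) A.
  by apply/(infmx_commuteP bP bA); rewrite trunc_mxpad.
exists (to_infmx P); split.
  split=> [|Q GQ QP]; first exact: Grn_Gr.
  have [k bQ] := infmx_bounded Q.
  have [k1 k2] := (leq_maxl m k, leq_maxr m k).
  have bA' := bounded_by_le k1 bA; have bQ' := bounded_by_le k2 bQ.
  have bP' := bounded_by_le k1 bP.
  rewrite !(@infmx_distE (maxn m k))//.
  apply: (@commuting_closest _ d).
  - by apply: (@Gr_trunc _ (to_infmx P)) => //; exact: Grn_Gr.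
  - exact: Gr_trunc.
  - exact/infmx_commuteP.
  - rewrite -infmx_distE//; apply: le_lt_trans AP.
    by rewrite -(to_infmx_trunc bA) infmx_dist_mxpad trunc_mxpad.
  - move=> E; apply: QP; rewrite -(to_infmx_trunc bQ') E.
    exact: (@to_infmx_trunc _ (to_infmx P)).
move=> p Ap q.
have [mp|pm] := leqP m p; first by rewrite /= mxpad_out ?mp.
have [mq|qm] := leqP m q; first by rewrite /= mxpad_out ?mq ?orbT.
have := @commuting_kernel R d m (trunc m A) P 1 (delta_mx 0 (Ordinal pm)) GP.
have -> : P *m symmx (trunc m A) = symmx (trunc m A) *m P.
  by have /(infmx_commuteP bP bA) := comm; rewrite trunc_mxpad.
rewrite -!rowE => /(_ erefl AP) h.
have /matrixP/(_ 0 (Ordinal qm)) : row (Ordinal pm) P = 0.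
  apply: h; apply/matrixP => i j; rewrite !mxE; first by rewrite (Ap _).1.
  by rewrite (Ap _).2.
by rewrite !mxE -mxpad_ord.
Qed.

Lemma is_closest_le (A P Q : infmx R) : is_closest d A P -> Gr R d Q ->
  infmx_dist A P <= infmx_dist A Q.
Proof.
by move=> [GP cP] GQ; have [->//|/cP QP] := pselect (Q = P); exact/ltW/QP.
Qed.

Lemma Gr_thick_open eta : 0 < eta -> open (Gr_thick R d eta).
Proof.
move=> eta0; rewrite infmx_openE => n; rewrite openE => M0; rewrite /Gr_thick /= gt_eqF//.
move=> [P GP MP]; pose e := eta - infmx_dist (to_infmx M0) P.
have e0 : 0 < e by rewrite subr_gt0.
have near_M0 : \forall M \near M0, frobenius (M0 - M) < e.
  have := @frobenius_sub_continuous R n M0 M0.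
  move=> /(_ [set x | x < e]) /=; apply; apply: open_nbhs_nbhs; split; first exact: open_lt.
  by rewrite /= subrr frobenius0.
apply: filterS near_M0 => M MM0 /=; exists P => //.
apply: le_lt_trans (infmx_dist_triangle _ (to_infmx M0) _) _.
by rewrite infmx_dist_mxpad frobeniusBC -ltrBrDr.
Qed.

Lemma closest_retraction eta : 0 < eta -> eta <= 2^-1 ->
  exists pi : GrThick d eta -> GrSpace R d, continuous pi /\
    forall A, is_closest d (val A) (val (pi A)) /\
      forall p, (forall q, val A p q = 0 /\ val A q p = 0) ->
        forall q, val (pi A) p q = 0.
Proof.
move=> eta0 eta2.
have /choice[P Pspec] (A : infmx R) : exists P, Gr_thick R d eta A ->
    is_closest d A P /\
    forall p, (forall q, A p q = 0 /\ A q p = 0) -> forall q, P p q = 0.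
  have [|nA] := pselect (Gr_thick R d eta A); last by exists A.
  rewrite /Gr_thick gt_eqF// => -[P0 GP0 AP0].
  by have [P ?] := infmx_closest GP0 (lt_le_trans AP0 eta2); exists P.
have GP (A : GrThick d eta) : P (val A) \in Gr R d.
  by rewrite inE; have [[]] := Pspec _ (set_valP A).
exists (fun A => exist _ (P (val A)) (GP A)); split; last first.
  by move=> A; exact: Pspec (set_valP A).
apply/continuousP => _ [W oW <-].
exists (Gr_thick R d eta `&` P @^-1` W); last first.
  by apply/seteqP; split=> [A [_ ?]//|A WA]; split=> //; exact: set_valP.
rewrite infmx_openE => n; rewrite preimage_setI.
have := Gr_thick_open eta0; rewrite infmx_openE => /(_ n) oT.
(* A closest point is symmetric and vanishes on the zero rows of its matrix, so a matrix of size [n]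
   has one of size [n], and openness can be tested inside the single compact [Grn R d n]. *)
have PM (M : 'M[R]_n) : Gr_thick R d eta (to_infmx M) -> exists2 N : 'M[R]_n,
    Grn R d n N & P (to_infmx M) = to_infmx N.
  move=> tM; have [[GPM cl] supp] := Pspec _ tM.
  have sP p q : P (to_infmx M) p q = P (to_infmx M) q p.
    have [k bk] := infmx_bounded (P (to_infmx M)).
    have [sN _ _] := GrnP (Gr_trunc bk GPM).
    have [kp|pk] := leqP k p; first by rewrite !bk ?kp ?orbT.
    have [kq|qk] := leqP k q; first by rewrite !bk ?kq ?orbT.
    by have /matrixP/(_ (Ordinal qk) (Ordinal pk)) := sN; rewrite !mxE.
  have bP : bounded_by n (P (to_infmx M)).
    have h p q : (n <= p)%N -> P (to_infmx M) p q = 0.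
      by move=> np; apply: supp => r; rewrite /= !mxpad_out ?np ?orbT.
    by move=> p q /orP[/h//|/h]; rewrite sP.
  exists (trunc n (P (to_infmx M))); first exact: Gr_trunc.
  by rewrite to_infmx_trunc.
rewrite openE => M0 [/= tM0 WM0].
have [N0 GN0 EN0] := PM _ tM0.
(* The values that must be avoided. Strict minimality of [N0] leaves a gap between its distance to
   [M0] and that of this compact set; moving [M0] by less than half the gap cannot bridge it. *)
pose K := Grn R d n `&` ~` (@to_infmx R n @^-1` W).
have cK : compact K.
  apply: compact_closedI; first exact: Grn_compact.
  by move: oW; rewrite infmx_openE => oW; exact/open_closedC/oW.
have tnear : \forall M \near M0, Gr_thick R d eta (to_infmx M).
  exact: open_nbhs_nbhs.
have [K0|] := pselect (K !=set0); last first.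
  move=> K0; apply: filterS tnear => M tM; split=> //=.
  have [N GN EN] := PM _ tM; rewrite EN; apply: contrapT => nW.
  by apply: K0; exists N.
have [Q [GQ nWQ] minQ] := compact_closest M0 cK K0.
have [[_ clN0] _] := Pspec _ tM0.
have gap : frobenius (M0 - N0) < frobenius (M0 - Q).
  rewrite -!infmx_dist_mxpad -EN0; apply: clN0; first exact: Grn_Gr.
  by move=> E; apply: nWQ; rewrite /= E.
pose e := (frobenius (M0 - Q) - frobenius (M0 - N0)) / 2.
have e0 : 0 < e by rewrite divr_gt0// subr_gt0.
have near_M0 : \forall M \near M0, frobenius (M0 - M) < e.
  have := @frobenius_sub_continuous R n M0 M0.
  move=> /(_ [set x | x < e]) /=; apply; apply: open_nbhs_nbhs; split; first exact: open_lt.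
  by rewrite /= subrr frobenius0.
apply: filterS2 tnear near_M0 => M tM MM0; split=> //=.
have [N GN EN] := PM _ tM; rewrite EN; apply: contrapT => nW.
have MN : frobenius (M0 - Q) <= frobenius (M0 - N) by apply: minQ.
have [cl _] := Pspec _ tM.
have := is_closest_le cl (Grn_Gr GN0); rewrite EN !infmx_dist_mxpad.
have := frobeniusB_le M0 M N; have := frobeniusB_le M M0 N0.
rewrite [frobenius (M - M0)]frobeniusBC; rewrite /e in MM0; lra.
Qed.

End Truncation.

(** * Weighted means of frames *)


Lemma continuousType_of (X Y : topologicalType) (f : X -> Y) : continuous f ->
  exists g : continuousType X Y, forall x, g x = f x.
Proof.
move=> cf; pose m := isContinuous.Build X Y f cf.
pose g : continuousType X Y := HB.pack f m.
by exists g.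
Qed.

Lemma set_type_continuous (X Y : topologicalType) (A : set Y) (f : X -> set_type A) :
  continuous (fun x => set_val (f x)) -> continuous f.
Proof.
move=> cf; apply/continuousP => _ [V oV <-].
by have /continuousP := cf; apply.
Qed.

Lemma set_val_continuous (Y : topologicalType) (A : set Y) :
  continuous (set_val : set_type A -> Y).
Proof. by apply/continuousP => V oV; exists V. Qed.

Lemma set_infmx_coord_continuous (R : realType) (A : set (infmx R)) a b :
  continuous (fun z : set_type A => set_val z a b : R).
Proof.
move=> z; apply: (@continuous_comp _ _ _ set_val (fun A : infmx R => A a b)).
  exact: set_val_continuous.
exact: infmx_coord_continuous.
Qed.

Lemma to_infmx_continuous (R : realType) n : continuous (@to_infmx R n).
Proof. by apply/continuousP => V; rewrite infmx_openE. Qed.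

(** In the direct limit topology continuity of the entries is not enough; the local bound on the
    size makes the map factor, near each point, through matrices of one size. *)
Lemma infmx_continuous (R : realType) (X : topologicalType) (f : X -> infmx R) :
  (forall p q, continuous (fun x => f x p q)) ->
  (forall x : X, exists n, \forall y \near x, bounded_by n (f y)) -> continuous f.
Proof.
move=> cf bf x; have [n bn] := bf x.
have E : {near x, (fun y => to_infmx (trunc n (f y))) =1 f}.
  by apply: filterS bn => y bn; rewrite to_infmx_trunc.
apply: near_eq_continuous E _.
apply: (@continuous_comp _ _ _ (fun y => trunc n (f y)) (@to_infmx R n)).
  apply: mx_continuous => i j; under [X in continuous X]funext => z do rewrite mxE.
  exact: cf.
exact: to_infmx_continuous.
Qed.

Section Subordinate.
Context (R : realType) (X : topologicalType).

(** Serves data that make sense only on [V]: since [f] vanishes off a closed [C] inside [V], the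
    product of [f] with a function continuous on [V] is continuous everywhere. *)
Definition subordinate (V : set X) (f : X -> R) :=
  (forall x, V x -> {for x, continuous f}) /\
  exists C, [/\ closed C, C `<=` V & forall x, ~ C x -> f x = 0].

Lemma subordinate_mul (V : set X) (f h : X -> R) x : subordinate V f ->
  (V x -> {for x, continuous h}) -> {for x, continuous (fun y => f y * h y)}.
Proof.
move=> [cf [C [cC CV f0]]] ch; have [Cx|nCx] := pselect (C x).
  by apply: cvgM; [exact/cf/CV|exact/ch/CV].
have E : {near x, (fun=> 0) =1 (fun y => f y * h y)}.
  have : nbhs x (~` C) by apply: open_nbhs_nbhs; split=> //; exact: closed_openC.
  by apply: filterS => y /f0 ->; rewrite mul0r.
apply: near_eq_continuous E _; exact: cst_continuous.
Qed.

Lemma subordinate0 (V : set X) (f : X -> R) x : subordinate V f -> ~ V x -> f x = 0.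
Proof. by move=> [_ [C [_ CV f0]]] nVx; apply: f0 => /CV. Qed.

Lemma sum_continuous_at (J : Type) (s : seq J) (h : J -> X -> R) x :
  (forall j, {for x, continuous (h j)}) ->
  {for x, continuous (fun y => \sum_(j <- s) h j y)}.
Proof.
move=> ch; elim: s => [|j s IHs].
  under [X in {for x, continuous X}]funext => y do rewrite big_nil.
  exact: cst_continuous.
under [X in {for x, continuous X}]funext => y do rewrite big_cons.
by apply: cvgD; [exact: ch|exact: IHs].
Qed.

Lemma fsum_continuous_at (J : choiceType) (f : J -> X -> R) x :
  locally_supported f -> (forall j, {for x, continuous (f j)}) ->
  {for x, continuous (fun y => \sum_(j \in [set: J]) f j y)}.
Proof.
move=> lf cf; have [s us sN] := lf x.
have E : {near x, (fun x => \sum_(j <- s) f j x) =1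
                  (fun x => \sum_(j \in [set: J]) f j x)}.
  by apply: filterS sN => y f0; rewrite (fsbig_seqT us)// => j /f0.
by apply: near_eq_continuous E _; exact: sum_continuous_at.
Qed.

End Subordinate.

Section Means.
Context (R : realType) (X : topologicalType) (I : choiceType) (d : nat).
Context (V : I -> set X) (psi : I -> X -> R).
Context (F : I -> X -> nat -> 'I_d -> R).

(** The form of a partition of unity used for all averages; it passes to pullbacks ([weights_comp])
    and to convex combinations ([weights_convex]). *)
Definition weights := [/\ forall i, subordinate (V i) (psi i),
  locally_supported psi, forall i x, 0 <= psi i x &
  forall x, \sum_(i \in [set: I]) psi i x = 1].

Definition mean (x : X) : nat -> nat -> R := fun p q =>
  \sum_(i \in [set: I]) psi i x * \sum_(c < d) F i x p c * F i x q c.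

Definition rows_bounded n x := forall i p c, (n <= p)%N -> F i x p c = 0.

Definition frame n i x : 'M[R]_(n, d) := \matrix_(p, c) F i x p c.

Hypothesis weights_psi : weights.

Lemma mean_bounded n x : rows_bounded n x -> bounded_by n (mean x).
Proof.
move=> bF p q pq; rewrite /mean fsbig1// => i _; rewrite big1 ?mulr0// => c _.
by case/orP: pq => /bF ->; rewrite ?mul0r ?mulr0.
Qed.

Lemma trunc_mean n x (s : seq I) : uniq s -> (forall i, i \notin s -> psi i x = 0) ->
  trunc n (mean x) = \sum_(i <- s) psi i x *: (frame n i x *m (frame n i x)^T).
Proof.
move=> us s0; apply/matrixP => p q; rewrite mxE /mean (fsbig_seqT us); last first.
  by move=> i /s0 ->; rewrite mul0r.
rewrite summxE; apply: eq_bigr => i _; rewrite !mxE; congr (_ * _).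
by apply: eq_bigr => c _; rewrite !mxE.
Qed.

Lemma mean_continuous p q :
  (forall i x, V i x -> forall p c, {for x, continuous (fun y => F i y p c)}) ->
  continuous (fun x => mean x p q).
Proof.
move=> cF x; have [sV ls _ _] := weights_psi; apply: fsum_continuous_at => [z|i].
  have [s us sN] := ls z; exists s => //; apply: filterS sN => y s0 j /s0 ->.
  by rewrite mul0r.
apply: subordinate_mul (sV i) _ => Vix; apply: sum_continuous_at => c.
by apply: cvgM; exact: cF.
Qed.

Lemma weights_in x : exists i, V i x /\ psi i x != 0.
Proof.
have [sV ls _ sum1] := weights_psi; apply: contrapT => no.
have : (1 : R) = 0.
  rewrite -(sum1 x) fsbig1// => i _; apply/eqP; apply: contraT => psi0.
  exfalso; apply: no; exists i; split=> //; apply: contrapT => nV.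
  by rewrite (subordinate0 (sV i) nV) eqxx in psi0.
by move/eqP; rewrite oner_eq0.
Qed.

(** Strictness needs one positive weight, supplied by [weights_in]; the other terms are compared
    weakly, and an index with [x] outside [V i] has weight zero. *)
Lemma convex_frobenius n (A : I -> 'M[R]_n) (L : 'M[R]_n) eta x (s : seq I) :
  uniq s -> (forall i, i \notin s -> psi i x = 0) ->
  (forall i, V i x -> frobenius (A i - L) < eta) ->
  frobenius (\sum_(i <- s) psi i x *: A i - L) < eta.
Proof.
move=> us s0 close; have [sV _ psi0 sum1] := weights_psi.
have {}sum1 : \sum_(i <- s) psi i x = 1 by rewrite -(fsbig_seqT us) ?sum1.
have -> : \sum_(i <- s) psi i x *: A i - L = \sum_(i <- s) psi i x *: (A i - L).
  under [RHS]eq_bigr do rewrite scalerBr.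
  by rewrite sumrB -scaler_suml sum1 scale1r.
have le_sum (r : seq I) : frobenius (\sum_(i <- r) psi i x *: (A i - L)) <=
    \sum_(i <- r) psi i x * frobenius (A i - L).
  elim: r => [|i r IHr]; first by rewrite !big_nil frobenius0.
  rewrite !big_cons; apply: le_trans (frobeniusD _ _) _.
  by rewrite frobeniusZ ger0_norm// lerD2l.
apply: le_lt_trans (le_sum s) _.
have [k [Vk psik]] := weights_in x.
have ks : k \in s by apply: contraT => /s0 E; rewrite E eqxx in psik.
rewrite -[ltRHS]mul1r -sum1 mulr_suml !(bigD1_seq k ks us)/=.
apply: ltr_leD.
  by rewrite ltr_pM2l ?close// lt_neqAle eq_sym psik psi0.
apply: ler_sum => i _; have [Vi|nVi] := pselect (V i x).
  by apply: ler_wpM2l => //; exact/ltW/close.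
by rewrite (subordinate0 (sV i) nVi) !mul0r.
Qed.

Lemma frame_Grn n i x : (frame n i x)^T *m frame n i x = 1%:M ->
  Grn R d n (frame n i x *m (frame n i x)^T).
Proof.
move=> oF; apply/GrnE; split; first by rewrite trmx_mul trmxK.
  by rewrite -[RHS]mulmxA (mulmxA _^T) oF mul1mx.
by rewrite mxtrace_mulC oF mxtrace1.
Qed.

Context (bnd : nat -> X -> Prop).
Hypothesis bnd_rows : forall n x, bnd n x -> rows_bounded n x.

(** [bnd n x] licenses the size [n] at [x]. The case split mirrors [Gr_thick]. *)
Definition frames_close (eta : R) := forall n x i l, bnd n x -> V i x -> V l x ->
  if eta == 0 then frame n i x *m (frame n i x)^T = frame n l x *m (frame n l x)^T
  else frobenius (frame n i x *m (frame n i x)^T - frame n l x *m (frame n l x)^T) < eta.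

Lemma mean_close n x l eta : frames_close eta -> bnd n x -> V l x ->
  if eta == 0 then trunc n (mean x) = frame n l x *m (frame n l x)^T
  else frobenius (trunc n (mean x) - frame n l x *m (frame n l x)^T) < eta.
Proof.
move=> close bF Vl; have [_ ls _ _] := weights_psi.
have [s us /nbhs_singleton s0] := ls x.
rewrite (trunc_mean n us s0); case: ifPn => eta0.
  have [sV _ _ sum1] := weights_psi.
  rewrite -[RHS]scale1r -(sum1 x) (fsbig_seqT us)// scaler_suml.
  apply: eq_bigr => i _; have [Vi|nVi] := pselect (V i x).
    by have := close n x i l bF Vi Vl; rewrite eta0 => ->.
  by rewrite (subordinate0 (sV i) nVi) !scale0r.
apply: convex_frobenius => // i Vi.
by have := close n x i l bF Vi Vl; rewrite (negPf eta0).
Qed.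

(** The witness for the thickening is the projection of any single frame at [x]: it lies in the
    Grassmannian and within [eta] of the mean. *)
Lemma mean_map eta :
  (forall i x, V i x -> forall p c, {for x, continuous (fun y => F i y p c)}) ->
  (forall x : X, exists n, \forall y \near x, bnd n y) ->
  (forall n x i, bnd n x -> V i x ->
     (frame n i x)^T *m frame n i x = 1%:M) ->
  frames_close eta ->
  exists f : continuousType X (GrThick d eta),
    forall x, infmx_val (set_val (f x)) = mean x.
Proof.
move=> cF bF oF close.
have bm x : exists n, bnd n x.
  by have [n /nbhs_singleton ?] := bF x; exists n.
have ex x : exists n (M : 'M[R]_n), mean x = mxpad M.
  have [n bn] := bm x; exists n, (trunc n (mean x)).
  by rewrite mxpad_trunc//; exact/mean_bounded/bnd_rows.
pose f0 x := Infmx (ex x).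
have f0thick x : f0 x \in Gr_thick R d eta.
  rewrite inE; have [n bn] := bm x; have [l [Vl _]] := weights_in x.
  have := mean_close close bn Vl.
  have GF := Grn_Gr (frame_Grn (oF _ _ _ bn Vl)).
  have bmean := mean_bounded (bnd_rows bn); rewrite /Gr_thick; case: ifPn => eta0 E.
    by rewrite -(@to_infmx_trunc _ n (f0 x) bmean) E.
  exists (to_infmx (frame n l x *m (frame n l x)^T)) => //.
  by rewrite -(@to_infmx_trunc _ n (f0 x) bmean) infmx_dist_mxpad.
have [|f fE] := @continuousType_of X (GrThick d eta) (fun x => exist _ (f0 x) (f0thick x)).
  apply: set_type_continuous; apply: infmx_continuous => [p q|x].
    exact: mean_continuous.
  have [n bn] := bF x; exists n; apply: filterS bn => y bn.
  exact/mean_bounded/bnd_rows.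
by exists f => x; rewrite fE.
Qed.

End Means.

(** * Frames assembled from blocks *)


Section SubordinateClosure.
Context (R : realType) (X : topologicalType) (V : set X).

Lemma subordinateD (f h : X -> R) : subordinate V f -> subordinate V h ->
  subordinate V (fun x => f x + h x).
Proof.
move=> [cf [C [cC CV f0]]] [ch [D [cD DV h0]]]; split.
  by move=> x Vx; apply: cvgD; [exact: cf|exact: ch].
exists (C `|` D); split; first exact: closedU.
  by move=> x [/CV|/DV].
by move=> x /not_orP[/f0 -> /h0 ->]; rewrite addr0.
Qed.

Lemma subordinateM (f h : X -> R) : subordinate V f ->
  (forall x, V x -> {for x, continuous h}) -> subordinate V (fun x => f x * h x).
Proof.
move=> [cf [C [cC CV f0]]] ch; split.
  by move=> x Vx; apply: cvgM; [exact: cf|exact: ch].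
by exists C; split=> // x /f0 ->; rewrite mul0r.
Qed.

Lemma subordinate_sqrt (f : X -> R) : subordinate V f ->
  subordinate V (fun x => Num.sqrt (f x)).
Proof.
move=> [cf [C [cC CV f0]]]; split.
  move=> x Vx; apply: (@continuous_comp _ _ _ f Num.sqrt); first exact: cf.
  exact: sqrt_continuous.
by exists C; split=> // x /f0 ->; rewrite sqrtr0.
Qed.

End SubordinateClosure.

Section Weights.
Context (R : realType) (X : topologicalType) (I : choiceType) (V : I -> set X).

Lemma partition_of_unity_weights (phi : I -> X -> R) :
  partition_of_unity V phi -> weights V phi.
Proof.
move=> [cphi phi0 supp lf sum1]; split=> // [i|]; last exact: locally_finite_supported.
split; first by move=> x _; exact: cphi.
exists (closure [set y | phi i y != 0]); split=> //; first exact: closed_closure.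
move=> x nx; apply/eqP; apply: contraT => psi0; exfalso; apply: nx.
exact: subset_closure.
Qed.

Lemma weights_comp (Y : topologicalType) (g : Y -> X) (phi : I -> X -> R) :
  continuous g -> weights V phi ->
  weights (fun i => g @^-1` V i) (fun i y => phi i (g y)).
Proof.
move=> cg [sV ls phi0 sum1]; split=> // [i|y].
  have [cphi [C [cC CV f0]]] := sV i; split.
    by move=> y Vy; apply: (@continuous_comp _ _ _ g (phi i)); [exact: cg|exact: cphi].
  exists (g @^-1` C); split; first by apply: preimage_closed => // y _ _; exact: cg.
    by move=> y /CV.
  by move=> y /f0.
have [s us sN] := ls (g y); exists s => //; exact: cg sN.
Qed.

Lemma weights_convex (phi phi' : I -> X -> R) (s : X -> R) : weights V phi ->
  weights V phi' -> continuous s -> (forall x, 0 <= s x <= 1) ->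
  weights V (fun i x => (1 - s x) * phi i x + s x * phi' i x).
Proof.
move=> [sV ls phi0 sum1] [sV' ls' phi0' sum1'] cs s01; split=> [i|x|i x|x].
- under [X in subordinate _ X]funext => x do rewrite mulrC [s x * _]mulrC.
  apply: subordinateD; apply: subordinateM => // x _; last exact: cs.
  by apply: cvgB; [exact: cst_continuous|exact: cs].
- have [u uu uN] := ls x; have [v uv vN] := ls' x.
  exists (undup (u ++ v)); first exact: undup_uniq.
  apply: filterS2 uN vN => y u0 v0 j; rewrite mem_undup mem_cat negb_or.
  by move=> /andP[/u0 -> /v0 ->]; rewrite !mulr0 addr0.
- by have /andP[s0 s1] := s01 x; rewrite addr_ge0// mulr_ge0// subr_ge0.
- have [u uu /nbhs_singleton u0] := ls x; have [v uv /nbhs_singleton v0] := ls' x.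
  have uw := undup_uniq (u ++ v).
  have w0 j : j \notin undup (u ++ v) -> phi j x = 0 /\ phi' j x = 0.
    by rewrite mem_undup mem_cat negb_or => /andP[/u0 -> /v0 ->].
  rewrite (fsbig_seqT uw) => [|j /w0[-> ->]]; last by rewrite !mulr0 addr0.
  rewrite big_split /= -!mulr_sumr.
  rewrite -(fsbig_seqT uw) => [|j /w0[]//]; rewrite -(fsbig_seqT uw) => [|j /w0[]//].
  by rewrite sum1 sum1' !mulr1 subrK.
Qed.

End Weights.

Section Blocks.
Context (R : realType) (B X : topologicalType) (I : choiceType) (d : nat).
Context (U : I -> set B) (g : X -> B) (rho : I -> X -> R).
Context (W : I -> X -> nat -> 'I_d -> R) (Omega : I -> I -> B -> 'M[R]_d).
Context (bnd : nat -> X -> Prop).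

Let V i := g @^-1` U i.

(** [Phi] with its scaled coordinate blocks replaced by arbitrary blocks [W j], over a space [X]
    mapped to [B]. With [X = B * R] and [g = fst], a homotopy moves the blocks while [Omega]
    stays. *)
Definition block_frame (i : I) (x : X) : nat -> 'I_d -> R := fun p c =>
  \sum_(j \in [set: I]) \sum_(r < d) W j x p r * (Omega i j (g x))^T r c.

Definition block n j x : 'M[R]_(n, d) := \matrix_(p, r) W j x p r.

Hypothesis oU : forall i, open (U i).
Hypothesis cg : continuous g.
Hypothesis wrho : weights V rho.
Hypothesis cochainO : cochain U Omega.
Hypothesis subW : forall j p r, subordinate (V j) (fun x => W j x p r).
Hypothesis W0 : forall j x, rho j x = 0 -> forall p r, W j x p r = 0.
Hypothesis Wbnd : forall n x, bnd n x -> forall j p r, (n <= p)%N -> W j x p r = 0.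

Lemma block_frame_continuous i x : V i x -> forall p c,
  {for x, continuous (fun y => block_frame i y p c)}.
Proof.
move=> Vix p c; have [_ ls _ _] := wrho; apply: fsum_continuous_at => [z|j].
  have [s us sN] := ls z; exists s => //; apply: filterS sN => y s0 j /s0 rj.
  by rewrite big1// => r _; rewrite W0// mul0r.
apply: sum_continuous_at => r; apply: subordinate_mul (subW j p r) _ => Vjx.
under [X in {for x, continuous X}]funext => y do rewrite mxE.
have [cO _ _ _] := cochainO.
apply: (@continuous_comp _ _ _ g (fun y => Omega i j y c r)); first exact: cg.
have : {in U j `&` U i, continuous (fun y => Omega i j y c r)}.
  rewrite -continuous_open_subspace; last exact: openI.
  exact: (@entry_continuous R (subspace (U j `&` U i)) d d (Omega i j) c r (cO i j)).
by apply; rewrite inE.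
Qed.

Lemma block_frame_bounded n x : bnd n x -> rows_bounded block_frame n x.
Proof.
move=> bn i p c np; rewrite /block_frame fsbig1// => j _.
by rewrite big1// => r _; rewrite (Wbnd bn)// mul0r.
Qed.

Lemma block_frameE n i x (s : seq I) : uniq s -> (forall j, j \notin s -> rho j x = 0) ->
  frame block_frame n i x = \sum_(j <- s) block n j x *m (Omega i j (g x))^T.
Proof.
move=> us s0; apply/matrixP => p c; rewrite mxE /block_frame (fsbig_seqT us).
  rewrite summxE; apply: eq_bigr => j _; rewrite [RHS]mxE.
  by apply: eq_bigr => r _; rewrite [block _ _ _ _ _]mxE.
by move=> j /s0 rj; rewrite big1// => r _; rewrite W0// mul0r.
Qed.

Lemma orthogonal_OmegaT i j x : V i x -> V j x -> Omega i j (g x) = (Omega j i (g x))^T.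
Proof.
have [_ oO invO _] := cochainO => Vi Vj.
by rewrite invO// orthogonal_inv//; exact: oO.
Qed.

Section Orthogonal.
Hypothesis orthW : forall n x, bnd n x -> forall j k,
  (block n j x)^T *m block n k x = (if j == k then rho j x else 0)%:M.

(** Distinct blocks are orthogonal, so the product has no cross terms and is a weighted mean.
    Orthonormality and closeness of frames are both read off from it. *)
Lemma mul_block_sum n x (s : seq I) (M N : I -> 'M[R]_d) : bnd n x -> uniq s ->
  (\sum_(j <- s) block n j x *m M j)^T *m (\sum_(j <- s) block n j x *m N j) =
  \sum_(j <- s) rho j x *: ((M j)^T *m N j).
Proof.
move=> bn us; rewrite [(\sum_(j <- s) block n j x *m M j)^T]raddf_sum /= mulmx_suml.
rewrite big_seq [RHS]big_seq; apply: eq_bigr => j js.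
rewrite mulmx_sumr (bigD1_seq j js us)/= big1 => [|k kj].
  rewrite addr0 trmx_mul -mulmxA (mulmxA _^T _ (N j)) (orthW bn) eqxx.
  by rewrite mul_scalar_mx -scalemxAr.
rewrite trmx_mul -mulmxA (mulmxA _^T _ (N k)) (orthW bn) eq_sym (negPf kj).
by rewrite mul_scalar_mx scale0r mulmx0.
Qed.

Lemma block_frame_orthonormal n x i : bnd n x -> V i x ->
  (frame block_frame n i x)^T *m frame block_frame n i x = 1%:M.
Proof.
move=> bn Vi; have [sV ls _ sum1] := wrho; have [s us /nbhs_singleton s0] := ls x.
rewrite (block_frameE n i us s0) mul_block_sum//.
have -> : \sum_(j <- s) rho j x *: ((Omega i j (g x))^T^T *m (Omega i j (g x))^T) =
    \sum_(j <- s) rho j x *: 1%:M.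
  apply: eq_bigr => j _; have [Vj|nVj] := pselect (V j x).
    have [_ oO _ _] := cochainO; rewrite -orthogonal_OmegaT//.
    have oji : (Omega j i (g x))^T *m Omega j i (g x) = 1%:M := oO j i (g x) Vi Vj.
    by rewrite oji.
  by rewrite (subordinate0 (sV j) nVj) !scale0r.
by rewrite -scaler_suml -(fsbig_seqT us)// sum1 scale1r.
Qed.

(** The difference is the block sum of the [M j], and where [x] lies in [V j] this is the cocycle
    defect of [j], [i], [l]. The squared norm is a weighted mean of squared defects, so [eps] passes
    unchanged however many opens meet. *)
Lemma block_frame_close eps : cocycle_condition U eps Omega -> 0 <= eps ->
  forall n x i l, bnd n x -> V i x -> V l x ->
  if eps == 0 then frame block_frame n i x *m Omega i l (g x) = frame block_frame n l x
  else frobenius (frame block_frame n i x *m Omega i l (g x) - frame block_frame n l x) < eps.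
Proof.
move=> cO eps0 n x i l bn Vi Vl.
have [sV ls rho0 sum1] := wrho; have [s us /nbhs_singleton s0] := ls x.
pose M j := (Omega i j (g x))^T *m Omega i l (g x) - (Omega l j (g x))^T.
have E : frame block_frame n i x *m Omega i l (g x) - frame block_frame n l x =
    \sum_(j <- s) block n j x *m M j.
  rewrite !(block_frameE n _ us s0) mulmx_suml -sumrB.
  by apply: eq_bigr => j _; rewrite -mulmxA -mulmxBr.
have MV j : V j x -> M j = Omega j i (g x) *m Omega i l (g x) - Omega j l (g x).
  by move=> Vj; rewrite /M -!orthogonal_OmegaT.
case: ifPn => epsE.
  apply/eqP; rewrite -subr_eq0 E big1// => j _.
  have [Vj|nVj] := pselect (V j x).
    rewrite MV//; have := cO j i l (g x) Vl Vi Vj.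
    by rewrite epsE => ->; rewrite subrr mulmx0.
  have -> : block n j x = 0.
    by apply/matrixP => p r; rewrite !mxE W0// (subordinate0 (sV j) nVj).
  by rewrite mul0mx.
have eps_gt0 : 0 < eps by rewrite lt_neqAle eq_sym epsE.
rewrite E -ltr_sqr ?nnegrE ?frobenius_ge0// sqr_frobenius mul_block_sum//.
rewrite raddf_sum /=.
have [k [Vk rk]] := weights_in wrho x.
have ks : k \in s by apply: contraT => /s0 Z; rewrite Z eqxx in rk.
have {}sum1 : \sum_(i <- s) rho i x = 1 by rewrite -(fsbig_seqT us) ?sum1.
have close j : V j x -> frobenius (M j) ^+ 2 < eps ^+ 2.
  move=> Vj; rewrite ltr_sqr ?nnegrE ?frobenius_ge0// MV//.
  by have := cO j i l (g x) Vl Vi Vj; rewrite (negPf epsE).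
rewrite -[ltRHS]mul1r -sum1 mulr_suml !(bigD1_seq k ks us)/=.
apply: ltr_leD.
  rewrite mxtraceZ -sqr_frobenius ltr_pM2l ?close//.
  by rewrite lt_neqAle eq_sym rk rho0.
apply: ler_sum => j _; rewrite mxtraceZ -sqr_frobenius.
have [Vj|nVj] := pselect (V j x); first by rewrite ler_wpM2l// ltW// close.
by rewrite (subordinate0 (sV j) nVj) !mul0r.
Qed.

(** Right multiplication by the orthogonal [Omega i l] leaves the projection of a frame unchanged,
    so [frobenius_proj] applies to the transported frame and contributes the factor [sqrt 2]. *)
Lemma block_frame_frames_close eps : cocycle_condition U eps Omega -> 0 <= eps ->
  frames_close V block_frame bnd (Num.sqrt 2 * eps).
Proof.
move=> cO eps0 n x i l bn Vi Vl; rewrite mulf_eq0 sqrtr_eq0 leNgt ltr0n /=.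
have := block_frame_close cO eps0 bn Vi Vl.
have [_ oO _ _] := cochainO.
have oil : Omega i l (g x) *m (Omega i l (g x))^T = 1%:M.
  have oli : (Omega l i (g x))^T *m Omega l i (g x) = 1%:M := oO l i (g x) Vi Vl.
  by move: oli; rewrite -!orthogonal_OmegaT.
set F := frame block_frame n i x; set G := frame block_frame n l x.
set O := Omega i l (g x) in oil *.
have FO : (F *m O) *m (F *m O)^T = F *m F^T.
  by rewrite trmx_mul -mulmxA (mulmxA O) oil mul1mx.
case: ifPn => epsE; first by move=> <-.
move=> h; rewrite -FO.
apply: le_lt_trans (frobenius_proj _ _) _; last by rewrite ltr_pM2l// sqrtr_gt0.
  rewrite trmx_mul -mulmxA (mulmxA F^T) block_frame_orthonormal// mul1mx.
  exact: oO.
exact: block_frame_orthonormal.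
Qed.

Lemma block_map eps : cocycle_condition U eps Omega -> 0 <= eps ->
  (forall x : X, exists n, \forall y \near x, bnd n y) ->
  exists f : continuousType X (GrThick d (Num.sqrt 2 * eps)),
    forall x, infmx_val (set_val (f x)) = mean rho block_frame x.
Proof.
move=> cO eps0 ebnd; apply: (mean_map wrho block_frame_bounded) => //.
- by move=> i x Vi p c; exact: block_frame_continuous.
- by move=> n x i bn Vi; exact: block_frame_orthonormal.
- exact: block_frame_frames_close.
Qed.

End Orthogonal.

End Blocks.

(** * The blocks of the construction *)


Lemma block_index_inj (d a b u v : nat) : (u < d)%N -> (v < d)%N ->
  (d * a + u = d * b + v)%N -> a = b /\ u = v.
Proof.
have lt_block x y w z : (w < d)%N -> (x < y)%N -> (d * x + w < d * y + z)%N.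
  by move=> wd xy; have := leq_mul (leqnn d) xy; rewrite mulnS; lia.
move=> ud vd E; have ab : a = b.
  case: (ltngtP a b) => // ab.
    by have := lt_block _ _ u v ud ab; rewrite E ltnn.
  by have := lt_block _ _ v u vd ab; rewrite E ltnn.
by split=> //; move: E; rewrite ab; lia.
Qed.

Section Coordinates.
Context (R : realType) (I : choiceType) (d : nat).
Implicit Types iota : I -> nat.

Definition row_coord iota j (p : nat) (r : 'I_d) : R := (p.+1 == (d * iota j + r)%N)%:R.

Definition coord_mx n iota j : 'M[R]_(n, d) := \matrix_(p, r) row_coord iota j p r.

Lemma mul_coord_mx n iota iota' j k : (0 < iota j)%N -> (d * iota j + d <= n)%N ->
  (coord_mx n iota j)^T *m coord_mx n iota' k = (iota j == iota' k)%:R%:M.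
Proof.
move=> i0 jn; apply/matrixP => r r'; rewrite !mxE.
(* The only row that contributes. Its index is one less than its number, which is positive because
   [0 < iota j]. *)
have p0n : ((d * iota j + r).-1 < n)%N by have := ltn_ord r; lia.
have p0S : (d * iota j + r).-1.+1 = (d * iota j + r)%N by have := ltn_ord r; nia.
rewrite (bigD1 (Ordinal p0n))//= big1 => [|p pp0]; last first.
  rewrite !mxE /row_coord -p0S eqSS.
  by move: pp0; rewrite -val_eqE /= => /negPf ->; rewrite mul0r.
rewrite !mxE /row_coord /= p0S eqxx mul1r addr0 -[RHS]mulr_natr -natrM mulnb.
congr (nat_of_bool _)%:R; rewrite -val_eqE /=.
apply/eqP/andP => [/block_index_inj[]// -> ->//|[/eqP -> /eqP ->]//].
Qed.

Lemma row_coord0 n iota j p r : (d * iota j + d <= n)%N -> (n <= p)%N ->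
  row_coord iota j p r = 0.
Proof.
move=> jn np; rewrite /row_coord; have := ltn_ord r; case: eqP => // E lt; lia.
Qed.

End Coordinates.

Lemma eq_cl_matrix_mean (R : realType) (B : topologicalType) (I : choiceType) d
   (phi : I -> B -> R) iota (Omega : I -> I -> B -> 'M[R]_d) :
  cl_matrix phi iota Omega = mean phi (Phi phi iota Omega).
Proof. by []. Qed.

Section TwoBlocks.
Context (R : realType) (B X : topologicalType) (I : choiceType) (d : nat).
Context (U : I -> set B) (g : X -> B) (rho s : I -> X -> R) (eps : R).
Context (Omega : Z1 U d eps) (Theta : I -> B -> 'M[R]_d) (iota iota' : I -> nat).

Let V i := g @^-1` U i.

(** The block of [j] divided between its old rows [iota j] and its new rows [iota' j], there turned
    by the gauge; the squared coefficients add up to [rho j]. The time [s j] depends on [j] so that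
    blocks can move one at a time. *)
Definition two_block (j : I) (x : X) (p : nat) (r : 'I_d) : R :=
  Num.sqrt (rho j x * (1 - s j x)) * row_coord R iota j p r +
  Num.sqrt (rho j x * s j x) *
    \sum_r1 row_coord R iota' j p r1 * Theta j (g x) r1 r.

Definition two_block_bnd (n : nat) (x : X) := forall j, rho j x != 0 ->
  (d * iota j + d <= n)%N /\ (d * iota' j + d <= n)%N.

Hypothesis oU : forall i, open (U i).
Hypothesis cg : continuous g.
Hypothesis wrho : weights V rho.
Hypothesis gT : gauge U Theta.
Hypothesis enum_iota : enumeration iota.
Hypothesis enum_iota' : enumeration iota'.
Hypothesis eps0 : 0 <= eps.
Hypothesis cs : forall j, continuous (s j).
Hypothesis s01 : forall j x, 0 <= s j x <= 1.
Hypothesis conflict : forall j k x, iota j = iota' k -> (1 - s j x) * s k x = 0.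

Lemma two_block_sub j p r : subordinate (V j) (fun x => two_block j x p r).
Proof.
have [sV _ _ _] := wrho.
apply: subordinateD.
  apply: subordinateM => [|x _]; last exact: cst_continuous.
  apply/subordinate_sqrt/subordinateM => // x _.
  by apply: cvgB; [exact: cst_continuous|exact: cs].
apply: subordinateM => [|x Vx].
  by apply/subordinate_sqrt/subordinateM => // x _; exact: cs.
apply: sum_continuous_at => r1; apply: cvgM; first exact: cst_continuous.
apply: (@continuous_comp _ _ _ g (fun y => Theta j y r1 r)); first exact: cg.
have : {in U j, continuous (fun y => Theta j y r1 r)}.
  rewrite -continuous_open_subspace//.
  exact: (@entry_continuous R (subspace (U j)) d d (Theta j) r1 r (gT j).1).
by apply; rewrite inE.
Qed.

Lemma two_block0 j x : rho j x = 0 -> forall p r, two_block j x p r = 0.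
Proof. by move=> r0 p r; rewrite /two_block r0 !mul0r sqrtr0 !mul0r addr0. Qed.

Lemma two_block_rows n x : two_block_bnd n x ->
  forall j p r, (n <= p)%N -> two_block j x p r = 0.
Proof.
move=> bn j p r np; have [rj|rj] := eqVneq (rho j x) 0; first exact: two_block0 rj p r.
have [b1 b2] := bn _ rj; rewrite /two_block (row_coord0 _ _ b1 np) mulr0 add0r.
by rewrite big1 ?mulr0// => r1 _; rewrite (row_coord0 _ _ b2 np) mul0r.
Qed.

Lemma two_block_mx n j x : block two_block n j x =
  Num.sqrt (rho j x * (1 - s j x)) *: coord_mx R d n iota j +
  Num.sqrt (rho j x * s j x) *: (coord_mx R d n iota' j *m Theta j (g x)).
Proof.
apply/matrixP => p r; rewrite !mxE; congr (_ + _ * _).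
by apply: eq_bigr => r1 _; rewrite !mxE.
Qed.

(** The only unwanted overlap is between old rows and new rows, of the same or of different blocks;
    [conflict] makes the product of their coefficients vanish when they coincide. *)
Lemma two_block_orth n x : two_block_bnd n x -> forall j k,
  (block two_block n j x)^T *m block two_block n k x =
  (if j == k then rho j x else 0)%:M.
Proof.
move=> bn j k; have [sV _ rho0 _] := wrho.
have [rj|rj] := eqVneq (rho j x) 0.
  have -> : block two_block n j x = 0.
    by apply/matrixP => p r; rewrite !mxE two_block0.
  by rewrite trmx0 mul0mx rj if_same -scalemx1 scale0r.
have [rk|rk] := eqVneq (rho k x) 0.
  have -> : block two_block n k x = 0.
    by apply/matrixP => p r; rewrite !mxE two_block0.
  rewrite mulmx0; case: eqP => [jk|_]; last by rewrite -scalemx1 scale0r.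
  by rewrite jk rk eqxx in rj.
have [b1 b2] := bn _ rj.
have [iI i0] := enum_iota; have [iI' i0'] := enum_iota'.
have s0 l : 0 <= s l x by have /andP[] := s01 l x.
have s1 l : 0 <= 1 - s l x by have /andP[_] := s01 l x; rewrite subr_ge0.
have cross l m : iota l = iota' m ->
    Num.sqrt (rho l x * (1 - s l x)) * Num.sqrt (rho m x * s m x) = 0.
  move=> /(conflict x) E; rewrite -sqrtrM ?mulr_ge0//.
  by rewrite mulrACA E mulr0 sqrtr0.
have cross1 l m : (Num.sqrt (rho l x * (1 - s l x)) * Num.sqrt (rho m x * s m x))
    * (iota l == iota' m)%:R = 0.
  by case: eqP => [/cross ->|_]; rewrite ?mul0r ?mulr0.
rewrite !two_block_mx trmxD !trmxZ trmx_mul mulmxDl !mulmxDr.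
rewrite -!scalemxAl -!scalemxAr !scalerA -!mulmxA.
rewrite (mulmxA (coord_mx _ _ _ iota j)^T (coord_mx _ _ _ iota' k)).
rewrite (mulmxA (coord_mx _ _ _ iota' j)^T (coord_mx _ _ _ iota' k)).
rewrite !mul_coord_mx// !mul_scalar_mx -!scalemxAr !scalerA cross1 scale0r addr0.
rewrite -[_%:R%:M]scalemx1 -[(_ == iota k)%:R%:M]scalemx1 -scalemxAr !scalerA.
rewrite [Num.sqrt (rho j x * s j x) * _]mulrC [iota' j == iota k]eq_sym cross1 scale0r add0r.
rewrite (inj_eq iI) (inj_eq iI').
case: eqVneq => [<-|jk]; last by rewrite !mulr0 !scale0r addr0 -scalemx1 scale0r.
have oT : (Theta j (g x))^T *m Theta j (g x) = 1%:M.
  by apply: (gT j).2; apply: contrapT => nV; rewrite (subordinate0 (sV j) nV) eqxx in rj.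
rewrite oT !mulr1 -scalerDl -!expr2 !sqr_sqrtr ?mulr_ge0//.
by rewrite -mulrDr subrK mulr1 scalemx1.
Qed.

Lemma two_block_bnd_near (x : X) : exists n, \forall y \near x, two_block_bnd n y.
Proof.
have [_ ls _ _] := wrho; have [u us uN] := ls x.
exists (\max_(j <- u) maxn (d * iota j + d) (d * iota' j + d))%N.
apply: filterS uN => y u0 j rj.
have ju : j \in u by apply: contraT => /u0 E; rewrite E eqxx in rj.
have := leq_bigmax_seq (F := fun j => maxn (d * iota j + d) (d * iota' j + d)) j ju isT.
by rewrite geq_max => /andP.
Qed.

Lemma two_block_map : exists f : continuousType X (GrThick d (Num.sqrt 2 * eps)),
  forall x, infmx_val (set_val (f x)) =
    mean rho (block_frame g two_block Omega) x.
Proof.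
apply: (block_map oU cg wrho (Z1_cochain Omega) two_block_sub two_block0
  two_block_rows two_block_orth (Z1_cocycle Omega) eps0).
exact: two_block_bnd_near.
Qed.

End TwoBlocks.

(** * Independence of the choices *)


Section Clamp.
Context (R : realType).

(** Clamping the time makes homotopy formulas continuous on all of [X * R] rather than on a
    strip. *)
Definition clamp01 (t : R) : R := Num.max 0 (Num.min 1 t).

Lemma clamp01_continuous : continuous clamp01.
Proof.
move=> t; apply: continuous_max; first exact: cst_continuous.
by apply: continuous_min; [exact: cst_continuous|exact: cvg_id].
Qed.

Lemma clamp01_bounds t : 0 <= clamp01 t <= 1.
Proof. by rewrite le_max lexx /= ge_max ler01 ge_min lexx. Qed.

Lemma clamp01_le0 t : t <= 0 -> clamp01 t = 0.
Proof. by move=> t0; apply/max_idPl; rewrite ge_min t0 orbT. Qed.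

Lemma clamp01_ge1 t : 1 <= t -> clamp01 t = 1.
Proof. by move=> t1; rewrite /clamp01 (min_idPl t1) (max_idPr ler01). Qed.

End Clamp.

Lemma mean_eq (R : realType) (X : topologicalType) (I : choiceType) d
    (V : I -> set X) (psi : I -> X -> R) (F G : I -> X -> nat -> 'I_d -> R) n x :
  weights V psi -> rows_bounded F n x -> rows_bounded G n x ->
  (forall i, V i x -> frame F n i x *m (frame F n i x)^T =
     frame G n i x *m (frame G n i x)^T) ->
  mean psi F x = mean psi G x.
Proof.
move=> [sV ls _ _] bF bG FG; have [s us /nbhs_singleton s0] := ls x.
rewrite -(mxpad_trunc (mean_bounded psi bF)) -(mxpad_trunc (mean_bounded psi bG)).
rewrite !(trunc_mean _ _ us s0); congr mxpad; apply: eq_bigr => i _.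
have [Vi|nVi] := pselect (V i x); first by rewrite FG.
by rewrite (subordinate0 (sV i) nVi) !scale0r.
Qed.

Lemma homotopic_ends (R : realType) (X Y : topologicalType)
    (H : continuousType (X * R)%type Y) (f h : continuousType X Y) :
  (forall x, H (x, 0) = f x) -> (forall x, H (x, 1) = h x) -> homotopic R f h.
Proof.
move=> H0 H1; exists H; split=> //.
by apply: continuous_subspaceT => p; exact: cts_fun.
Qed.

Section Represents.
Context (R : realType) (B : topologicalType) (I : choiceType) (U : I -> set B).
Context (d : nat).
Hypothesis oU : forall i, open (U i).

Lemma GrThick_eq eta (A A' : GrThick d (eta : R)) :
  infmx_val (set_val A) = infmx_val (set_val A') -> A = A'.
Proof. by move=> /infmx_eq/val_inj. Qed.

Section Map.
Context (eps : R) (eps0 : 0 <= eps).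

Definition represents (f : continuousType B (GrThick d (Num.sqrt 2 * eps)))
    (phi : I -> B -> R) (iota : I -> nat) (Omega : I -> I -> B -> 'M[R]_d) :=
  forall y, infmx_val (set_val (f y)) = cl_matrix phi iota Omega y.

Let Theta1 : I -> B -> 'M[R]_d := fun _ _ => 1%:M.

Lemma gauge1 : gauge U Theta1.
Proof.
move=> i; split=> [|y _]; last exact: orthogonal1.
by apply: continuous_subspaceT => y; exact: cst_continuous.
Qed.

Lemma block_frame_Phi (X : topologicalType) (g : X -> B)
    (phi : I -> B -> R) iota Omega (W : I -> X -> nat -> 'I_d -> R) x :
  (forall j p r, W j x p r = Num.sqrt (phi j (g x)) * row_coord R iota j p r) ->
  forall i, block_frame g W Omega i x = Phi phi iota Omega i (g x).
Proof.
move=> WE i; apply/funext => p; apply/funext => c.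
apply: eq_fsbigr => j _; rewrite [RHS]big_mkcond /=; apply: eq_bigr => r _.
by rewrite WE /row_coord; case: eqP => _; rewrite ?mulr1// mulr0 mul0r.
Qed.

Definition Phi_bnd (phi : I -> B -> R) (iota : I -> nat) (n : nat) (y : B) :=
  forall j, phi j y != 0 -> (d * iota j + d <= n)%N.

(** [Phi] is a moving block at rest, with time 0 and trivial gauge, so its properties are instances
    of those of [two_block]. *)
Lemma Phi_two_block (Omega : Z1 U d eps) phi iota :
  block_frame id (two_block id phi (fun _ _ => 0) Theta1 iota iota) Omega =
  Phi phi iota Omega.
Proof.
apply/funext => i; apply/funext => z; apply: (@block_frame_Phi B id phi) => j p r.
by rewrite /two_block subr0 mulr1 mulr0 sqrtr0 mul0r addr0.
Qed.

Lemma Phi_frame phi iota (Omega : Z1 U d eps) n y : weights U phi -> enumeration iota ->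
  Phi_bnd phi iota n y ->
  rows_bounded (Phi phi iota Omega) n y /\
  (forall i, U i y -> (frame (Phi phi iota Omega) n i y)^T *m
      frame (Phi phi iota Omega) n i y = 1%:M) /\
  (forall i l, U i y -> U l y -> if eps == 0 then
     frame (Phi phi iota Omega) n i y *m Omega i l y = frame (Phi phi iota Omega) n l y
     else frobenius (frame (Phi phi iota Omega) n i y *m Omega i l y -
       frame (Phi phi iota Omega) n l y) < eps).
Proof.
move=> wphi enum bn; pose s0 : I -> B -> R := fun _ _ => 0.
have s01 j x : 0 <= s0 j x <= 1 by rewrite lexx ler01.
have conf j k x : iota j = iota k -> (1 - s0 j x) * s0 k x = 0 by rewrite mulr0.
have bn' : two_block_bnd d phi iota iota n y by move=> j /bn.
rewrite -Phi_two_block -/s0.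
have orth := @two_block_orth R B B I d U id phi s0 Theta1 iota iota
  wphi gauge1 enum enum s01 conf.
have Z0 := @two_block0 R B B I d id phi s0 Theta1 iota iota.
split; last split.
- exact: (block_frame_bounded id Omega
    (@two_block_rows _ _ _ _ _ id phi s0 Theta1 iota iota)).
- move=> i Ui.
  exact: (block_frame_orthonormal wphi (Z1_cochain Omega) Z0 orth bn' Ui).
- move=> i l Ui Ul.
  exact: (block_frame_close wphi (Z1_cochain Omega) Z0 orth (Z1_cocycle Omega) eps0 bn' Ui Ul).
Qed.

Lemma Phi_bnd_near phi iota (y : B) : weights U phi ->
  exists n, \forall z \near y, Phi_bnd phi iota n z.
Proof.
move=> wphi; have [n nN] := two_block_bnd_near d (U := U) (g := id) iota iota wphi y.
by exists n; apply: filterS nN => z bz j /bz[].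
Qed.

Lemma Phi_continuous phi iota (Omega : Z1 U d eps) i y : weights U phi -> U i y ->
  forall p c, {for y, continuous (fun z => Phi phi iota Omega i z p c)}.
Proof.
move=> wphi Ui p c; under [X in {for y, continuous X}]funext => z do rewrite -Phi_two_block.
have cid : continuous (fun y : B => y) by move=> z; exact: cvg_id.
apply: (@block_frame_continuous _ _ _ _ _ U id phi) => //.
- exact: Z1_cochain.
- move=> j a r; apply: (two_block_sub (U := U)) => //.
  + exact: gauge1.
  + by move=> k; exact: cst_continuous.
- exact: two_block0.
Qed.

Lemma Phi_frames_close phi iota (Omega : Z1 U d eps) :
  weights U phi -> enumeration iota ->
  frames_close U (Phi phi iota Omega) (Phi_bnd phi iota) (Num.sqrt 2 * eps).
Proof.
move=> wphi enum n y i l bn Ui Ul.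
have bn' : two_block_bnd d phi iota iota n y by move=> j /bn.
have s01 (j : I) (x : B) : 0 <= (0 : R) <= 1 by rewrite lexx ler01.
have conf (j k : I) (x : B) : iota j = iota k -> (1 - 0) * 0 = 0 :> R by rewrite mulr0.
have orth := two_block_orth (g := id) (s := fun _ _ => 0) wphi gauge1 enum enum s01 conf.
have Z0 := @two_block0 R B B I d id phi (fun _ _ => 0) Theta1 iota iota.
have := block_frame_frames_close wphi (Z1_cochain Omega) Z0 orth (Z1_cocycle Omega)
  eps0 bn' Ui Ul.
by rewrite Phi_two_block.
Qed.

Lemma represents_exists phi iota (Omega : Z1 U d eps) :
  weights U phi -> enumeration iota -> exists f, represents f phi iota Omega.
Proof.
move=> wphi enum.
have [|j|j x|j k x _|f fE] := two_block_map (g := id) (s := fun _ _ => 0) Omega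
   oU _ wphi gauge1 enum enum eps0.
- by move=> y; exact: cvg_id.
- exact: cst_continuous.
- by rewrite lexx ler01.
- by rewrite mulr0.
- by exists f => y; rewrite fE Phi_two_block.
Qed.

Lemma Phi_Stiefel phi iota (Omega : Z1 U d eps) i y :
  weights U phi -> enumeration iota -> U i y -> Stiefel R d (Phi phi iota Omega i y).
Proof.
move=> wphi enum Ui; have [n /nbhs_singleton bn] := Phi_bnd_near iota y wphi.
have [rows [orth _]] := Phi_frame Omega wphi enum bn.
exists n, (frame (Phi phi iota Omega) n i y); split; first exact: orth.
apply/funext => p; apply/funext => c; rewrite /colpad.
case: insubP => [k _ <-|]; first by rewrite mxE.
by rewrite -leqNgt => /rows ->.
Qed.

Lemma mean_pull (X Y : topologicalType) psi psi' (F : I -> X -> nat -> 'I_d -> R)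
   (G : I -> Y -> nat -> 'I_d -> R) x y :
  (forall i, psi i x = psi' i y) -> (forall i, F i x = G i y) ->
  mean psi F x = mean (R := R) psi' G y.
Proof.
move=> psiE FE; apply/funext => p; apply/funext => q; apply: eq_fsbigr => i _.
by rewrite psiE FE.
Qed.

Let fst_continuous : continuous (fst : B * R -> B).
Proof. by move=> p; exact: cvg_fst. Qed.

Let clamp_snd_continuous : continuous (fun p : B * R => clamp01 p.2).
Proof.
move=> p; apply: (@continuous_comp _ _ _ snd (@clamp01 R)); first exact: cvg_snd.
exact: clamp01_continuous.
Qed.

Lemma represents_phi_homotopic phi phi' iota (Omega : Z1 U d eps) f f' :
  weights U phi -> weights U phi' -> enumeration iota ->
  represents f phi iota Omega -> represents f' phi' iota Omega -> homotopic R f f'.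
Proof.
move=> wphi wphi' enum fE f'E.
pose rho (i : I) (p : B * R) :=
  (1 - clamp01 p.2) * phi i p.1 + clamp01 p.2 * phi' i p.1.
have wrho : weights (fun i => fst @^-1` U i) rho.
  apply: (@weights_convex R _ I _ (fun i p => phi i p.1) (fun i p => phi' i p.1)).
  - exact: weights_comp fst_continuous wphi.
  - exact: weights_comp fst_continuous wphi'.
  - exact: clamp_snd_continuous.
  - by move=> p; exact: clamp01_bounds.
have [|||H HE] := two_block_map (g := fst) (s := fun _ _ => 0) Omega
   oU fst_continuous wrho gauge1 enum enum eps0.
- by move=> j; exact: cst_continuous.
- by move=> j x; rewrite lexx ler01.
- by move=> j k x _; rewrite mulr0.
apply: (homotopic_ends (H := H)) => y; apply: GrThick_eq; rewrite HE ?fE ?f'E;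
  apply: mean_pull => i.
- by rewrite /rho /= clamp01_le0// subr0 mul1r mul0r addr0.
- apply: (@block_frame_Phi _ fst phi iota Omega _ (y, 0 : R)) => j p r.
  rewrite /two_block subr0 mulr1 mulr0 sqrtr0 mul0r addr0.
  by rewrite /rho /= clamp01_le0// subr0 mul1r mul0r addr0.
- by rewrite /rho /= clamp01_ge1// subrr mul0r mul1r add0r.
- apply: (@block_frame_Phi _ fst phi' iota Omega _ (y, 1 : R)) => j p r.
  rewrite /two_block subr0 mulr1 mulr0 sqrtr0 mul0r addr0.
  by rewrite /rho /= clamp01_ge1// subrr mul0r mul1r add0r.
Qed.

(* The block of index [j] moves from the rows of [iota j] to those of [iota' j]
   while the time runs from [1/(k+1)] to [1/k], where [k = iota j]: the rows of
   [iota' j = iota l > iota j] have then already been left by the block of [l]. *)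
Definition shift_time (k : nat) (t : R) : R :=
  clamp01 ((t - k.+1%:R^-1) * (k%:R * k.+1%:R)).

Lemma shift_time0 k : shift_time k 0 = 0.
Proof.
by rewrite /shift_time clamp01_le0// sub0r mulNr oppr_le0 !mulr_ge0.
Qed.

Lemma shift_time1 k : (0 < k)%N -> shift_time k 1 = 1.
Proof.
move=> k0; rewrite /shift_time clamp01_ge1// mulrC mulrBr mulr1 mulfK ?pnatr_eq0//.
rewrite -natrM -natrB ?ler1n; nia.
Qed.

(** The ramp of [k] starts at [1/(k+1)], and that of [m] has ended by [1/m], which is no later. *)
Lemma shift_time_conflict k m t : (0 < k)%N -> (k < m)%N ->
  (1 - shift_time m t) * shift_time k t = 0.
Proof.
move=> k0 km; have [tk|kt] := leP t k.+1%:R^-1.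
  rewrite /shift_time (clamp01_le0 (t := (t - _) * (k%:R * _))) ?mulr0//.
  by rewrite mulr_le0_ge0// subr_le0.
rewrite [shift_time m t]/shift_time clamp01_ge1 ?subrr ?mul0r//.
have m0 : (0 : R) < m%:R by rewrite ltr0n (leq_trans _ km).
have mt : m%:R^-1 <= t.
  by apply: le_trans (ltW kt); rewrite lef_pV2 ?posrE// ler_nat.
have E1 : (m%:R^-1 - m.+1%:R^-1) * (m%:R * m.+1%:R) = 1 :> R.
  rewrite mulrBl mulKf ?gt_eqF// [X in _ - X]mulrC mulfK ?pnatr_eq0//.
  by rewrite -natrB// subSnn.
rewrite -[leLHS]E1.
by rewrite ler_wpM2r// lerB.
Qed.

(** At time 1 the frame of [i] differs from that of [Lambda] by the orthogonal factor [Th i] on the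
    right, which its projection does not see. *)
Lemma represents_gauge_homotopic phi iota iota' (Omega Lambda : Z1 U d eps) f f' :
  weights U phi -> enumeration iota -> enumeration iota' ->
  (forall j, iota j < iota' j)%N -> cohomologous U Omega Lambda ->
  represents f phi iota Omega -> represents f' phi iota' Lambda -> homotopic R f f'.
Proof.
move=> wphi enum enum' iota_lt [Th gT LE] fE f'E.
pose s (j : I) (p : B * R) := shift_time (iota j) p.2.
have wrho := weights_comp fst_continuous wphi.
have [|||H HE] := two_block_map (g := fst) (s := s) Omega
   oU fst_continuous wrho gT enum enum' eps0.
- move=> j p; apply: (@continuous_comp _ _ _ snd (shift_time (iota j))); first exact: cvg_snd.
  apply: continuous_comp; last exact: clamp01_continuous.
  by apply: cvgM; [apply: cvgB; [exact: cvg_id|exact: cst_continuous]|exact: cst_continuous].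
- by move=> j p; exact: clamp01_bounds.
- move=> j k x E; rewrite /s E mulrC.
  by rewrite mulrC shift_time_conflict//; exact: enum.2.
apply: (homotopic_ends (H := H)) => y; apply: GrThick_eq; rewrite HE ?fE ?f'E.
  apply: mean_pull => i//.
  apply: (@block_frame_Phi _ fst phi iota Omega _ (y, 0 : R)) => j p r.
  by rewrite /two_block /s shift_time0 subr0 mulr1 mulr0 sqrtr0 mul0r addr0.
rewrite eq_cl_matrix_mean.
pose W := two_block fst (fun i p => phi i p.1) s Th iota iota'.
pose F i y := block_frame fst W Omega i (y, 1).
have -> : mean (fun i p => phi i p.1) (block_frame fst W Omega) (y, 1) = mean phi F y.
  exact: mean_pull.
have [n /nbhs_singleton bn] := two_block_bnd_near d iota iota' wrho (y, 1).
have bn' : Phi_bnd phi iota' n y by move=> j rj; have [] := bn j rj.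
have [rows _] := Phi_frame Lambda wphi enum' bn'.
have rowsF : rows_bounded F n y.
  move=> i p c np; apply: (block_frame_bounded fst Omega
    (@two_block_rows _ _ _ _ _ fst (fun i p => phi i p.1) s Th iota iota') bn) => //.
apply: (mean_eq wphi rowsF rows) => i Ui.
have [_ ls _ _] := wphi; have [u uu /nbhs_singleton u0] := ls y.
have FE : frame F n i y = \sum_(j <- u)
   (Num.sqrt (phi j y) *: coord_mx R d n iota' j) *m (Th j y *m (Omega i j y)^T).
  have <- : frame (block_frame fst W Omega) n i (y, 1) = frame F n i y by [].
  rewrite (@block_frameE _ _ _ _ _ fst (fun i p => phi i p.1) _ Omega
    (@two_block0 _ _ _ _ _ fst (fun i p => phi i p.1) s Th iota iota') n i (y, 1) u uu u0).
  apply: eq_bigr => j _.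
  rewrite two_block_mx /s /= shift_time1; last exact: enum.2.
  by rewrite subrr mulr0 sqrtr0 scale0r add0r mulr1 -!scalemxAl mulmxA.
have GE : frame (Phi phi iota' Lambda) n i y = \sum_(j <- u)
   (Num.sqrt (phi j y) *: coord_mx R d n iota' j) *m (Lambda i j y)^T.
  rewrite -Phi_two_block (@block_frameE _ _ _ _ _ id phi _ Lambda
    (@two_block0 _ _ _ _ _ id phi (fun _ _ => 0) Theta1 iota' iota') n i y u uu u0).
  apply: eq_bigr => j _; rewrite two_block_mx subr0 mulr1 mulr0 sqrtr0.
  by rewrite scale0r addr0.
have -> : frame (Phi phi iota' Lambda) n i y = frame F n i y *m (Th i y)^T.
  rewrite GE FE mulmx_suml; apply: eq_bigr => j _.
  have [Uj|nUj] := pselect (U j y); last first.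
    have [sV _ _ _] := wphi.
    by rewrite (subordinate0 (sV j) nUj) sqrtr0 scale0r !mul0mx.
  rewrite LE// !trmx_mul orthogonal_inv ?trmxK -?mulmxA//.
  exact: (gT j).2.
rewrite trmx_mul trmxK -mulmxA (mulmxA _^T (Th i y)).
have -> : (Th i y)^T *m Th i y = 1%:M by exact: (gT i).2.
by rewrite mul1mx.
Qed.

Lemma represents_homotopic phi phi' iota iota' (Omega Lambda : Z1 U d eps) f f' :
  weights U phi -> weights U phi' -> enumeration iota -> enumeration iota' ->
  cohomologous U Omega Lambda ->
  represents f phi iota Omega -> represents f' phi' iota' Lambda -> homotopic R f f'.
Proof.
move=> wphi wphi' enum enum' OL fE f'E.
(* A common target exceeding both enumerations, as the shift requires; it is injective because the
   exponent of 2 recovers [iota]. *)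
pose iota2 j := (2 ^ iota j * 3 ^ iota' j)%N.
have lt1 j : (iota j < iota2 j)%N.
  by rewrite /iota2; apply: leq_trans (ltn_expl _ (ltnSn 1)) _; rewrite leq_pmulr// expn_gt0.
have lt2 j : (iota' j < iota2 j)%N.
  by rewrite /iota2; apply: leq_trans (@ltn_expl 3 _ isT) _; rewrite leq_pmull// expn_gt0.
have enum2 : enumeration iota2.
  split; last by move=> i; rewrite muln_gt0 !expn_gt0.
  move=> i j /(congr1 (logn 2)); rewrite !lognM ?expn_gt0// !lognX /=.
  by rewrite !(@logn_prime 2)// !muln1 !muln0 !addn0 => /enum.1.
have [f1 f1E] := represents_exists Omega wphi' enum.
have [f2 f2E] := represents_exists Lambda wphi' enum2.
apply: homotopic_trans (represents_phi_homotopic wphi wphi' enum fE f1E) _.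
apply: homotopic_trans (represents_gauge_homotopic wphi' enum enum2 lt1 OL f1E f2E) _.
apply: homotopic_sym.
exact: represents_gauge_homotopic wphi' enum' enum2 lt2 (cohomologous_refl _ _) f'E f2E.
Qed.

End Map.
End Represents.

(** * Stability *)


Section Distances.
Context (R : realType) (B : topologicalType) (I : choiceType) (U : I -> set B).
Context (d : nat).
Implicit Types Omega Lambda : I -> I -> B -> 'M[R]_d.

Lemma frobenius_orthogonal (A : 'M[R]_d) : Defs.orthogonal A -> frobenius A = Num.sqrt d%:R.
Proof. by move=> oA; rewrite /frobenius (oA : _ *m _ = _) mxtrace1. Qed.

(** The supremum of the empty set is 0, hence the condition [0 <= M]. *)
Lemma sup_le (A : set R) M : 0 <= M -> (forall x, A x -> x <= M) -> sup A <= M.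
Proof.
move=> M0 AM; have [A0|nA] := pselect (A !=set0); first exact: ge_sup.
have -> : A = set0 by apply/seteqP; split=> // x Ax; apply: nA; exists x.
by rewrite sup0.
Qed.

Lemma sup_ge0 (A : set R) : (forall x, A x -> 0 <= x) -> 0 <= sup A.
Proof.
move=> A0; have [hs|/sup_out ->//] := pselect (has_sup A).
by case: (hs) => -[x Ax] ub; apply: le_trans (A0 x Ax) _; exact: sup_upper_bound.
Qed.

Lemma dZ_ge0 Omega Lambda : 0 <= dZ U Omega Lambda.
Proof.
by apply: sup_ge0 => _ [ij _ <-]; apply: sup_ge0 => _ [y _ <-]; exact: frobenius_ge0.
Qed.

Lemma dZ_le Omega Lambda M : 0 <= M ->
  (forall i j y, U j y -> U i y -> frobenius (Omega i j y - Lambda i j y) <= M) ->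
  dZ U Omega Lambda <= M.
Proof.
move=> M0 le; apply: sup_le => // _ [[i j] _ <-].
by apply: sup_le => // _ [y [Uj Ui] <-]; exact: le.
Qed.

(** A supremum bounds its elements only when the set is bounded; orthogonal matrices have norm
    [sqrt d], so [2 sqrt d] bounds all the differences. *)
Lemma frobenius_le_dZ Omega Lambda i j y : cochain U Omega -> cochain U Lambda ->
  U j y -> U i y -> frobenius (Omega i j y - Lambda i j y) <= dZ U Omega Lambda.
Proof.
move=> [_ oO _ _] [_ oL _ _] Uj Ui.
pose M : R := Num.sqrt d%:R + Num.sqrt d%:R.
have bound i' j' z : U j' z -> U i' z ->
    frobenius (Omega i' j' z - Lambda i' j' z) <= M.
  move=> Uj' Ui'; apply: le_trans (frobeniusD _ _) _; rewrite frobeniusN.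
  by rewrite !frobenius_orthogonal//; [exact: oL|exact: oO].
have M0 : 0 <= M by rewrite addr_ge0 ?sqrtr_ge0.
apply: (@le_trans _ _ (sup [set frobenius (Omega i j z - Lambda i j z) | z in U j `&` U i])).
  apply: ub_le_sup; last by exists y.
  by exists M => _ [z [? ?] <-]; exact: bound.
apply: ub_le_sup.
  exists M => _ [[i' j'] _ <-]; apply: sup_le => // _ [z [? ?] <-]; exact: bound.
by exists (i, j) => //; exists y.
Qed.

Lemma dH_lt_dZ (eps : R) (c c' : H1 U d eps) (delta : R) : dH c c' < delta ->
  exists Omega Lambda : Z1 U d eps, [/\ H1_class Omega = c, H1_class Lambda = c' &
    dZ U Omega Lambda < delta].
Proof.
have reprE (e : H1 U d eps) : H1_class (repr e) = e by rewrite /H1_class reprK.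
move=> lt; have [|_ [Om OE] [La LE] <-] := inf_lt _ lt.
  exists (dZ U (repr c) (repr c')); exists (repr c) => //; exists (repr c') => //.
by exists Om, La.
Qed.

Lemma dH_le_dZ (eps : R) (Omega Lambda : Z1 U d eps) :
  dH (H1_class Omega) (H1_class Lambda) <= dZ U Omega Lambda.
Proof.
apply: ge_inf; last by exists Omega => //; exists Lambda.
by exists 0 => _ [Om _ [La _ <-]]; exact: dZ_ge0.
Qed.

End Distances.

Section Stability.
Context (R : realType) (B : topologicalType) (I : choiceType) (U : I -> set B).
Context (d : nat) (eps : R).
Hypothesis oU : forall i, open (U i).
Hypothesis eps0 : 0 <= eps.
Context (phi : I -> B -> R) (iota : I -> nat).
Hypothesis wphi : weights U phi.
Hypothesis enum : enumeration iota.

Lemma Phi_close (Omega Lambda : Z1 U d eps) (M : R) n i y : 0 <= M ->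
  Phi_bnd d phi iota n y ->
  (forall j, U j y -> frobenius (Omega i j y - Lambda i j y) <= M) ->
  frobenius (frame (Phi phi iota Omega) n i y - frame (Phi phi iota Lambda) n i y) <= M.
Proof.
move=> M0 bn OL.
have bn' : two_block_bnd d phi iota iota n y by move=> j /bn.
have s01 (j : I) (x : B) : 0 <= (0 : R) <= 1 by rewrite lexx ler01.
have conf (j k : I) (x : B) : iota j = iota k -> (1 - 0) * 0 = 0 :> R by rewrite mulr0.
pose W := two_block id phi (fun _ _ => 0) (fun _ _ => 1%:M : 'M[R]_d) iota iota.
have orth := two_block_orth (g := id) (s := fun _ _ => 0) wphi
  (@gauge1 R B I U d) enum enum s01 conf.
have [sV ls phi0 sum1] := wphi; have [s us /nbhs_singleton s0] := ls y.
have E (O : Z1 U d eps) : frame (Phi phi iota O) n i y =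
    \sum_(j <- s) block W n j y *m (O i j y)^T.
  rewrite -Phi_two_block; apply: block_frameE us s0 => j x.
  exact: two_block0.
rewrite !E -sumrB.
under eq_bigr do rewrite -mulmxBr.
rewrite -ler_sqr ?nnegrE ?frobenius_ge0// sqr_frobenius.
rewrite (mul_block_sum orth _ _ bn' us) raddf_sum /=.
rewrite -[leRHS]mul1r -(sum1 y) (fsbig_seqT us)// mulr_suml.
apply: ler_sum => j _; rewrite mxtraceZ -sqr_frobenius.
have [Uj|nUj] := pselect (U j y); last by rewrite (subordinate0 (sV j) nUj) !mul0r.
by rewrite ler_wpM2l// ler_sqr ?nnegrE ?frobenius_ge0// -trmxB frobenius_tr OL.
Qed.

(** Both maps lie, at each point, in the ball of radius [eta] about the projection of one frame
    [F l] of [Omega], and balls are convex. A frame of [Lambda] is compared with the frame of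
    [Omega] of the same index, then with [F l], at cost [sqrt 2 * M + sqrt 2 * eps] with
    [M < delta]. *)
Lemma represents_stable (delta : R) (delta0 : 0 <= delta) (Omega Lambda : Z1 U d eps) f f' :
  dZ U Omega Lambda < delta ->
  represents f phi iota Omega -> represents f' phi iota Lambda ->
  homotopic R (GrThick_incl d eps0 delta0 \o f : continuousType _ _)
    (GrThick_incl d eps0 delta0 \o f' : continuousType _ _).
Proof.
move=> dd fE f'E; set M := dZ U Omega Lambda in dd.
have M0 : 0 <= M by exact: dZ_ge0.
have delta_gt0 : 0 < delta by exact: le_lt_trans dd.
pose eta := Num.sqrt 2 * (eps + delta).
have sqrt2 : 0 < Num.sqrt 2 :> R by rewrite sqrtr_gt0.
have eta_gt0 : 0 < eta by rewrite mulr_gt0// ltr_wpDl.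
pose K (p : B * R) : nat -> nat -> R := fun a b =>
  (1 - clamp01 p.2) * val (f p.1) a b + clamp01 p.2 * val (f' p.1) a b.
have bndK y : exists n, Phi_bnd d phi iota n y.
  by have [n /nbhs_singleton bn] := Phi_bnd_near d iota y wphi; exists n.
have bK n p : Phi_bnd d phi iota n p.1 ->
    [/\ bounded_by n (val (f p.1)), bounded_by n (val (f' p.1)) & bounded_by n (K p)].
  move=> bn.
  have b1 : bounded_by n (val (f p.1)).
    rewrite [infmx_val _]fE; apply: mean_bounded.
    by have [rows _] := Phi_frame eps0 Omega wphi enum bn.
  have b2 : bounded_by n (val (f' p.1)).
    rewrite [infmx_val _]f'E; apply: mean_bounded.
    by have [rows _] := Phi_frame eps0 Lambda wphi enum bn.
  by split=> // a b ab; rewrite /K b1// b2// !mulr0 addr0.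
have exK p : exists n (A : 'M[R]_n), K p = mxpad A.
  have [n bn] := bndK p.1; exists n, (trunc n (K p)); rewrite mxpad_trunc//.
  by have [] := bK n p bn.
pose H0 p := Infmx (exK p).
have H0thick p : H0 p \in Gr_thick R d eta.
  rewrite inE /Gr_thick gt_eqF//; have [n bn] := bndK p.1.
  have [b1 b2 b3] := bK n p bn.
  have [l [Ul _]] := weights_in wphi p.1.
  have [rO [oO _]] := Phi_frame eps0 Omega wphi enum bn.
  have [rL [oL _]] := Phi_frame eps0 Lambda wphi enum bn.
  pose F i := frame (Phi phi iota Omega) n i p.1.
  pose G i := frame (Phi phi iota Lambda) n i p.1.
  pose P := F l *m (F l)^T.
  have FF i : U i p.1 -> frobenius (F i *m (F i)^T - P) <= Num.sqrt 2 * eps.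
    move=> Ui; have := Phi_frames_close eps0 Omega wphi enum bn Ui Ul.
    case: ifP => [_ ->|_ /ltW//].
    by rewrite subrr frobenius0 mulr_ge0// ltW.
  have lt_eta : Num.sqrt 2 * M + Num.sqrt 2 * eps < eta.
    by rewrite -mulrDr /eta addrC ltr_pM2l// ltrD2l.
  have FP i : U i p.1 -> frobenius (F i *m (F i)^T - P) < eta.
    move=> Ui; apply: le_lt_trans (FF i Ui) (le_lt_trans _ lt_eta).
    by rewrite lerDr mulr_ge0// ltW.
  have GP i : U i p.1 -> frobenius (G i *m (G i)^T - P) < eta.
    move=> Ui; apply: le_lt_trans (frobeniusB_le _ (F i *m (F i)^T) _) _.
    apply: le_lt_trans lt_eta; apply: lerD; last exact: FF.
    apply: le_trans (frobenius_proj (oL i Ui) (oO i Ui)) _.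
    rewrite ler_pM2l// frobeniusBC Phi_close// => j Uj.
    exact: frobenius_le_dZ (Z1_cochain Omega) (Z1_cochain Lambda) Uj Ui.
  have [_ ls _ _] := wphi; have [s us /nbhs_singleton s0] := ls p.1.
  have c1 : frobenius (trunc n (val (f p.1)) - P) < eta.
    rewrite [infmx_val _]fE eq_cl_matrix_mean (trunc_mean _ _ us s0).
    exact: (convex_frobenius wphi).
  have c2 : frobenius (trunc n (val (f' p.1)) - P) < eta.
    rewrite [infmx_val _]f'E eq_cl_matrix_mean (trunc_mean _ _ us s0).
    exact: (convex_frobenius wphi).
  exists (to_infmx P); first by apply/Grn_Gr/frame_Grn/oO.
  rewrite -(@to_infmx_trunc _ n (H0 p) b3) infmx_dist_mxpad.
  have -> : trunc n (K p) - P = (1 - clamp01 p.2) *: (trunc n (val (f p.1)) - P) +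
      clamp01 p.2 *: (trunc n (val (f' p.1)) - P).
    by apply/matrixP => a b; rewrite !mxE /K; ring.
  apply: le_lt_trans (frobeniusD _ _) _; rewrite !frobeniusZ.
  have /andP[c0 c01] := clamp01_bounds p.2.
  rewrite !ger0_norm ?subr_ge0//.
  have [->|cN0] := eqVneq (clamp01 p.2) 0; first by rewrite subr0 mul1r mul0r addr0.
  have c_gt0 : 0 < clamp01 p.2 by rewrite lt_neqAle eq_sym cN0.
  have -> : eta = (1 - clamp01 p.2) * eta + clamp01 p.2 * eta by ring.
  apply: ler_ltD; last by rewrite ltr_pM2l.
  by rewrite ler_wpM2l ?subr_ge0// ltW.
have [|H HE] := @continuousType_of _ (GrThick d eta) (fun p => exist _ (H0 p) (H0thick p)).
  apply: set_type_continuous; apply: infmx_continuous => [a b p|p].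
    have cfst : continuous (fst : B * R -> B) by move=> q; exact: cvg_fst.
    have csnd : {for p, continuous (fun q : B * R => clamp01 q.2)}.
      apply: (@continuous_comp _ _ _ snd (@clamp01 R)); first exact: cvg_snd.
      exact: clamp01_continuous.
    have cval (h : continuousType B (GrThick d (Num.sqrt 2 * eps))) :
        {for p, continuous (fun q : B * R => val (h q.1) a b)}.
      apply: (@continuous_comp _ _ _ fst (fun y => val (h y) a b)); first exact: cfst.
      apply: (@continuous_comp _ _ _ h (fun z => set_val z a b)); first exact: cts_fun.
      exact: set_infmx_coord_continuous.
    apply: cvgD; apply: cvgM; rewrite //; try exact: cval.
    by apply: cvgB; [exact: cst_continuous|exact: csnd].
  have [n nN] := Phi_bnd_near d iota p.1 wphi; exists n.
  have : \forall q \near p, Phi_bnd d phi iota n q.1 by exact: cvg_fst nN.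
  by apply: filterS => q bn; have [] := bK n q bn.
apply: (homotopic_ends (H := H)) => y; apply: GrThick_eq; rewrite HE /=;
  apply/funext => a; apply/funext => b; rewrite /K /=.
- by rewrite clamp01_le0// subr0 mul1r mul0r addr0.
- by rewrite clamp01_ge1// subrr mul0r mul1r add0r.
Qed.

End Stability.

(** * Inverse square roots of matrices *)


Section InverseSquareRoot.
Context (R : realType) (d : nat).
Implicit Types X Y Z : 'M[R]_d.

(* A fixed point [Y] gives the square root [1 - Y] of [1 - X]. *)
Definition sqrt_step X Y : 'M[R]_d := 2^-1 *: (X + Y *m Y).

Lemma sqrt_step_lip X X' Y Y' : frobenius Y <= 2^-1 -> frobenius Y' <= 2^-1 ->
  frobenius (sqrt_step X Y - sqrt_step X' Y') <=
  2^-1 * (frobenius (X - X') + frobenius (Y - Y')).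
Proof.
move=> hY hY'; rewrite /sqrt_step -scalerBr frobeniusZ ger0_norm ?invr_ge0//.
rewrite ler_pM2l ?invr_gt0// opprD addrACA.
apply: le_trans (frobeniusD _ _) _; rewrite lerD2l.
have -> : Y *m Y - Y' *m Y' = Y *m (Y - Y') + (Y - Y') *m Y'.
  by rewrite mulmxBr mulmxBl addrA subrK.
apply: le_trans (frobeniusD _ _) _.
have e0 := frobenius_ge0 (Y - Y').
apply: le_trans (lerD (frobeniusM _ _) (frobeniusM _ _)) _.
have h1 : frobenius Y * frobenius (Y - Y') <= 2^-1 * frobenius (Y - Y').
  by rewrite ler_wpM2r.
have h2 : frobenius (Y - Y') * frobenius Y' <= frobenius (Y - Y') * 2^-1.
  by rewrite ler_wpM2l.
by lra.
Qed.

Lemma sqrt_step_ball X Y : frobenius X <= 2^-1 -> frobenius Y <= 2^-1 ->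
  frobenius (sqrt_step X Y) <= 2^-1.
Proof.
move=> hX hY; rewrite /sqrt_step frobeniusZ ger0_norm ?invr_ge0//.
have h1 := frobeniusD X (Y *m Y); have h2 := frobeniusM Y Y.
have : frobenius Y * frobenius Y <= 2^-1 * 2^-1.
  by rewrite ler_pM ?frobenius_ge0.
by move=> h3; lra.
Qed.

(** On the ball of radius 1/2 the step at least halves distances, so a point of least displacement
    in this compact ball is fixed: one more step would halve the displacement. *)
Lemma sqrt_step_fix X : frobenius X <= 2^-1 ->
  exists2 Y, frobenius Y <= 2^-1 & sqrt_step X Y = Y.
Proof.
move=> hX; pose K := [set Y : 'M[R]_d | frobenius Y <= 2^-1].
have cK : compact K.
  apply: (@frobenius_bounded_compact _ _ _ _ 2^-1) => //.
  apply: (preimage_closed (f := @frobenius R d d) (D := [set x | x <= 2^-1])).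
    by move=> Y _; exact: frobenius_continuous.
  exact: closed_le.
have K0 : K !=set0 by exists 0; rewrite /K /= frobenius0 invr_ge0.
have cstep : continuous (fun Y => frobenius (sqrt_step X Y - Y)).
  move=> Y; apply: (@continuous_comp _ _ _ (fun Y => sqrt_step X Y - Y)); last first.
    exact: frobenius_continuous.
  have cid := @idmx_continuous R d d.
  apply: addmx_continuous; last exact: oppmx_continuous.
  apply: scalemx_continuous; first exact: cst_continuous.
  apply: addmx_continuous; first exact: cstmx_continuous.
  exact: mulmx_continuous.
have [|Y] := compact_EVT_min K0 cK (f := fun Y => frobenius (sqrt_step X Y - Y)).
  exact: continuous_subspaceT.
rewrite inE => KY minY; exists Y => //.
have KF : sqrt_step X Y \in K by rewrite inE; exact: sqrt_step_ball.
have := minY _ KF.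
have := sqrt_step_lip X X (set_mem KF) KY; rewrite subrr frobenius0 add0r.
have := frobenius_ge0 (sqrt_step X Y - Y) => h0 h1 h2.
apply/eqP; rewrite -subr_eq0; apply/eqP/frobenius_eq0; lra.
Qed.

(** Multiplication by [1 - Y] shrinks norms by at most a factor 2. This gives invertibility and also
    controls the inverse. *)
Lemma mul_unitB_ge m Y (A : 'M[R]_(d, m)) : frobenius Y <= 2^-1 ->
  frobenius A <= 2 * frobenius ((1%:M - Y) *m A).
Proof.
move=> hY; have := frobeniusD ((1%:M - Y) *m A) (Y *m A).
rewrite -mulmxDl subrK mul1mx => h1; have h2 := frobeniusM Y A.
have : frobenius Y * frobenius A <= 2^-1 * frobenius A.
  by rewrite ler_wpM2r ?frobenius_ge0.
by move=> h3; lra.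
Qed.

Lemma unitB_unitmx Y : frobenius Y <= 2^-1 -> 1%:M - Y \in unitmx.
Proof.
move=> hY; rewrite -unitmx_tr -row_free_unit -kermx_eq0.
apply/eqP; rewrite -[LHS]trmxK; apply/eqP; rewrite trmx_eq0; apply/eqP/frobenius_eq0.
apply/eqP; rewrite eq_le frobenius_ge0 andbT.
apply: le_trans (mul_unitB_ge _ hY) _.
by rewrite -[(1%:M - Y) *m _]trmxK trmx_mul trmxK mulmx_ker trmx0 frobenius0 mulr0.
Qed.

(** [Z X] is the inverse of [1 - Y] for the fixed point [Y], as [(1 - Y)^2 = 1 - X]. It is symmetric
    because the transpose of [Y] is fixed as well and fixed points are unique. The constant 4 comes
    from the resolvent identity, whose two inverses cost a factor 2 each. *)
Lemma inverse_sqrt_exists : exists Z : 'M[R]_d -> 'M[R]_d,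
  (forall X, X^T = X -> frobenius X <= 2^-1 -> frobenius X <= \tr X ->
    [/\ (Z X)^T = Z X, Z X *m (1%:M - X) *m Z X = 1%:M &
        d%:R - \tr ((1%:M - X) *m Z X) <= \tr X]) /\
  (forall X X', frobenius X <= 2^-1 -> frobenius X' <= 2^-1 ->
    frobenius (Z X - Z X') <= 4 * frobenius (X - X')).
Proof.
have /choice[S SP] X : exists Y, frobenius X <= 2^-1 ->
    frobenius Y <= 2^-1 /\ sqrt_step X Y = Y.
  have [hX|nX] := pselect (frobenius X <= 2^-1); last by exists 0.
  by have [Y hY E] := sqrt_step_fix hX; exists Y.
have S_lip X X' Y Y' : frobenius Y <= 2^-1 -> sqrt_step X Y = Y ->
    frobenius Y' <= 2^-1 -> sqrt_step X' Y' = Y' ->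
    frobenius (Y - Y') <= frobenius (X - X').
  move=> hY EY hY' EY'; have := sqrt_step_lip X X' hY hY'; rewrite EY EY' => h; lra.
exists (fun X => invmx (1%:M - S X)); split=> [X sX hX tX|X X' hX hX'].
  have [hY EY] := SP X hX; set Y := S X in hY EY *.
  have uH := unitB_unitmx hY.
  have sY : Y^T = Y.
    apply/eqP; rewrite -subr_eq0; apply/eqP/frobenius_eq0/eqP.
    rewrite eq_le frobenius_ge0 andbT.
    apply: le_trans (S_lip X X _ _ _ _ hY EY) _; last by rewrite subrr frobenius0.
      by rewrite frobenius_tr.
    by rewrite -[in RHS]EY /sqrt_step trmxZ trmxD trmx_mul sX.
  have HH : 1%:M - X = (1%:M - Y) *m (1%:M - Y).
    have XE : X = Y + Y - Y *m Y.
      have : 2 *: Y = X + Y *m Y.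
        by rewrite -[in LHS]EY /sqrt_step scalerA mulfV ?pnatr_eq0// scale1r.
      by rewrite scaler_nat mulr2n => ->; rewrite addrK.
    rewrite mulmxBl mul1mx mulmxBr mulmx1 XE.
    by rewrite !opprD !opprK !addrA.
  have HZ : (1%:M - X) *m invmx (1%:M - Y) = 1%:M - Y.
    by rewrite HH -mulmxA mulmxV// mulmx1.
  split.
  - by rewrite trmx_inv trmxB trmx1 sY.
  - by rewrite -mulmxA HZ mulVmx.
  - rewrite HZ raddfB /= mxtrace1 opprB addrC subrK.
    (* The goal is now [tr Y <= tr X]. The two bounds that follow give [|Y|^2 <= |X| / 3], and
       [|X| <= tr X] by hypothesis. *)
    have trY : 2 * \tr Y = \tr X + frobenius Y ^+ 2.
      rewrite -[in LHS]EY /sqrt_step mxtraceZ mulrA mulfV ?pnatr_eq0// mul1r mxtraceD.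
      by rewrite sqr_frobenius sY.
    have Ybound : frobenius Y <= 2^-1 * (frobenius X + frobenius Y * frobenius Y).
      rewrite -[leLHS](congr1 (@frobenius R d d) EY) /sqrt_step frobeniusZ.
      rewrite ger0_norm ?invr_ge0// ler_pM2l ?invr_gt0//.
      by apply: le_trans (frobeniusD _ _) _; rewrite lerD2l frobeniusM.
    have YY : frobenius Y * frobenius Y <= 2^-1 * frobenius Y.
      by rewrite ler_wpM2r ?frobenius_ge0.
    have y0 := frobenius_ge0 Y.
    by rewrite expr2 in trY; lra.
have [hY EY] := SP X hX; have [hY' EY'] := SP X' hX'.
have lip := S_lip _ _ _ _ hY EY hY' EY'.
set Y := S X in hY EY lip *; set Y' := S X' in hY' EY' lip *.
have uH := unitB_unitmx hY; have uH' := unitB_unitmx hY'.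
have E : invmx (1%:M - Y) - invmx (1%:M - Y') =
    invmx (1%:M - Y) *m (Y - Y') *m invmx (1%:M - Y').
  have -> : Y - Y' = (1%:M - Y') - (1%:M - Y).
    by apply/matrixP => a b; rewrite !mxE; ring.
  by rewrite mulmxBr mulVmx// mulmxBl mul1mx -mulmxA mulmxV// mulmx1.
have h1 : frobenius ((Y - Y') *m invmx (1%:M - Y')) <= 2 * frobenius (Y - Y').
  rewrite -[leLHS]frobenius_tr -[frobenius (Y - Y')]frobenius_tr.
  have hT : frobenius Y'^T <= 2^-1 by rewrite frobenius_tr.
  apply: le_trans (mul_unitB_ge _ hT) _.
  have -> : 1%:M - Y'^T = (1%:M - Y')^T by rewrite trmxB trmx1.
  by rewrite -trmx_mul -mulmxA mulVmx// mulmx1.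
rewrite E -mulmxA; apply: le_trans (mul_unitB_ge _ hY) _.
by rewrite mulKVmx//; lra.
Qed.

End InverseSquareRoot.

(** * Polar frames *)


Section PolarFrame.
Context (R : realType) (d n : nat).
Implicit Types (F G : 'M[R]_(n, d)) (P : 'M[R]_n).

(** Expanding the square gives [|P - F F^T|^2 = d - 2 d + d]: [d] orthonormal columns in the image
    of a projection of rank [d] span it. *)
Lemma frame_projection F P : Grn R d n P -> F^T *m F = 1%:M -> P *m F = F ->
  F *m F^T = P.
Proof.
move=> GP oF PF; have [sP PP tP] := GrnP GP.
apply/eqP; rewrite eq_sym -subr_eq0; apply/eqP/frobenius_eq0/eqP.
rewrite -sqrf_eq0 sqr_frobeniusB (sqr_frobenius_Grn GP).
rewrite (sqr_frobenius_Grn (_ : Grn R d n (F *m F^T))); last first.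
  apply/GrnE; split; first by rewrite trmx_mul trmxK.
    by rewrite -[RHS]mulmxA (mulmxA F^T) oF mul1mx.
  by rewrite mxtrace_mulC oF mxtrace1.
rewrite sP mulmxA PF mxtrace_mulC oF mxtrace1; apply/eqP; ring.
Qed.

Context (F : 'M[R]_(n, d)) (P : 'M[R]_n).
Hypothesis GP : Grn R d n P.
Hypothesis oF : F^T *m F = 1%:M.

(** The Gram matrix of [(1 - P) F], the part of the frame outside the image of [P]. Its complement
    [1 - defect] is the Gram matrix of [P F], whose inverse square root makes [P F] orthonormal. *)
Definition defect : 'M[R]_d := 1%:M - F^T *m P *m F.

Lemma defect_tr : defect^T = defect.
Proof.
have [sP _ _] := GrnP GP.
by rewrite /defect trmxB trmx1 !trmx_mul trmxK sP mulmxA.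
Qed.

Lemma mxtrace_defect : 2 * \tr defect = frobenius (F *m F^T - P) ^+ 2.
Proof.
have [sP PP tP] := GrnP GP.
rewrite sqr_frobeniusB (sqr_frobenius_Grn GP).
rewrite (frobenius_isometry _ oF) frobenius_tr sqr_frobenius oF mxtrace1.
rewrite trmx_mul trmxK -mulmxA [\tr (F *m _)]mxtrace_mulC.
by rewrite /defect raddfB /= mxtrace1; ring.
Qed.

Lemma defect_le : frobenius defect <= \tr defect.
Proof.
have [sP PP tP] := GrnP GP.
have -> : defect = ((1%:M - P) *m F)^T *m ((1%:M - P) *m F).
  rewrite trmx_mul trmxB trmx1 sP mulmxA -(mulmxA F^T).
  have -> : (1%:M - P) *m (1%:M - P) = 1%:M - P.
    by rewrite mulmxBl mul1mx mulmxBr mulmx1 PP subrr subr0.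
  by rewrite mulmxBr mulmx1 mulmxBl oF.
apply: le_trans (frobeniusM _ _) _.
by rewrite frobenius_tr -expr2 sqr_frobenius.
Qed.

Hypothesis close : frobenius (F *m F^T - P) < 1.

(** The trace of the defect is half of [|F F^T - P|^2], so distance 1 is the limit at which the
    inverse square root is still available. *)
Lemma defect_half : frobenius defect <= 2^-1.
Proof.
apply: le_trans defect_le _.
have : frobenius (F *m F^T - P) ^+ 2 <= 1 by rewrite expr_le1 ?frobenius_ge0// ltW.
by rewrite -mxtrace_defect => h; lra.
Qed.

(** Both frames are orthonormal, so [|F - P F Z|^2 = 2 d - 2 tr ((1 - defect) Z)]; the trace bound
    on [Z] turns this into at most [2 tr defect], the square of the right-hand side. *)
Lemma polar_frame (Z : 'M[R]_d) : Z^T = Z -> Z *m (1%:M - defect) *m Z = 1%:M ->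
  d%:R - \tr ((1%:M - defect) *m Z) <= \tr defect ->
  [/\ (P *m F *m Z)^T *m (P *m F *m Z) = 1%:M,
      (P *m F *m Z) *m (P *m F *m Z)^T = P &
      frobenius (F - P *m F *m Z) <= frobenius (F *m F^T - P)].
Proof.
move=> sZ ZZ trZ; have [sP PP tP] := GrnP GP.
have GE : 1%:M - defect = F^T *m P *m F by rewrite /defect opprB addrC subrK.
have oPsi : (P *m F *m Z)^T *m (P *m F *m Z) = 1%:M.
  rewrite !trmx_mul sZ sP -ZZ GE -!mulmxA; congr (_ *m (_ *m _)).
  by rewrite !mulmxA PP.
split=> //.
  by apply: frame_projection => //; rewrite !mulmxA PP.
rewrite frobenius_le -mxtrace_defect sqr_frobeniusB.
have -> : frobenius F ^+ 2 = d%:R by rewrite sqr_frobenius oF mxtrace1.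
have -> : frobenius (P *m F *m Z) ^+ 2 = d%:R by rewrite sqr_frobenius oPsi mxtrace1.
rewrite !mulmxA -GE; lra.
Qed.

End PolarFrame.

Section PointwiseContinuity.
Context (R : realType) (X : topologicalType) (x : X).

Lemma mx_continuous_at m n (f : X -> 'M[R]_(m, n)) :
  (forall i j, {for x, continuous (fun y => f y i j)}) -> {for x, continuous f}.
Proof.
move=> cf P [Q Qf QP].
apply: (@filterS _ (nbhs x) _ (fun z => forall i j, Q i j (f z i j))).
  by move=> z Qz; apply: QP.
apply: filter_forall => i; apply: filter_forall => j.
exact: (cf i j _ (Qf i j)).
Qed.

Lemma entry_continuous_at m n (f : X -> 'M[R]_(m, n)) i j :
  {for x, continuous f} -> {for x, continuous (fun y => f y i j)}.
Proof.
move=> cf; apply: (@continuous_comp _ _ _ f (fun M : 'M[R]_(m, n) => M i j)) => //.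
exact: coord_continuous.
Qed.

Lemma mulmx_continuous_at m n p (f : X -> 'M[R]_(m, n)) (g : X -> 'M[R]_(n, p)) :
  {for x, continuous f} -> {for x, continuous g} ->
  {for x, continuous (fun y => f y *m g y)}.
Proof.
move=> cf cg; apply: mx_continuous_at => i j.
under [X in {for x, continuous X}]funext => y do rewrite mxE.
by apply: sum_continuous_at => k; apply: cvgM; exact: entry_continuous_at.
Qed.

Lemma trmx_continuous_at m n (f : X -> 'M[R]_(m, n)) :
  {for x, continuous f} -> {for x, continuous (fun y => (f y)^T)}.
Proof.
move=> cf; apply: mx_continuous_at => i j.
under [X in {for x, continuous X}]funext => y do rewrite mxE.
exact: entry_continuous_at.
Qed.

Lemma subcst_continuous_at m n (A : 'M[R]_(m, n)) (f : X -> 'M[R]_(m, n)) :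
  {for x, continuous f} -> {for x, continuous (fun y => A - f y)}.
Proof.
move=> cf; apply: mx_continuous_at => i j.
under [X in {for x, continuous X}]funext => y do rewrite !mxE.
by apply: cvgB; [exact: cst_continuous|exact: entry_continuous_at].
Qed.

Lemma lipschitz_continuous_at m n m' n' (D : set 'M[R]_(m, n)) (k : R)
    (Z : 'M[R]_(m, n) -> 'M[R]_(m', n')) (f : X -> 'M[R]_(m, n)) : 0 < k ->
  (forall A A', D A -> D A' -> frobenius (Z A - Z A') <= k * frobenius (A - A')) ->
  (\forall y \near x, D (f y)) -> {for x, continuous f} ->
  {for x, continuous (fun y => Z (f y))}.
Proof.
move=> k0 lip Df cf; have Dfx := nbhs_singleton Df.
apply: mx_continuous_at => i j; apply/cvgrPdist_lt => e e0.
have cfrob : {for x, continuous (fun y => frobenius (f x - f y))}.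
  apply: (@continuous_comp _ _ _ (fun y => f x - f y) (@frobenius R m n)).
    exact: subcst_continuous_at.
  exact: frobenius_continuous.
have near_e : \forall y \near x, frobenius (f x - f y) < e / k.
  have := cfrob [set t | t < e / k]; apply; apply: open_nbhs_nbhs; split.
    exact: open_lt.
  by rewrite /= subrr frobenius0 divr_gt0.
apply: filterS2 Df near_e => y Dfy ye.
have -> : Z (f x) i j - Z (f y) i j = (Z (f x) - Z (f y)) i j by rewrite !mxE.
apply: le_lt_trans (entry_le_frobenius _ _ _) _.
apply: le_lt_trans (lip _ _ Dfx Dfy) _.
by rewrite mulrC -ltr_pdivlMr.
Qed.

End PointwiseContinuity.

(** * Nearby exact cocycles *)


Lemma frame_eq (R : realType) (X : topologicalType) (I : choiceType) d
   (F : I -> X -> nat -> 'I_d -> R) n i x p c (pn : (p < n)%N) :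
  frame F n i x (Ordinal pn) c = F i x p c.
Proof. by rewrite mxE. Qed.

Section ExactCocycle.
Context (R : realType) (B : topologicalType) (I : choiceType) (U : I -> set B).
Context (d : nat) (eps : R).
Hypothesis oU : forall i, open (U i).
Hypothesis eps_gt0 : 0 < eps.
Context (phi : I -> B -> R) (iota : I -> nat) (Omega : Z1 U d eps).
Hypothesis wphi : weights U phi.
Hypothesis enum : enumeration iota.
Context (P : B -> infmx R).
Hypothesis cP : forall p q, continuous (fun y => P y p q).
Hypothesis GP : forall y, Gr R d (P y).
Hypothesis suppP : forall y p,
  (forall q, cl_matrix phi iota Omega y p q = 0 /\ cl_matrix phi iota Omega y q p = 0) ->
  forall q, P y p q = 0.
Hypothesis closeP : forall n y i, Phi_bnd d phi iota n y -> U i y ->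
  frobenius (frame (Phi phi iota Omega) n i y *m (frame (Phi phi iota Omega) n i y)^T -
    trunc n (P y)) < Num.min 1 (2 * Num.sqrt 2 * eps).
Context (Z : 'M[R]_d -> 'M[R]_d).
Hypothesis ZP : forall X, X^T = X -> frobenius X <= 2^-1 -> frobenius X <= \tr X ->
    [/\ (Z X)^T = Z X, Z X *m (1%:M - X) *m Z X = 1%:M &
        d%:R - \tr ((1%:M - X) *m Z X) <= \tr X].
Hypothesis Z_lip : forall X X', frobenius X <= 2^-1 -> frobenius X' <= 2^-1 ->
    frobenius (Z X - Z X') <= 4 * frobenius (X - X').

Let eps0 : 0 <= eps := ltW eps_gt0.
Let F n i y := frame (Phi phi iota Omega) n i y.
Let bnd n y := Phi_bnd d phi iota n y.

Lemma P_sym y p q : P y p q = P y q p.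
Proof.
have [k bk] := infmx_bounded (P y).
have [sN _ _] := GrnP (Gr_trunc bk (GP y)).
have [kp|pk] := leqP k p; first by rewrite !bk ?kp ?orbT.
have [kq|qk] := leqP k q; first by rewrite !bk ?kq ?orbT.
by have /matrixP/(_ (Ordinal qk) (Ordinal pk)) := sN; rewrite !mxE.
Qed.

(** [P y] inherits the zero rows of the mean, so a size that suits the frames suits it too. *)
Lemma P_bounded n y : bnd n y -> bounded_by n (P y).
Proof.
move=> bn; have [rows _] := Phi_frame eps0 Omega wphi enum bn.
have bm := mean_bounded phi rows.
have h p q : (n <= p)%N -> P y p q = 0.
  by move=> np; apply: suppP => r; rewrite !eq_cl_matrix_mean !bm ?np ?orbT.
by move=> p q /orP[/h//|/h]; rewrite P_sym.
Qed.

Let Pm n y := trunc n (P y).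

Lemma Pm_Grn n y : bnd n y -> Grn R d n (Pm n y).
Proof. by move=> bn; apply: Gr_trunc => //; exact: P_bounded. Qed.

(** The matrix [F^T P F] without a choice of size: [n] exists only locally, whereas [Psi] and the
    cocycle must be defined on all of [B]. *)
Definition gram i y : 'M[R]_d := \matrix_(c, c')
  \sum_(q \in [set: nat]) (\sum_(p \in [set: nat]) Phi phi iota Omega i y p c * P y p q) *
    Phi phi iota Omega i y q c'.

Lemma gramE n i y : bnd n y -> gram i y = (F n i y)^T *m Pm n y *m F n i y.
Proof.
move=> bn; have [rows _] := Phi_frame eps0 Omega wphi enum bn.
apply/matrixP => c c'; rewrite !mxE (@fsum_ord R n) => [|q nq]; last first.
  by rewrite rows ?mulr0.
apply: eq_bigr => q _; rewrite !mxE; congr (_ * _).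
rewrite (@fsum_ord R n) => [|p np]; last by rewrite rows ?mul0r.
by apply: eq_bigr => p _; rewrite !mxE.
Qed.

Definition Psi i y p c := \sum_(q \in [set: nat]) P y p q *
  \sum_c' Phi phi iota Omega i y q c' * Z (1%:M - gram i y) c' c.

Lemma Psi_frame n i y : bnd n y ->
  frame Psi n i y = Pm n y *m F n i y *m Z (defect (F n i y) (Pm n y)).
Proof.
move=> bn; have [rows _] := Phi_frame eps0 Omega wphi enum bn.
rewrite /defect -gramE//; apply/matrixP => p c; rewrite -mulmxA mxE.
rewrite /Psi (@fsum_ord R n) => [|q nq]; last first.
  by rewrite (P_bounded bn) ?nq ?orbT// mul0r.
rewrite mxE; apply: eq_bigr => q _; rewrite !mxE; congr (_ * _).
by apply: eq_bigr => c' _; rewrite !mxE.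
Qed.

Lemma Psi_rows n y : bnd n y -> rows_bounded Psi n y.
Proof.
by move=> bn i p c np; rewrite /Psi fsbig1// => q _; rewrite (P_bounded bn) ?np// mul0r.
Qed.

Lemma Psi_polar n i y : bnd n y -> U i y ->
  [/\ (frame Psi n i y)^T *m frame Psi n i y = 1%:M,
      frame Psi n i y *m (frame Psi n i y)^T = Pm n y &
      frobenius (F n i y - frame Psi n i y) <= 2 * Num.sqrt 2 * eps].
Proof.
move=> bn Ui; have [_ [ oF _]] := Phi_frame eps0 Omega wphi enum bn.
have {}oF := oF i Ui; have GPn := Pm_Grn bn.
have := closeP bn Ui; rewrite lt_min => /andP[c1 c2].
have [sZ ZZ trZ] := ZP (defect_tr _ GPn) (defect_half GPn oF c1) (defect_le GPn oF).
have [q1 q2 q3] := polar_frame GPn oF sZ ZZ trZ.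
by rewrite Psi_frame//; split=> //; apply: le_trans q3 (ltW c2).
Qed.

Let bnd_near (y : B) : exists n, \forall z \near y, bnd n z.
Proof. exact: (Phi_bnd_near d iota y wphi). Qed.

Lemma F_continuous n i y : U i y -> {for y, continuous (F n i)}.
Proof.
move=> Ui; apply: mx_continuous_at => p c.
under [X in {for y, continuous X}]funext => z do rewrite mxE.
exact: Phi_continuous.
Qed.

Lemma Psi_frame_continuous n i (y : B) : U i y -> (\forall z \near y, bnd n z) ->
  {for y, continuous (fun z => frame Psi n i z)}.
Proof.
move=> Ui bn.
have E : {near y, (fun z => Pm n z *m F n i z *m Z (defect (F n i z) (Pm n z))) =1
    (fun z => frame Psi n i z)}.
  by apply: filterS bn => z bz; rewrite Psi_frame.
apply: near_eq_continuous E _.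
have cF := @F_continuous n i y Ui.
have cPm : {for y, continuous (Pm n)}.
  apply: mx_continuous_at => p q; under [X in {for y, continuous X}]funext => z do rewrite mxE.
  exact: cP.
apply: mulmx_continuous_at; first exact: mulmx_continuous_at.
apply: (@lipschitz_continuous_at _ _ _ _ _ _ _ [set X | frobenius X <= 2^-1] 4) => //.
  have Uz : \forall z \near y, U i z by apply: open_nbhs_nbhs.
  apply: filterS2 bn Uz => z bz Uz /=.
  have [_ [ oF _]] := Phi_frame eps0 Omega wphi enum bz.
  have := closeP bz Uz; rewrite lt_min => /andP[c1 _].
  exact: defect_half (Pm_Grn bz) (oF i Uz) c1.
have cT := trmx_continuous_at cF; have cTP := mulmx_continuous_at cT cPm.
have cD := @subcst_continuous_at R B y d d 1%:M _ (mulmx_continuous_at cTP cF).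
by rewrite /defect.
Qed.

Lemma Psi_continuous i y : U i y -> forall p c,
  {for y, continuous (fun z => Psi i z p c)}.
Proof.
move=> Ui p c; have [n bn] := bnd_near y.
have [np|pn] := leqP n p.
  have E : {near y, (fun=> 0) =1 (fun z => Psi i z p c)}.
    by apply: filterS bn => z bz; rewrite (Psi_rows bz).
  by apply: near_eq_continuous E _; exact: cst_continuous.
have := @entry_continuous_at R B y n d _ (Ordinal pn) c (Psi_frame_continuous Ui bn).
by under [X in {for y, continuous X}]funext => z do rewrite frame_eq.
Qed.

Definition exact_cochain i j y : 'M[R]_d :=
  if `[< (U j `&` U i) y >] then
    \matrix_(c, c') \sum_(p \in [set: nat]) Psi i y p c * Psi j y p c' else 0.

Lemma exact_cochainE n i j y : bnd n y -> U j y -> U i y ->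
  exact_cochain i j y = (frame Psi n i y)^T *m frame Psi n j y.
Proof.
move=> bn Uj Ui; rewrite /exact_cochain asboolT//.
apply/matrixP => c c'; rewrite !mxE (@fsum_ord R n) => [|p np]; last first.
  by rewrite (Psi_rows bn)// mul0r.
by apply: eq_bigr => p _; rewrite !mxE.
Qed.

(** [Psi_j Psi_j^T] is [P] for every [j], and [Psi_i^T P = Psi_i^T], so the middle frame drops
    out. *)
Lemma exact_cochain_cocycle i j k y : U k y -> U j y -> U i y ->
  exact_cochain i j y *m exact_cochain j k y = exact_cochain i k y.
Proof.
move=> Uk Uj Ui; have [n /nbhs_singleton bn] := bnd_near y.
rewrite !(@exact_cochainE n)// !mulmxA -(mulmxA (frame Psi n i y)^T).
have [_ -> _] := Psi_polar bn Uj.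
have [ orth_i <- _] := Psi_polar bn Ui.
by rewrite mulmxA orth_i mul1mx.
Qed.

Lemma exact_cochain_tr i j y : U j y -> U i y ->
  (exact_cochain i j y)^T = exact_cochain j i y.
Proof.
move=> Uj Ui; have [n /nbhs_singleton bn] := bnd_near y.
by rewrite !(@exact_cochainE n)// trmx_mul trmxK.
Qed.

Lemma exact_cochain_orthogonal i j y : U j y -> U i y ->
  Defs.orthogonal (exact_cochain i j y).
Proof.
move=> Uj Ui; rewrite /Defs.orthogonal /= exact_cochain_tr// exact_cochain_cocycle//.
have [n /nbhs_singleton bn] := bnd_near y.
by rewrite (@exact_cochainE n)//; have [] := Psi_polar bn Uj.
Qed.

Lemma exact_cochainP : cochain U exact_cochain.
Proof.
split.
- move=> i j; apply: continuous_in_subspaceT => y; rewrite inE => -[Uj Ui].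
  have [n bn] := bnd_near y.
  have Uij : \forall z \near y, (U j `&` U i) z.
    by apply: open_nbhs_nbhs; split=> //; exact: openI.
  have E : {near y, (fun z => (frame Psi n i z)^T *m frame Psi n j z) =1 exact_cochain i j}.
    by apply: filterS2 bn Uij => z bz [Ujz Uiz]; rewrite (@exact_cochainE n).
  apply: near_eq_continuous E _.
  apply: mulmx_continuous_at; last exact: Psi_frame_continuous.
  by apply: trmx_continuous_at; exact: Psi_frame_continuous.
- by move=> i j y Uj Ui; exact: exact_cochain_orthogonal.
- move=> i j y Uj Ui; rewrite orthogonal_inv ?exact_cochain_tr//.
  exact: exact_cochain_orthogonal.
- by move=> i j y nU; rewrite /exact_cochain asboolF.
Qed.

Definition exact_cocycle : Z1 U d (0 : R).
Proof.
apply: (@MkZ1 _ _ _ _ _ _ _ exact_cochainP) => i j k y Uk Uj Ui.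
by rewrite eqxx exact_cochain_cocycle.
Defined.

(** [F_i^T F_j] is within [eps] of [Omega_ij]; exchanging its factors for polar frames one at a time
    costs [2 sqrt 2 eps] each, and [sqrt 2 <= 2]. *)
Lemma exact_cochain_close i j y : U j y -> U i y ->
  frobenius (Omega i j y - exact_cochain i j y) <= 9 * eps.
Proof.
move=> Uj Ui; have [n /nbhs_singleton bn] := bnd_near y.
have [_ [ oF tF]] := Phi_frame eps0 Omega wphi enum bn.
have := tF i j Ui Uj; rewrite gt_eqF// -/(F n i y) -/(F n j y) => close.
have {}oF k : U k y -> (F n k y)^T *m F n k y = 1%:M by move=> Uk; exact: oF.
have [ oPi _ ci] := Psi_polar bn Ui; have [ oPj _ cj] := Psi_polar bn Uj.
rewrite (exact_cochainE bn)//.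
move: (frame Psi n i y) (frame Psi n j y) oPi ci oPj cj => Pi Pj oPi ci oPj cj.
have h1 : frobenius (Omega i j y - (F n i y)^T *m F n j y) <= eps.
  rewrite -[X in X - _]mul1mx -(oF i Ui) -mulmxA -mulmxBr.
  exact: le_trans (frobenius_trisometry _ (oF i Ui)) (ltW close).
have h2 : frobenius ((F n i y)^T *m F n j y - Pi^T *m Pj) <=
    frobenius (F n j y - Pj) + frobenius (F n i y - Pi).
  have -> : (F n i y)^T *m F n j y - Pi^T *m Pj =
      (F n i y)^T *m (F n j y - Pj) + (Pj^T *m (F n i y - Pi))^T.
    rewrite trmx_mul trmxK trmxB mulmxBr mulmxBl addrA subrK//.
  apply: le_trans (frobeniusD _ _) _; rewrite frobenius_tr.
  by apply: lerD; apply: frobenius_trisometry => //; exact: oF.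
have sqrt2 : Num.sqrt 2 <= 2 :> R.
  by rewrite -[leRHS]ger0_norm// -sqrtr_sqr ler_wsqrtr// expr2 ler_peMl// ler1n.
have := frobeniusB_le (Omega i j y) ((F n i y)^T *m F n j y) (Pi^T *m Pj).
have : Num.sqrt 2 * eps <= 2 * eps by rewrite ler_wpM2r.
by move=> h3 h4; lra.
Qed.

Lemma Psi_transition n i l y : bnd n y -> U i y -> U l y ->
  frame Psi n i y *m exact_cochain i l y = frame Psi n l y.
Proof.
move=> bn Ui Ul; rewrite (exact_cochainE bn)// mulmxA.
have [_ -> _] := Psi_polar bn Ui; have [ orth_l <- _] := Psi_polar bn Ul.
by rewrite -mulmxA orth_l mulmx1.
Qed.

Lemma mean_Psi y : mean phi Psi y = P y.
Proof.
have [n /nbhs_singleton bn] := bnd_near y.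
have [sV ls _ sum1] := wphi; have [s us /nbhs_singleton s0] := ls y.
rewrite -(mxpad_trunc (mean_bounded phi (Psi_rows bn))) -(mxpad_trunc (P_bounded bn)).
congr mxpad; rewrite (trunc_mean _ _ us s0).
rewrite -[RHS]scale1r -(sum1 y) (fsbig_seqT us)// scaler_suml.
apply: eq_bigr => i _; have [Ui|nUi] := pselect (U i y).
  by have [_ -> _] := Psi_polar bn Ui.
by rewrite (subordinate0 (sV i) nUi) !scale0r.
Qed.

Section Homotopy.
Context (iota' : I -> nat).
Hypothesis enum' : enumeration iota'.
Hypothesis disjoint : forall j k, iota j <> iota' k.

(** Rows reserved by [iota'] are zero in every frame built with [iota], hence in the mean, hence in
    [P] by [suppP], hence in [Psi]. *)
Lemma rows_disjoint i l y p c c' :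
  Psi i y p c * Phi phi iota' exact_cochain l y p c' = 0.
Proof.
have [[j [r pE]]|no] := pselect (exists j (r : 'I_d), p.+1 = (d * iota' j + r)%N).
  suff Pp q : P y p q = 0.
    by rewrite /Psi fsbig1 ?mul0r// => q _; rewrite Pp mul0r.
  apply: suppP => q'.
  have Phi0 k c1 : Phi phi iota Omega k y p c1 = 0.
    rewrite /Phi fsbig1// => j' _; rewrite big_pred0// => r'; apply/eqP.
    by rewrite pE => /block_index_inj[]// E _; exact: (disjoint (esym E)).
  split; rewrite /cl_matrix fsbig1// => k _; rewrite big1 ?mulr0// => c1 _.
    by rewrite Phi0 mul0r.
  by rewrite Phi0 mulr0.
rewrite [X in _ * X]/Phi fsbig1 ?mulr0// => j _; rewrite big_pred0// => r.
by apply/eqP => E; apply: no; exists j, r.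
Qed.

(** Disjoint rows keep the path of frames orthonormal, and [Psi] and [Phi'] obey the same exact
    transition law. So the frames over a point share one projection at every time, and the mean
    never leaves the Grassmannian. *)
Lemma exact_homotopic (h : continuousType B (GrSpace R d))
    (f : continuousType B (GrThick d (Num.sqrt 2 * 0 : R))) :
  (forall y, set_val (h y) = P y) -> represents f phi iota' exact_cocycle ->
  homotopic R h (GrThick_exact R d \o f : continuousType _ _).
Proof.
move=> hE fE.
have fst_continuous : continuous (fst : B * R -> B) by move=> p; exact: cvg_fst.
have wphi1 := weights_comp fst_continuous wphi.
pose Phi' i y := Phi phi iota' exact_cochain i y.
pose G i (p : B * R) a c := Num.sqrt (1 - clamp01 p.2) * Psi i p.1 a c +
  Num.sqrt (clamp01 p.2) * Phi' i p.1 a c.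
pose bnd2 n (p : B * R) := bnd n p.1 /\ Phi_bnd d phi iota' n p.1.
have GE n i p : frame G n i p = Num.sqrt (1 - clamp01 p.2) *: frame Psi n i p.1 +
    Num.sqrt (clamp01 p.2) *: frame Phi' n i p.1.
  by apply/matrixP => a c; rewrite !mxE.
have eps00 : (0 : R) <= 0 by [].
have rowsG n p : bnd2 n p -> rows_bounded G n p.
  move=> [b1 b2] i a c na; rewrite /G (Psi_rows b1)//.
  have [rows _] := Phi_frame eps00 exact_cocycle wphi enum' b2.
  by rewrite /Phi' rows// !mulr0 addr0.
have oG n p i : bnd2 n p -> U i p.1 -> (frame G n i p)^T *m frame G n i p = 1%:M.
  move=> [b1 b2] Ui.
  have [_ [oF _]] := Phi_frame eps00 exact_cocycle wphi enum' b2.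
  have {}oF : (frame Phi' n i p.1)^T *m frame Phi' n i p.1 = 1%:M := oF i Ui.
  have [oP _ _] := Psi_polar b1 Ui.
  have dis : (frame Psi n i p.1)^T *m frame Phi' n i p.1 = 0.
    apply/matrixP => c c'; rewrite !mxE big1// => a _; rewrite !mxE.
    exact: rows_disjoint.
  have dis' : (frame Phi' n i p.1)^T *m frame Psi n i p.1 = 0.
    by rewrite -[LHS]trmxK trmx_mul trmxK dis trmx0.
  have /andP[c0 c1] := clamp01_bounds p.2.
  rewrite GE trmxD !trmxZ mulmxDl !mulmxDr -!scalemxAl -!scalemxAr oP oF dis dis'.
  rewrite !scaler0 addr0 add0r !scalerA -!expr2 !sqr_sqrtr ?subr_ge0//.
  by rewrite -scalerDl subrK scale1r.
have [||||H HE] := @mean_map R _ I d (fun i => fst @^-1` U i) (fun i p => phi i p.1)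
  G wphi1 bnd2 rowsG (Num.sqrt 2 * 0).
- move=> i p Ui a c; apply: cvgD; apply: cvgM.
  + apply: (@continuous_comp _ _ _ (fun q : B * R => 1 - clamp01 q.2) Num.sqrt).
      apply: cvgB; first exact: cst_continuous.
      apply: (@continuous_comp _ _ _ snd (@clamp01 R)); first exact: cvg_snd.
      exact: clamp01_continuous.
    exact: sqrt_continuous.
  + apply: (@continuous_comp _ _ _ fst (fun y => Psi i y a c)); first exact: cvg_fst.
    exact: Psi_continuous.
  + apply: (@continuous_comp _ _ _ (fun q : B * R => clamp01 q.2) Num.sqrt).
      apply: (@continuous_comp _ _ _ snd (@clamp01 R)); first exact: cvg_snd.
      exact: clamp01_continuous.
    exact: sqrt_continuous.
  + apply: (@continuous_comp _ _ _ fst (fun y => Phi' i y a c)); first exact: cvg_fst.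
    have h1 := @Phi_continuous R B I U d oU 0 phi iota' exact_cocycle i p.1 wphi Ui a c.
    exact h1.
- move=> p; have [n1 b1] := bnd_near p.1.
  have [n2 b2] := Phi_bnd_near d iota' p.1 wphi; exists (maxn n1 n2).
  have {}b1 : \forall q \near p, bnd n1 q.1 by exact: cvg_fst b1.
  have {}b2 : \forall q \near p, Phi_bnd d phi iota' n2 q.1 by exact: cvg_fst b2.
  apply: filterS2 b1 b2 => q b1 b2; split=> j rj.
    by apply: leq_trans (b1 j rj) _; exact: leq_maxl.
  by apply: leq_trans (b2 j rj) _; exact: leq_maxr.
- exact: oG.
- move=> n p i l [b1 b2] Ui Ul; rewrite mulr0 eqxx.
  have [_ [_ tF]] := Phi_frame eps00 exact_cocycle wphi enum' b2.
  have := tF i l Ui Ul; rewrite eqxx => {}tF.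
  have GL : frame G n i p *m exact_cochain i l p.1 = frame G n l p.
    by rewrite !GE mulmxDl -!scalemxAl (Psi_transition b1)// tF.
  rewrite -GL trmx_mul -mulmxA (mulmxA (exact_cochain _ _ _)).
  rewrite exact_cochain_tr// exact_cochain_cocycle//.
  have -> : exact_cochain i i p.1 = 1%:M.
    by rewrite (exact_cochainE b1)//; have [] := Psi_polar b1 Ui.
  by rewrite mul1mx.
apply: (homotopic_ends (H := (GrThick_exact R d \o H : continuousType _ _))) => y.
  apply: val_inj; apply: infmx_eq.
  rewrite -[RHS]/(infmx_val (set_val (h y))) hE -mean_Psi.
  rewrite -[LHS]/(infmx_val (set_val (H (y, 0)))) HE; apply: mean_pull => // i.
  apply/funext => a; apply/funext => c.
  by rewrite /G /= clamp01_le0// subr0 sqrtr1 mul1r sqrtr0 mul0r addr0.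
apply: val_inj; apply: infmx_eq.
rewrite -[LHS]/(infmx_val (set_val (H (y, 1)))) HE.
rewrite -[RHS]/(infmx_val (set_val (f y))) fE eq_cl_matrix_mean.
apply: mean_pull => // i; apply/funext => a; apply/funext => c.
by rewrite /G /= clamp01_ge1// subrr sqrtr0 mul0r add0r sqrtr1 mul1r.
Qed.

End Homotopy.

End ExactCocycle.

(** * The class map *)


Lemma countable_enumeration (I : choiceType) : countable [set: I] ->
  exists iota : I -> nat, enumeration iota.
Proof.
case/countable_injP => g /in2TT ginj.
by exists (fun i => (g i).+1); split=> // i j [] /ginj.
Qed.

Section Class.
Context (R : realType) (B : topologicalType) (I : choiceType) (U : I -> set B).
Context (d : nat).
Hypothesis oU : forall i, open (U i).
Context (phi : I -> B -> R) (iota : I -> nat).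
Hypothesis wphi : weights U phi.
Hypothesis enum : enumeration iota.

Definition cl_class (eps : R) (eps0 : 0 <= eps) (c : H1 U d eps) :
    homotopy_classes R B (GrThick d (Num.sqrt 2 * eps)) :=
  homotopy_class R (projT1 (cid (represents_exists oU eps0 (repr c) wphi enum))).

(** [cl_class] fixes a representative, [phi] and [iota]; any other choice may be used to compute
    it. *)
Lemma cl_classE (eps : R) (eps0 : 0 <= eps) (Omega : Z1 U d eps) phi' iota' f :
  weights U phi' -> enumeration iota' -> represents f phi' iota' Omega ->
  cl_class eps0 (H1_class Omega) = homotopy_class R f.
Proof.
move=> wphi' enum' fE; apply/homotopy_classP; case: cid => /= f0 f0E.
apply: (represents_homotopic oU eps0 wphi wphi' enum enum' _ f0E fE).
by apply/H1_classP; rewrite /H1_class reprK.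
Qed.

Lemma cl_class_stable (eps delta : R) (eps0 : 0 <= eps) (delta0 : 0 <= delta)
    (c c' : H1 U d eps) : dH c c' < delta ->
  pushforward_class (GrThick_incl d eps0 delta0) (cl_class eps0 c) =
  pushforward_class (GrThick_incl d eps0 delta0) (cl_class eps0 c').
Proof.
move=> /dH_lt_dZ[Om [La [<- <- lt]]].
have [f fE] := represents_exists oU eps0 Om wphi enum.
have [f' f'E] := represents_exists oU eps0 La wphi enum.
rewrite (cl_classE _ wphi enum fE) (cl_classE _ wphi enum f'E) !pushforward_classE.
by apply/homotopy_classP; exact: represents_stable lt fE f'E.
Qed.

Lemma GrThick_exact_closest :
  forall A : GrThick d (Num.sqrt 2 * 0 : R),
    is_closest d (set_val A) (set_val (GrThick_exact R d A)).
Proof.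
move=> A; split; first exact: (set_valP (GrThick_exact R d A)).
move=> Q _ QA; rewrite infmx_distxx lt_neqAle infmx_dist_ge0 andbT eq_sym.
by apply/eqP => /infmx_dist_eq0 E; apply: QA; rewrite -E.
Qed.

Lemma dH_H1_incl0 (c : H1 U d (0 : R)) :
  dH c (H1_incl (lexx 0) (lexx 0) c) <= 9 * 0.
Proof.
rewrite -[c]reprK -/(H1_class (repr c)) H1_inclE mulr0.
apply: le_trans (dH_le_dZ _ _) _; apply: dZ_le => // i j y _ _.
by rewrite subrr frobenius0.
Qed.

Lemma cl_class_exact (eps : R) (eps0 : 0 <= eps) : 0 < eps -> eps <= Num.sqrt 2 / 4 ->
  exists pi : continuousType (GrThick d (Num.sqrt 2 * eps)) (GrSpace R d),
    (forall A, is_closest d (set_val A) (set_val (pi A))) /\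
    forall c : H1 U d eps, exists Lambda : H1 U d 0,
      pushforward_class pi (cl_class eps0 c) =
        pushforward_class (GrThick_exact R d) (cl_class (lexx 0) Lambda) /\
      dH c (H1_incl (lexx 0) eps0 Lambda) <= 9 * eps.
Proof.
move=> eps_gt0 eps_le.
have sqrt2 : 0 < Num.sqrt 2 :> R by rewrite sqrtr_gt0.
have eta0 : 0 < Num.sqrt 2 * eps by rewrite mulr_gt0.
have eta_le : Num.sqrt 2 * eps <= 2^-1.
  have : Num.sqrt 2 * eps <= Num.sqrt 2 * (Num.sqrt 2 / 4) by rewrite ler_pM2l.
  by rewrite mulrA -expr2 sqr_sqrtr// => h; lra.
have [pi0 [cpi0 pi0P]] := closest_retraction d eta0 eta_le.
have [pi piE] := continuousType_of cpi0.
exists pi; split=> [A|c]; first by rewrite piE; have [] := pi0P A.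
pose iota1 j := (iota j).*2; pose iota2 j := (iota j).*2.+1.
have [iI i0] := enum.
have enum1 : enumeration iota1.
  by split=> [i j /double_inj/iI//|i]; rewrite double_gt0.
have enum2 : enumeration iota2 by split=> // i j [/double_inj/iI].
have disj j k : iota1 j <> iota2 k.
  by move=> /(congr1 odd); rewrite /= !odd_double.
pose Om := repr c.
have cE : c = H1_class Om by rewrite /H1_class reprK.
have [f fE] := represents_exists oU eps0 Om wphi enum1.
pose h : continuousType B (GrSpace R d) := pi \o f.
pose P y := set_val (h y).
have PE y : P y = set_val (pi0 (f y)) by rewrite /P /h /= piE.
have cP p q : continuous (fun y => P y p q).
  move=> y; apply: (@continuous_comp _ _ _ h (fun z => set_val z p q)); first exact: cts_fun.
  exact: set_infmx_coord_continuous.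
have GP y : Gr R d (P y) by exact: set_valP.
have suppP y p : (forall q, cl_matrix phi iota1 Om y p q = 0 /\
    cl_matrix phi iota1 Om y q p = 0) -> forall q, P y p q = 0.
  move=> zero q; rewrite PE; have [_] := pi0P (f y); apply=> q'.
  by rewrite -[infmx_val _]/(infmx_val (set_val (f y))) fE; exact: zero.
have closeP n y i : Phi_bnd d phi iota1 n y -> U i y ->
    frobenius (frame (Phi phi iota1 Om) n i y *m (frame (Phi phi iota1 Om) n i y)^T -
      trunc n (P y)) < Num.min 1 (2 * Num.sqrt 2 * eps).
  move=> bn Ui; have [rows [oF _]] := Phi_frame eps0 Om wphi enum1 bn.
  have bP := P_bounded eps_gt0 wphi enum1 GP suppP bn.
  have bf : bounded_by n (set_val (f y)).
    by rewrite fE; exact: mean_bounded.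
  have := mean_close wphi (Phi_frames_close eps0 Om wphi enum1) bn Ui.
  rewrite gt_eqF// -eq_cl_matrix_mean -fE => close.
  set Q := _ *m _ in close *.
  have bQ := bounded_by_mxpad Q.
  have GQ : Gr R d (to_infmx Q) by apply/Grn_Gr/frame_Grn/oF.
  have cl : is_closest d (set_val (f y)) (P y) by rewrite PE; have [] := pi0P (f y).
  (* [P y] is no farther from [f y] than [Q] is; the triangle inequality doubles the radius
     [sqrt 2 * eps]. *)
  have := is_closest_le cl GQ; rewrite !(@infmx_distE _ n)// trunc_mxpad => le.
  have := frobeniusB_le Q (trunc n (set_val (f y))) (trunc n (P y)).
  rewrite (frobeniusBC Q (trunc n (set_val (f y)))) => tri.
  by rewrite lt_min; apply/andP; split; lra.
have [Z [ZP Z_lip]] := inverse_sqrt_exists R d.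
pose La := exact_cocycle oU eps_gt0 wphi enum1 cP GP suppP closeP ZP Z_lip.
exists (H1_class La).
have [f2 f2E] := represents_exists oU (lexx 0) La wphi enum2.
rewrite cE (cl_classE _ wphi enum1 fE) (cl_classE _ wphi enum2 f2E) !pushforward_classE.
split.
  apply/homotopy_classP.
  exact: (exact_homotopic enum2 disj (h := h) (fun y => erefl) f2E).
rewrite H1_inclE; apply: le_trans (dH_le_dZ _ _) _.
apply: dZ_le => [|i j y Uj Ui]; first by rewrite mulr_ge0.
exact: (exact_cochain_close eps_gt0 wphi enum1 GP suppP closeP ZP Uj Ui).
Qed.

End Class.

Unset Implicit Arguments.

Theorem theorem1 (R : realType) (B : topologicalType) (I : choiceType)
    (U : I -> set B) (d : nat) :
  paracompact B -> open_cover U -> countable [set: I] -> (1 <= d)%N ->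
  (* the choices in the construction of [cl] can be made *)
  (exists phi : I -> B -> R, partition_of_unity U phi) /\
  (exists iota : I -> nat, enumeration iota) /\
  exists cl : forall eps : R, 0 <= eps ->
      H1 U d eps -> homotopy_classes R B (GrThick d (Num.sqrt 2 * eps)),
  [/\ (* [cl] is given by the construction, for all representatives Omega and
         all choices of phi and iota *)
      forall (eps : R) (eps0 : 0 <= eps) (Omega : Z1 U d eps)
        (phi : I -> B -> R) (iota : I -> nat),
        partition_of_unity U phi -> enumeration iota ->
        (forall i y, U i y -> Stiefel R d (Phi phi iota Omega i y)) /\
        exists f : continuousType B (GrThick d (Num.sqrt 2 * eps)),
          (forall y, infmx_val (set_val (f y)) = cl_matrix phi iota Omega y) /\
          cl eps eps0 (H1_class Omega) = homotopy_class R f,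
      (* stability *)
      forall (eps delta : R) (eps0 : 0 <= eps) (delta0 : 0 <= delta)
        (Omega Lambda : H1 U d eps),
        dH Omega Lambda < delta ->
        pushforward_class (GrThick_incl d eps0 delta0) (cl eps eps0 Omega) =
        pushforward_class (GrThick_incl d eps0 delta0) (cl eps eps0 Lambda)
    & (* nearby exact classes *)
      forall (eps : R) (eps0 : 0 <= eps), eps <= Num.sqrt 2 / 4 ->
        exists pi : continuousType (GrThick d (Num.sqrt 2 * eps)) (GrSpace R d),
          (forall A, is_closest d (set_val A) (set_val (pi A))) /\
          forall Omega : H1 U d eps, exists Lambda : H1 U d 0,
            pushforward_class pi (cl eps eps0 Omega) =
              pushforward_class (GrThick_exact R d) (cl 0 (lexx 0) Lambda) /\
            dH Omega (H1_incl (lexx 0) eps0 Lambda) <= 9 * eps].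
Proof.
move=> pB cU cI _; have [oU _] := cU.
have [phi pphi] := paracompact_partition_of_unity pB R cU.
have [iota enum] := countable_enumeration cI.
have wphi := partition_of_unity_weights pphi.
split; first by exists phi.
split; first by exists iota.
exists (fun eps eps0 => cl_class oU wphi enum (eps := eps) eps0); split.
- move=> eps eps0 Omega phi' iota' /partition_of_unity_weights wphi' enum'.
  split; first by move=> i y; exact: Phi_Stiefel.
  have [f fE] := represents_exists oU eps0 Omega wphi' enum'.
  by exists f; split=> //; exact: cl_classE fE.
- by move=> eps delta eps0 delta0 Omega Lambda; exact: cl_class_stable.
- move=> eps eps0; have [eps_gt0|eps_le0] := ltP 0 eps; first exact: cl_class_exact.
  have E : eps = 0 by apply/eqP; rewrite eq_le eps_le0.
  (* At radius 0 the thickening is the Grassmannian itself: the identification serves as [pi], and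
     each class as its own [Lambda]. *)
  subst eps; rewrite (bool_irrelevance eps0 (lexx 0)) => _.
  exists (GrThick_exact R d); split; first exact: GrThick_exact_closest.
  by move=> c; exists c; split=> //; exact: dH_H1_incl0.
Qed.
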